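(* Under the bivariate normal model with parameters $(\mu_1,\mu_2,\beta,\theta,\eta)$ and prior $\pi(\mu_1,\mu_2,\beta,\theta,\eta)\propto(\theta\eta)^{-1}$, the prior $\pi$ achieves matching via distribution functions for each of $\beta$, $\theta$ and $\eta$ individually. That is, for each choice of interest parameter $\psi\in\{\beta,\theta,\eta\}$, let $\hat\psi$ be the maximum likelihood estimator of $\psi$ and put $y=\sqrt{n}(\psi-\hat\psi)/(I^{\psi\psi})^{1/2}$, where $I^{\beta\beta}=\eta^2$, $I^{\theta\theta}=\theta^2$, $I^{\eta\eta}=\eta^2$. Then for each $w\in\mathbb{R}$ and each fixed value $\omega=(\mu_1,\mu_2,\beta,\theta,\eta)$ of the parameter, as $n\to\infty$, $$E_\omega\big[P^\pi(y\le w\mid X)\big]=P_\omega(y\le w)+o(n^{-1}).$$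
   Context: Data: $X=\{(X_{1i},X_{2i}):i=1,\dots,n\}$ ($n\ge 3$) are i.i.d. bivariate normal with means $\mu_1,\mu_2$, variances $\sigma_1^2,\sigma_2^2>0$ and correlation $\rho$, $|\rho|<1$. Reparameterize by $$\beta=\rho\sigma_2/\sigma_1,\qquad \theta=\sigma_1\sigma_2(1-\rho^2)^{1/2},\qquad \eta=\sigma_2(1-\rho^2)^{1/2}/\sigma_1,$$ so that $(\mu_1,\mu_2,\beta,\theta,\eta)$ ranges over $\mathbb{R}^3\times(0,\infty)^2$, and the density of one observation is $$f(x_1,x_2)=(2\pi\theta)^{-1}\exp\Big\{-\tfrac12\Big[\frac{(x_2-\mu_2-\beta(x_1-\mu_1))^2}{\theta\eta}+\frac{\eta(x_1-\mu_1)^2}{\theta}\Big]\Big\}$$ (in this display only, $\pi$ is the usual constant). The improper prior $\pi\propto(\theta\eta)^{-1}$ is a density with respect to Lebesgue measure $d\mu_1\,d\mu_2\,d\beta\,d\theta\,d\eta$; the posterior is obtained by normalizing likelihood times prior. $P^\pi(\cdot\mid X)$ is posterior probability given the data (with $X$, hence $\hat\psi$, fixed and all parameters appearing in $y$ distributed according to the joint posterior). $P_\omega$ and $E_\omega$ denote sampling probability and expectation over the data when the true parameter is $\omega$ (with the parameters appearing in $y$ fixed at their true values inside $P_\omega(y\le w)$). The quantity $I^{\psi\psi}$ is the diagonal entry for $\psi$ of the inverse of the per-observation Fisher information matrix. *)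

(* Defs.v *)
From HB Require Import structures.
From mathcomp Require Import all_boot all_order all_algebra finmap.
From mathcomp Require Import all_classical all_reals all_analysis.

Set Implicit Arguments.
Unset Strict Implicit.
Unset Printing Implicit Defensive.

Import Order.TTheory GRing.Theory Num.Theory.
Import numFieldNormedType.Exports.

Local Open Scope classical_set_scope.
Local Open Scope ring_scope.

Section iid.
Context {d d' : measure_display} {T : measurableType d} {T' : measurableType d'}.
Context {R : realType} (P : probability T R).

Definition mutually_independent (X : nat -> {RV P >-> T'}) : Prop :=
  forall (J : {fset nat}) (A : nat -> set T'),
    (forall i, measurable (A i)) ->
    P (\bigcap_(i in [set` J]) (X i @^-1` A i)) =
    (\prod_(i <- J) P (X i @^-1` A i))%E.

(* i.i.d. with common density f with respect to the reference measure nu *)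
Definition iid_with_density (nu : {measure set T' -> \bar R}) (f : T' -> R)
    (X : nat -> {RV P >-> T'}) : Prop :=
  mutually_independent X /\
  forall i (A : set T'), measurable A ->
    distribution P (X i) A = (\int[nu]_(x in A) (f x)%:E)%E.

End iid.

Section bivariate_normal.
Context {R : realType}.

(* Lebesgue measure on R^2 and on R^5. The library's lebesgue_measure lives on
   measurableTypeR R, that is R with its Borel sets; hence this carrier in the
   type of the observations. *)
Definition leb2 : {measure set (measurableTypeR R * measurableTypeR R)%type -> \bar R} :=
  (@lebesgue_measure R \x @lebesgue_measure R)%E.

Definition leb5 : {measure set (measurableTypeR R * measurableTypeR R *
    measurableTypeR R * measurableTypeR R * measurableTypeR R)%type -> \bar R} :=
  (@lebesgue_measure R \x @lebesgue_measure R \x @lebesgue_measure R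
    \x @lebesgue_measure R \x @lebesgue_measure R)%E.

(* A parameter value is a tuple (mu1, mu2, beta, theta, eta); the components
   are numbered 0, 1, 2, 3, 4 in this order. *)
Definition par (om : R * R * R * R * R) (i : 'I_5) : R :=
  let: (mu1, mu2, beta, theta, eta) := om in
  tnth [tuple mu1; mu2; beta; theta; eta] i.

Definition i_mu1   : 'I_5 := @Ordinal 5 0 isT.
Definition i_mu2   : 'I_5 := @Ordinal 5 1 isT.
Definition i_beta  : 'I_5 := @Ordinal 5 2 isT.
Definition i_theta : 'I_5 := @Ordinal 5 3 isT.
Definition i_eta   : 'I_5 := @Ordinal 5 4 isT.

Definition set_par (om : R * R * R * R * R) (i : 'I_5) (v : R) :
    R * R * R * R * R :=
  let c j := if j == i then v else par om j in
  (c i_mu1, c i_mu2, c i_beta, c i_theta, c i_eta).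

Definition param_space : set (R * R * R * R * R) :=
  [set om | 0 < par om i_theta /\ 0 < par om i_eta].

(* In terms of the standard deviations s1, s2 and the correlation rho:
   beta = rho * s2 / s1, theta = s1 * s2 * sqrt (1 - rho^2) and
   eta = s2 * sqrt (1 - rho^2) / s1. *)
Definition binormal_pdf (om : R * R * R * R * R) (x : R * R) : R :=
  let: (mu1, mu2, beta, theta, eta) := om in
  (2 * pi * theta)^-1 *
  expR (- 2^-1 * ((x.2 - mu2 - beta * (x.1 - mu1)) ^+ 2 / (theta * eta)
                  + eta * (x.1 - mu1) ^+ 2 / theta)).

Definition likelihood n (x : n.-tuple (R * R)) (om : R * R * R * R * R) : R :=
  \prod_(i < n) binormal_pdf om (tnth x i).

Definition is_mle n (x : n.-tuple (R * R)) (om : R * R * R * R * R) : Prop :=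
  param_space om /\
  forall om', param_space om' -> likelihood x om' <= likelihood x om.

(* For n >= 3 the maximizer exists and is unique almost surely; on the
   exceptional null set of samples the value is an irrelevant default. *)
Definition mle n (x : n.-tuple (R * R)) : R * R * R * R * R :=
  xget (0, 0, 0, 1, 1) [set om | is_mle x om].

Definition prior (om : R * R * R * R * R) : R :=
  (par om i_theta * par om i_eta)^-1.

(* P^pi(A | x): likelihood times the improper prior, normalized *)
Definition posterior n (x : n.-tuple (R * R)) (A : set (R * R * R * R * R)) : R :=
  fine (\int[leb5]_(om in param_space `&` A) (likelihood x om * prior om)%:E)%E /
  fine (\int[leb5]_(om in param_space) (likelihood x om * prior om)%:E)%E.

Definition score (om : R * R * R * R * R) (i : 'I_5) (x : R * R) : R :=
  derive1 (fun v => ln (binormal_pdf (set_par om i v) x)) (par om i).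

Definition fisher_info (om : R * R * R * R * R) : 'M[R]_5 :=
  \matrix_(i, j) \int[leb2]_x (score om i x * score om j x * binormal_pdf om x).

(* I^{psi psi} *)
Definition inv_info (om : R * R * R * R * R) (psi : 'I_5) : R :=
  (invmx (fisher_info om)) psi psi.

(* y = sqrt n (psi - psi_hat) / sqrt I^{psi psi}, for parameter om and data x *)
Definition standardized n (psi : 'I_5) (om : R * R * R * R * R)
    (x : n.-tuple (R * R)) : R :=
  Num.sqrt n%:R * (par om psi - par (mle x) psi) /
  Num.sqrt (inv_info om psi).

Definition sample {d : measure_display} {T : measurableType d}
    {P : probability T R} (X : nat -> {RV P >-> (measurableTypeR R * measurableTypeR R)%type}) (n : nat) (t : T) :
    n.-tuple (R * R) :=
  [tuple X i t | i < n].

End bivariate_normal.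

(* Main.v *)
Require Import Defs.
From HB Require Import structures.
From mathcomp Require Import all_boot all_order all_algebra finmap.
From mathcomp Require Import all_classical all_reals all_analysis.
From mathcomp Require Import measurable_realfun ring lra.

Set Implicit Arguments.
Unset Strict Implicit.
Unset Printing Implicit Defensive.

Import Order.TTheory GRing.Theory Num.Theory.
Import numFieldNormedType.Exports.

Local Open Scope classical_set_scope.
Local Open Scope ring_scope.

(** The model is the orbit of the standard bivariate normal law under the lower
    triangular affine group of the plane: the parameter is the group element
    [om] (acting by [gact]), and [1 / (theta * eta)] is the density of the right
    Haar measure. The maximum likelihood estimate [s] is equivariant and
    sufficient, and the standardized value [y] depends only on the pivot
    [om^-1 s], whose sampling law does not depend on [om].

    For [n >= 3] the posterior law of the pivot is almost surely its sampling
    law, so the two sides are equal and not only up to [o(1/n)]. Indeed, weight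
    the posterior mass of [y <= w] at [s] by a test function of [s] divided by
    the likelihood under the true parameter, and integrate over the sample. A
    change of parameter under the integral over [om], then [s = om tau] and right
    invariance, turn the result into [P (y <= w)] times the Haar integral of the
    test function. The posterior mass is thus almost surely proportional to the
    total mass, with factor [P (y <= w)]. The density of the estimate is never
    computed. *)

(** * Integration tools *)

(** Haar measure is infinite, so the parameter cannot simply be averaged out. The test function,
    positive with finite Haar integral, makes the compared integrals finite; restricting it to an
    arbitrary measurable set of estimates turns one identity of integrals into an almost sure
    identity. Dividing by the likelihood at the true parameter changes an expectation under that
    parameter into one under each other parameter. For the event that always holds the factor is 1,
    and the same identity shows that the normalizing constant is almost surely finite. The bound
    [n >= 3] makes degenerate samples null: three independent points with a density are almost
    surely not collinear. On degenerate samples the estimator takes its default value, which has to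
    be carried through the sampling probability. The posterior is not known to be measurable in the
    sample, so its expectation is found by squeezing. The Fisher information serves to identify the
    divisor of [y] as [eta] or [theta], the factor by which the group scales the error of the
    estimate; this is why [y] is a function of the pivot. *)

Section measure_image.
Context d1 d2 (T1 : measurableType d1) (T2 : measurableType d2) (R : realType).

(** Bundled as a measure with its measurability proof explicit, so that lemmas about integrals
    against measures apply to it. *)
Definition image_measure (m : {measure set T1 -> \bar R}) (f : T1 -> T2)
    (mf : measurable_fun setT f) : {measure set T2 -> \bar R} :=
  measure_function_pushforward__canonical__measure_function_Measure m mf.

End measure_image.

Section affine.
Context {R : realType}.
Notation MR := (measurableTypeR R).
Notation mu := (@lebesgue_measure R).
Local Open Scope ereal_scope.

(** By uniqueness of Lebesgue measure: [a] times its image under [x |-> b + a * x] gives every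
    half-open interval its length. *)
Lemma ge0_integral_affine (a b : R) (f : MR -> \bar R) : (0 < a)%R ->
  measurable_fun setT f -> (forall x, 0 <= f x) ->
  \int[mu]_x f x = a%:E * \int[mu]_x f (b + a * x)%R.
Proof.
move=> a0 mf f0.
pose phi (x : MR) : MR := (b + a * x)%R.
have mphi : measurable_fun setT phi.
  by apply: measurable_funD => //; exact: measurable_funM.
pose m := mscale (NngNum (ltW a0)) (image_measure mu mphi).
have mE A : measurable A -> mu A = m A.
  apply: lebesgue_measure_unique => _ [[u v] _ <-].
  have E : phi @^-1` `]u, v]%classic = `](u - b) / a, (v - b) / a]%classic%R.
    apply/seteqP; split => x /=; rewrite !in_itv/= /phi.
      by rewrite ltr_pdivrMr // ler_pdivlMr // ltrBlDl lerBrDl mulrC.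
    by rewrite ltr_pdivrMr // ler_pdivlMr // ltrBlDl lerBrDl mulrC.
  change (mu `]u, v] = a%:E * mu (phi @^-1` `]u, v])); rewrite E.
  rewrite !lebesgue_measure_itv/= !lte_fin ltr_pM2r ?invr_gt0// ltrD2r.
  case: ifPn => _; last by rewrite mule0.
  rewrite -!EFinD -EFinM; congr EFin; field; exact: lt0r_neq0.
rewrite (eq_measure_integral m); last by move=> A mA _; exact: mE.
by rewrite ge0_integral_mscale// ge0_integral_pushforward.
Qed.

End affine.

(** * Closure rules and a tactic for measurability *)

Section measurable_closure.
Context d1 d2 d3 (T : measurableType d1) (T1 : measurableType d2)
  (T2 : measurableType d3) {R : realType}.

Lemma measurable_fun_fst (f : T -> T1 * T2) :
  measurable_fun setT f -> measurable_fun setT (fun x => (f x).1).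
Proof. by move=> mf; exact: (measurableT_comp measurable_fst). Qed.

Lemma measurable_fun_snd (f : T -> T1 * T2) :
  measurable_fun setT f -> measurable_fun setT (fun x => (f x).2).
Proof. by move=> mf; exact: (measurableT_comp measurable_snd). Qed.

Lemma measurable_fun_tnth n (i : 'I_n) (f : T -> n.-tuple T1) :
  measurable_fun setT f -> measurable_fun setT (fun x => tnth (f x) i).
Proof. by move=> mf; exact: (measurableT_comp (measurable_tnth i)). Qed.

(** Inversion is not continuous at 0, so it is rewritten as [x] times the power -1 of [x ^+ 2].
    Squaring gives [powR] a nonnegative base, and the factor [x] gives the value 0 at 0. *)
Lemma measurable_invr : measurable_fun setT (@GRing.inv R).
Proof.
rewrite (_ : @GRing.inv R = fun x => x * powR (x ^+ 2) (-1)).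
  apply: measurable_funM => //.
  have m2 : measurable_fun setT (fun x : R => x ^+ 2) by exact: measurable_funX.
  exact: (measurableT_comp (@measurable_powR R (-1)) m2).
apply/funext => x; rewrite powR_inv1 ?sqr_ge0//.
have [->|x0] := eqVneq x 0; first by rewrite invr0 mul0r.
by field.
Qed.

Lemma measurable_fun_inv (f : T -> R) :
  measurable_fun setT f -> measurable_fun setT (fun x => (f x)^-1).
Proof. by move=> mf; exact: (measurableT_comp measurable_invr). Qed.

Lemma measurable_fun_sqrt (f : T -> R) :
  measurable_fun setT f -> measurable_fun setT (fun x => Num.sqrt (f x)).
Proof.
move=> mf; apply: (measurableT_comp _ mf).
by apply: continuous_measurable_fun; exact: sqrt_continuous.
Qed.

Lemma measurable_fun_expR (f : T -> R) :
  measurable_fun setT f -> measurable_fun setT (fun x => expR (f x)).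
Proof. by move=> mf; exact: (measurableT_comp (@measurable_expR R)). Qed.

Lemma measurable_fun_EFin (f : T -> R) :
  measurable_fun setT f -> measurable_fun setT (fun x => (f x)%:E).
Proof. by move/measurable_EFinP. Qed.

Lemma measurable_fun_natr (f : T -> bool) :
  measurable_fun setT f -> measurable_fun setT (fun x => (f x)%:R : R).
Proof.
by move=> mf; apply: (measurableT_comp (f := fun b : bool => b%:R : R)).
Qed.

Lemma measurable_set_bool (f : T -> bool) :
  measurable_fun setT f -> measurable [set x | f x].
Proof.
by move=> mf; rewrite -[X in measurable X]setTI; exact: (mf measurableT [set true]).
Qed.

End measurable_closure.

Section measurable_coordinates.
Context d (T : measurableType d) {R : realType}.
Notation MR := (measurableTypeR R).
Notation obs := (MR * MR)%type.
Notation param := (MR * MR * MR * MR * MR)%type.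

(** The codomain is [R] rather than [measurableTypeR R]: in this form the rules for real-valued
    functions apply to the coordinates. *)
Lemma measurable_obs1 (f : T -> obs) : measurable_fun setT f ->
  @measurable_fun _ _ T R setT (fun x => (f x).1).
Proof. exact: measurable_fun_fst. Qed.

Lemma measurable_obs2 (f : T -> obs) : measurable_fun setT f ->
  @measurable_fun _ _ T R setT (fun x => (f x).2).
Proof. exact: measurable_fun_snd. Qed.

Lemma measurable_par0 (f : T -> param) : measurable_fun setT f ->
  @measurable_fun _ _ T R setT (fun x => (f x).1.1.1.1).
Proof. by move=> mf; do 4 apply: measurable_fun_fst. Qed.

Lemma measurable_par1 (f : T -> param) : measurable_fun setT f ->
  @measurable_fun _ _ T R setT (fun x => (f x).1.1.1.2).
Proof. by move=> mf; apply: measurable_fun_snd; do 3 apply: measurable_fun_fst. Qed.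

Lemma measurable_par2 (f : T -> param) : measurable_fun setT f ->
  @measurable_fun _ _ T R setT (fun x => (f x).1.1.2).
Proof. by move=> mf; apply: measurable_fun_snd; do 2 apply: measurable_fun_fst. Qed.

Lemma measurable_par3 (f : T -> param) : measurable_fun setT f ->
  @measurable_fun _ _ T R setT (fun x => (f x).1.2).
Proof. by move=> mf; apply: measurable_fun_snd; apply: measurable_fun_fst. Qed.

Lemma measurable_par4 (f : T -> param) : measurable_fun setT f ->
  @measurable_fun _ _ T R setT (fun x => (f x).2).
Proof. by move=> mf; apply: measurable_fun_snd. Qed.

End measurable_coordinates.

Ltac mfun_eta := lazymatch goal with
  | |- measurable_fun _ (fun _ => _) => idtac
  | |- @measurable_fun ?d1 ?d2 ?T1 ?T2 ?D ?f =>
      change (@measurable_fun d1 d2 T1 T2 D (fun x => f x))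
  | _ => idtac
  end.

(** Recursion on the body of the function; a goal with an unlisted head is left to the caller. Eta
    expansion comes first because the patterns match abstractions only. *)
Ltac mfun := cbv beta; try assumption; try mfun_eta;
  lazymatch goal with
  | |- @measurable_fun ?d1 ?d2 ?T1 ?T2 ?D (fun x => x) =>
      exact (@measurable_id d1 T1 D)
  | |- @measurable_fun ?d1 ?d2 ?T1 ?T2 ?D (fun _ => ?a) =>
      exact (@measurable_cst d1 d2 T1 T2 D a)
  | |- measurable_fun _ (fun x => (@?f x).1) =>
      first [apply: measurable_par0 | apply: measurable_obs1
            | apply: measurable_fun_fst]; mfun
  | |- measurable_fun _ (fun x => (@?f x).2) =>
      first [apply: measurable_par1 | apply: measurable_par2
            | apply: measurable_par3 | apply: measurable_par4
            | apply: measurable_obs2 | apply: measurable_fun_snd]; mfun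
  | |- measurable_fun _ (fun x => (@?f x, @?g x)) =>
      apply: measurable_fun_pair; mfun
  | |- measurable_fun _ (fun x => tnth (@?f x) _) =>
      apply: measurable_fun_tnth; mfun
  | |- measurable_fun _ (fun x => (@?f x)%:E) =>
      apply: measurable_fun_EFin; mfun
  | |- measurable_fun _ (fun x => (@?f x * @?g x)%E) =>
      apply: emeasurable_funM; mfun
  | |- measurable_fun _ (fun x => (@?f x + @?g x)) =>
      apply: measurable_funD; mfun
  | |- measurable_fun _ (fun x => (- @?f x)) =>
      apply: measurable_funN; mfun
  | |- measurable_fun _ (fun x => (@?f x * @?g x)) =>
      apply: measurable_funM; mfun
  | |- measurable_fun _ (fun x => (@?f x ^+ _)) =>
      apply: measurable_funX; mfun
  | |- measurable_fun _ (fun x => (@?f x)^-1) =>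
      apply: measurable_fun_inv; mfun
  | |- measurable_fun _ (fun x => Num.sqrt (@?f x)) =>
      apply: measurable_fun_sqrt; mfun
  | |- measurable_fun _ (fun x => expR (@?f x)) =>
      apply: measurable_fun_expR; mfun
  | |- measurable_fun _ (fun x => (nat_of_bool (@?f x))%:R) =>
      apply: measurable_fun_natr; mfun
  | |- measurable_fun _ (fun x => @?f x && @?g x) =>
      apply: measurable_and; mfun
  | |- measurable_fun _ (fun x => (@?f x <= @?g x)) =>
      apply: measurable_fun_ler; mfun
  | |- measurable_fun _ (fun x => (@?f x < @?g x)) =>
      apply: measurable_fun_ltr; mfun
  | |- measurable_fun _ (fun x => \sum_(i < _) @?f i x) =>
      apply: measurable_sum; move=> ?; mfun
  | |- measurable_fun _ (fun x => \prod_(i < _) @?f i x) =>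
      apply: measurable_prod; move=> ? ?; mfun
  | _ => idtac
  end.

Section integral_setT.
Context d (T : measurableType d) {R : realType}.
Variable m : {measure set T -> \bar R}.
Local Open Scope ereal_scope.

Lemma ge0_integralT_Zl (c : R) (f : T -> \bar R) : (0 <= c)%R ->
  measurable_fun setT f -> (forall x, 0 <= f x) ->
  \int[m]_x (c%:E * f x) = c%:E * \int[m]_x f x.
Proof. by move=> c0 mf f0; rewrite ge0_integralZl. Qed.

Lemma ge0_integralT_Zr (c : R) (f : T -> \bar R) : (0 <= c)%R ->
  measurable_fun setT f -> (forall x, 0 <= f x) ->
  \int[m]_x (f x * c%:E) = (\int[m]_x f x) * c%:E.
Proof. by move=> c0 mf f0; rewrite ge0_integralZr. Qed.

End integral_setT.

(** * Products of sigma-finite measures and Tonelli *)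

Section product_sigma_finite.
Context d1 d2 (T1 : measurableType d1) (T2 : measurableType d2) {R : realType}.
Variables (m1 : {sigma_finite_measure set T1 -> \bar R})
  (m2 : {sigma_finite_measure set T2 -> \bar R}).

(* The name carries the sigma-finite structure: on [m1 \x m2] itself, canonical
   inference is captured by the instance for products of subprobabilities. *)
Definition prod_measure : set (T1 * T2) -> \bar R := (m1 \x m2)%E.

HB.instance Definition _ := Measure.copy prod_measure (m1 \x m2)%E.

(** Rectangles of two increasing exhaustions exhaust the product: by monotonicity the larger of two
    indices serves both factors. *)
Lemma prod_measure_sigma_finite : sigma_finite [set: T1 * T2] prod_measure.
Proof.
have /sigma_finiteP[F [FT ndF Ffin]] := sigma_finiteT m1.
have /sigma_finiteP[G [GT ndG Gfin]] := sigma_finiteT m2.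
exists (fun n => F n `*` G n).
  apply/seteqP; split => // -[x y] _.
  have [i _ Fi] : (\bigcup_i F i) x by rewrite -FT.
  have [j _ Gj] : (\bigcup_i G i) y by rewrite -GT.
  exists (maxn i j) => //; split => /=.
    by apply: (subsetPset _ _ (ndF _ _ (leq_maxl i j))).
  by apply: (subsetPset _ _ (ndG _ _ (leq_maxr i j))).
move=> n; have [mF Fn] := Ffin n; have [mG Gn] := Gfin n.
split; first exact: measurableX.
by rewrite /prod_measure product_measure1E// lte_mul_pinfty// ge0_fin_numE.
Qed.

HB.instance Definition _ :=
  Measure_isSigmaFinite.Build _ _ _ prod_measure prod_measure_sigma_finite.

Lemma tonelli1 (f : T1 * T2 -> \bar R) :
  measurable_fun setT f -> (forall z, 0 <= f z)%E ->
  (\int[prod_measure]_z f z = \int[m1]_x \int[m2]_y f (x, y))%E.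
Proof. by move=> mf f0; exact: (@fubini_tonelli1 _ _ _ _ R m1 m2 f mf f0). Qed.

Lemma tonelli2 (f : T1 * T2 -> \bar R) :
  measurable_fun setT f -> (forall z, 0 <= f z)%E ->
  (\int[prod_measure]_z f z = \int[m2]_y \int[m1]_x f (x, y))%E.
Proof. by move=> mf f0; exact: (@fubini_tonelli2 _ _ _ _ R m1 m2 f mf f0). Qed.

Lemma measurable_integral_snd (f : T1 * T2 -> \bar R) :
  measurable_fun setT f -> (forall z, 0 <= f z)%E ->
  measurable_fun setT (fun x => \int[m2]_y f (x, y))%E.
Proof.
by move=> mf f0; exact: (@measurable_fun_fubini_tonelli_F _ _ _ _ R m2 f mf f0).
Qed.

Lemma measurable_integral_fst (f : T1 * T2 -> \bar R) :
  measurable_fun setT f -> (forall z, 0 <= f z)%E ->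
  measurable_fun setT (fun y => \int[m1]_x f (x, y))%E.
Proof.
by move=> mf f0; exact: (@measurable_fun_fubini_tonelli_G _ _ _ _ R m1 f mf f0).
Qed.

End product_sigma_finite.

(** * The normal family as a group orbit *)

Section one_observation.
Context {R : realType}.
Notation MR := (measurableTypeR R).
Notation mu := (@lebesgue_measure R).
Implicit Types om : R * R * R * R * R.

(* The element of the lower triangular affine group that the parameter encodes:
   it sends a standard bivariate normal vector to one with parameter [om]. *)
Definition gact om (z : MR * MR) : MR * MR :=
  (om.1.1.1.1 + Num.sqrt (om.1.2 / om.2) * z.1,
   om.1.1.1.2 + om.1.1.2 * (Num.sqrt (om.1.2 / om.2) * z.1)
     + Num.sqrt (om.1.2 * om.2) * z.2).

Definition std_pdf (z : R * R) : R :=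
  (2 * pi)^-1 * expR (- 2^-1 * (z.1 ^+ 2 + z.2 ^+ 2)).

Lemma param_spaceP om : param_space om <-> 0 < om.1.2 /\ 0 < om.2.
Proof. by move: om => [[[[a b] c] e] f]. Qed.

Lemma binormal_pdfE om x : binormal_pdf om x = (2 * pi * om.1.2)^-1 *
  expR (- 2^-1 * ((x.2 - om.1.1.1.2 - om.1.1.2 * (x.1 - om.1.1.1.1)) ^+ 2
    / (om.1.2 * om.2) + om.2 * (x.1 - om.1.1.1.1) ^+ 2 / om.1.2)).
Proof. by move: om => [[[[a b] c] e] f]. Qed.

Lemma binormal_pdf_gt0 om x : param_space om -> 0 < binormal_pdf om x.
Proof.
move=> /param_spaceP[t0 e0]; rewrite binormal_pdfE mulr_gt0 ?expR_gt0//.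
by rewrite invr_gt0 !mulr_gt0// pi_gt0.
Qed.

Lemma measurable_binormal_pdf om :
  measurable_fun [set: MR * MR] (binormal_pdf om).
Proof. rewrite (funext (binormal_pdfE om)); mfun. Qed.

Lemma measurable_gact om : measurable_fun setT (gact om).
Proof. rewrite /gact; mfun. Qed.

(** The two roots are the diagonal entries of the linear part of [gact om]; their product [theta] is
    its Jacobian determinant and cancels the normalization of the density. *)
Lemma binormal_pdf_gact om z : param_space om ->
  Num.sqrt (om.1.2 / om.2) * (Num.sqrt (om.1.2 * om.2) *
    binormal_pdf om (gact om z)) = std_pdf z.
Proof.
move=> /param_spaceP[t0 e0].
move: om t0 e0 => [[[[m1 m2] b] t] e] /= t0 e0.
have p0 := lt0r_neq0 (pi_gt0 R); have t1 := lt0r_neq0 t0; have e1 := lt0r_neq0 e0.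
rewrite mulrA -sqrtrM; last by rewrite divr_ge0 ?ltW.
have -> : t / e * (t * e) = t ^+ 2 by field.
rewrite sqrtr_sqr gtr0_norm// /std_pdf mulrA; congr (_ * _).
  by move: (pi) p0 => p p0; field; rewrite t1 p0.
congr (expR (_ * _)); rewrite /= !(addrC m1) addrK.
rewrite (_ : _ - _ - _ = Num.sqrt (t * e) * z.2); last by ring.
rewrite !exprMn !sqr_sqrtr ?divr_ge0 ?mulr_ge0 ?ltW//.
by move: (z.1) (z.2) => u v; field; rewrite t1 e1.
Qed.

Local Open Scope ereal_scope.

(** Since [gact] is triangular, the change of variables in the plane reduces to two affine
    substitutions on the line, the second with the first coordinate fixed. *)
Lemma ge0_integral_gact om (k : MR * MR -> \bar R) : param_space om ->
  measurable_fun setT k -> (forall x, 0 <= k x) ->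
  \int[leb2]_x (k x * (binormal_pdf om x)%:E) =
  \int[leb2]_z (k (gact om z) * (std_pdf z)%:E).
Proof.
move=> Om mk k0.
have [t0 e0] := (param_spaceP _).1 Om.
have s10 : (0 < Num.sqrt (om.1.2 / om.2))%R by rewrite sqrtr_gt0 divr_gt0.
have s20 : (0 < Num.sqrt (om.1.2 * om.2))%R by rewrite sqrtr_gt0 mulr_gt0.
pose K x := k x * (binormal_pdf om x)%:E.
have mK : measurable_fun setT K.
  by apply: emeasurable_funM => //; apply/measurable_EFinP; exact: measurable_binormal_pdf.
have K0 x : 0 <= K x by rewrite mule_ge0// lee_fin ltW// binormal_pdf_gt0.
pose K' z := k (gact om z) * (std_pdf z)%:E.
have mg := measurable_gact om.
have mK' : measurable_fun setT K'.
  apply: emeasurable_funM; first exact: (measurableT_comp mk).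
  by rewrite /std_pdf; mfun.
have K'0 x : 0 <= K' x.
  by rewrite mule_ge0// lee_fin mulr_ge0 ?expR_ge0// invr_ge0 mulr_ge0 ?pi_ge0.
have E k' (mk' : measurable_fun setT k') (k'0 : forall x, 0 <= k' x) :
    \int[leb2]_x k' x = \int[mu]_x fubini_F mu k' x.
  exact: (@fubini_tonelli1 _ _ _ _ R mu mu k' mk' k'0).
rewrite [LHS](E K mK K0) [RHS](E K' mK' K'0).
have mF := @measurable_fun_fubini_tonelli_F _ _ _ _ R mu _ mK K0.
have F0 x : 0 <= fubini_F mu K x by apply: integral_ge0.
rewrite (ge0_integral_affine om.1.1.1.1 s10 mF F0).
have mF1 : measurable_fun setT (fun x : MR =>
    fubini_F mu K (om.1.1.1.1 + Num.sqrt (om.1.2 / om.2) * x)%R).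
  by apply: (measurableT_comp mF); mfun.
rewrite -(ge0_integralT_Zl mu (ltW s10) mF1 (fun _ => F0 _)).
apply: eq_integral => v _; rewrite /fubini_F.
have mv0 := @measurable_fun_pair2 _ _ _ _ _ _ K
  (om.1.1.1.1 + Num.sqrt (om.1.2 / om.2) * v)%R mK.
rewrite (ge0_integral_affine (om.1.1.1.2 + om.1.1.2 *
  (Num.sqrt (om.1.2 / om.2) * v))%R s20 mv0 (fun _ => K0 _)).
have mv : measurable_fun setT (fun u : MR => K (gact om (v, u))).
  by apply: (measurableT_comp mK); rewrite /gact; mfun.
rewrite muleA -EFinM -(ge0_integralT_Zl mu (mulr_ge0 (ltW s10) (ltW s20)) mv (fun _ => K0 _)).
apply: eq_integral => u _.
rewrite /K' /K muleCA -EFinM; congr (_ * _%:E).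
by rewrite -mulrA binormal_pdf_gact.
Qed.

(** Signed version, for products of scores. The densities are nonnegative and therefore pass through
    positive and negative parts. *)
Lemma integral_gact om (k : MR * MR -> R) : param_space om ->
  measurable_fun setT k ->
  \int[leb2]_x (k x * binormal_pdf om x)%:E =
  \int[leb2]_z (k (gact om z) * std_pdf z)%:E.
Proof.
move=> Om mk; rewrite integralE [RHS]integralE.
have b0 x := ltW (binormal_pdf_gt0 x Om).
have s0 z : (0 <= std_pdf z)%R.
  by rewrite mulr_ge0 ?expR_ge0// invr_ge0 mulr_ge0 ?pi_ge0.
have mkp : measurable_fun setT (EFin \o k)^\+.
  by apply: measurable_funepos; exact/measurable_EFinP.
have mkn : measurable_fun setT (EFin \o k)^\-.
  by apply: measurable_funeneg; exact/measurable_EFinP.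
have E1 b : (forall x, 0 <= b x)%R ->
    (fun x => (k x * b x)%:E)^\+ = fun x => (EFin \o k)^\+ x * (b x)%:E.
  move=> p0; apply/funext => x; rewrite !funeposE/= -!EFin_max -EFinM.
  by rewrite maxr_pMl// mul0r.
have E2 b : (forall x, 0 <= b x)%R ->
    (fun x => (k x * b x)%:E)^\- = fun x => (EFin \o k)^\- x * (b x)%:E.
  move=> p0; apply/funext => x; rewrite !funenegE/= -!EFin_max -EFinM.
  by rewrite maxr_pMl// mul0r mulNr.
congr (_ - _).
- rewrite (E1 _ b0) (ge0_integral_gact Om mkp (funepos_ge0 _)).
  apply: eq_integral => z _; rewrite !funeposE/= -!EFin_max -EFinM.
  by rewrite maxr_pMl// mul0r.
- rewrite (E2 _ b0) (ge0_integral_gact Om mkn (funeneg_ge0 _)).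
  apply: eq_integral => z _; rewrite !funenegE/= -!EFin_max -EFinM.
  by rewrite maxr_pMl// mul0r mulNr.
Qed.

End one_observation.

(** * Right Haar measure *)

Section right_invariance.
Context {R : realType}.
Notation MR := (measurableTypeR R).
Notation mu := (@lebesgue_measure R).
Notation param := (MR * MR * MR * MR * MR)%type.
Local Open Scope ereal_scope.

Lemma ge0_integral_translation (c : R) (k : MR -> \bar R) :
  measurable_fun setT k -> (forall x, 0 <= k x) ->
  \int[mu]_x (k (x + c)%R) = \int[mu]_x k x.
Proof.
move=> mk k0; rewrite (@ge0_integral_affine R 1 c k)// mul1e.
by apply: eq_integral => x _; rewrite mul1r addrC.
Qed.

(** Invariance of [dx / x] on the positive half-line; the indicator lets the integral range over the
    whole line. *)
Lemma ge0_integral_dilation (a : R) (k : MR -> \bar R) : (0 < a)%R ->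
  measurable_fun setT k -> (forall x, 0 <= k x) ->
  \int[mu]_x (k (x * a)%R * ((0 < x)%R%:R / x)%:E) =
  \int[mu]_x (k x * ((0 < x)%R%:R / x)%:E).
Proof.
move=> a0 mk k0.
have h0 (x : MR) : (0 <= (0 < x)%R%:R / x :> R)%R.
  by case: ltP => x0; rewrite ?mul0r// mul1r invr_ge0 ltW.
have mh : measurable_fun setT (fun x : MR => ((0 < x)%R%:R / x : R)%:E).
  by mfun.
have mkh : measurable_fun setT (fun x : MR => k x * ((0 < x)%R%:R / x : R)%:E).
  exact: emeasurable_funM.
have kh0 x : 0 <= k x * ((0 < x)%R%:R / x : R)%:E by rewrite mule_ge0 ?lee_fin.
have mkh1 : measurable_fun setT (fun x : MR =>
    k (0 + a * x)%R * ((0 < 0 + a * x)%R%:R / (0 + a * x) : R)%:E).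
  by apply: (measurableT_comp mkh); mfun.
rewrite [RHS](@ge0_integral_affine R a 0 _ a0 mkh kh0).
rewrite -(ge0_integralT_Zl mu (ltW a0) mkh1 (fun _ => kh0 _)).
apply: eq_integral => x _; rewrite add0r muleCA -EFinM (mulrC a).
congr (_ * _%:E); rewrite pmulr_lgt0//.
have [x0|] := boolP (0 < x)%R; last by rewrite !mul0r mulr0.
by rewrite !mul1r invfM mulrCA mulfV ?mulr1// lt0r_neq0.
Qed.

(** For fixed [y] the inner integral absorbs [Th], and afterwards only [tau] acts. Iterated, this
    reduces an invariance in five dimensions to translations and dilations of the line. *)
Lemma ge0_integral_skew d (X : measurableType d)
    (m : {sigma_finite_measure set X -> \bar R})
    (w : X -> R) (h : MR -> R) (Th : X * MR -> X) (tau : MR -> MR) :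
  measurable_fun setT w -> (forall x, 0 <= w x)%R ->
  measurable_fun setT h -> (forall x, 0 <= h x)%R ->
  measurable_fun setT Th -> measurable_fun setT tau ->
  (forall y (k : X -> \bar R), measurable_fun setT k -> (forall x, 0 <= k x) ->
    \int[m]_x (k (Th (x, y)) * (w x)%:E) = \int[m]_x (k x * (w x)%:E)) ->
  (forall k : MR -> \bar R, measurable_fun setT k -> (forall x, 0 <= k x) ->
    \int[mu]_y (k (tau y) * (h y)%:E) = \int[mu]_y (k y * (h y)%:E)) ->
  forall k : X * MR -> \bar R, measurable_fun setT k -> (forall z, 0 <= k z) ->
    \int[prod_measure m mu]_z (k (Th z, tau z.2) * (w z.1 * h z.2)%:E) =
    \int[prod_measure m mu]_z (k z * (w z.1 * h z.2)%:E).
Proof.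
move=> mw w0 mh h0 mTh mtau inv_w inv_h k mk k0.
have mwh : measurable_fun setT (fun z : X * MR => (w z.1 * h z.2)%:E).
  apply/measurable_EFinP/measurable_funM.
    exact: (measurableT_comp mw).
  exact: (measurableT_comp mh).
have mk1 : measurable_fun setT (fun z : X * MR => k (Th z, tau z.2)).
  apply: (measurableT_comp mk); apply: measurable_fun_pair => //.
  exact: (measurableT_comp mtau).
have wh0 z : 0 <= (w z.1 * h z.2)%:E by rewrite lee_fin mulr_ge0.
have mkw : measurable_fun setT (fun z : X * MR => k z * (w z.1)%:E).
  apply: emeasurable_funM => //; apply/measurable_EFinP.
  exact: (measurableT_comp mw).
pose K y := \int[m]_x (k (x, y) * (w x)%:E).
have mK : measurable_fun setT K.
  apply: (@measurable_fun_fubini_tonelli_G _ _ _ _ R m _ mkw) => z.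
  by rewrite mule_ge0 ?lee_fin.
have pull y (g : X -> \bar R) : measurable_fun setT g -> (forall x, 0 <= g x) ->
    \int[m]_x (g x * (w x * h y)%:E) = (\int[m]_x (g x * (w x)%:E)) * (h y)%:E.
  move=> mg g0; rewrite -ge0_integralZr//.
  - by apply: eq_integral => x _; rewrite EFinM muleA.
  - by apply: emeasurable_funM => //; exact/measurable_EFinP.
  - by move=> x _; rewrite mule_ge0 ?lee_fin.
  - by rewrite lee_fin.
have kwh1 z : 0 <= k (Th z, tau z.2) * (w z.1 * h z.2)%:E by rewrite mule_ge0.
have kwh z : 0 <= k z * (w z.1 * h z.2)%:E by rewrite mule_ge0.
rewrite (tonelli2 _ _ (emeasurable_funM mk1 mwh) kwh1).
rewrite (tonelli2 _ _ (emeasurable_funM mk mwh) kwh).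
transitivity (\int[mu]_y (K (tau y) * (h y)%:E)).
  apply: eq_integral => y _; rewrite /= pull//.
  - rewrite (inv_w y (fun x => k (x, tau y)))//.
    exact: (measurable_fun_pair1 _ mk).
  - exact: (measurable_fun_pair1 _ mk1).
rewrite inv_h//; last by move=> y; apply: integral_ge0 => x _; rewrite mule_ge0 ?lee_fin.
apply: eq_integral => y _; rewrite /= pull//.
exact: (measurable_fun_pair1 _ mk).
Qed.

(* The group law, transported to the parameter: [gact (gmul om s)] is
   [gact om \o gact s]. *)
Definition gmul (om s : param) : param :=
  (om.1.1.1.1 + Num.sqrt (om.1.2 / om.2) * s.1.1.1.1,
   om.1.1.1.2 + om.1.1.2 * (Num.sqrt (om.1.2 / om.2) * s.1.1.1.1)
     + Num.sqrt (om.1.2 * om.2) * s.1.1.1.2,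
   om.1.1.2 + om.2 * s.1.1.2, om.1.2 * s.1.2, om.2 * s.2)%R.

(** The prior on the parameter space and 0 elsewhere, so that integrals range over the whole of
    [R^5]. *)
Definition haar (om : param) : R :=
  ((0 < om.1.2)%R%:R / om.1.2 * ((0 < om.2)%R%:R / om.2))%R.

Lemma haar_ge0 om : (0 <= haar om)%R.
Proof.
have h0 (x : R) : (0 <= (0 < x)%R%:R / x :> R)%R.
  by case: ltP => x0; rewrite ?mul0r// mul1r invr_ge0 ltW.
by rewrite /haar mulr_ge0.
Qed.

Lemma measurable_haar : measurable_fun setT haar.
Proof. by rewrite /haar; mfun. Qed.

(** Right multiplication by [s] is triangular in the coordinates of [om] read from the last: [eta]
    and [theta] are dilated by constants, while [beta], [mu2] and [mu1] are translated by amounts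
    that depend only on later coordinates. *)
Lemma ge0_integral_gmul (s : param) (k : param -> \bar R) :
  param_space s -> measurable_fun setT k -> (forall x, 0 <= k x) ->
  \int[leb5]_om (k (gmul om s) * (haar om)%:E) =
  \int[leb5]_om (k om * (haar om)%:E).
Proof.
move=> /param_spaceP[t0 e0] mk k0.
have h0 (x : MR) : (0 <= (0 < x)%R%:R / x :> R)%R.
  by case: ltP => x0; rewrite ?mul0r// mul1r invr_ge0 ltW.
pose h (x : MR) : R := ((0 < x)%R%:R / x)%R.
have mh : measurable_fun setT h by rewrite /h; mfun.
have tr c (k' : MR -> \bar R) : measurable_fun setT k' -> (forall x, 0 <= k' x) ->
    \int[mu]_x (k' (x + c)%R * 1%:E) = \int[mu]_x (k' x * 1%:E).
  move=> mk' k'0; under eq_integral do rewrite mule1.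
  rewrite (ge0_integral_translation c mk' k'0).
  by under [RHS]eq_integral do rewrite mule1.
pose l1 (t e : R) := Num.sqrt (t / e).
pose l2 (t e : R) := Num.sqrt (t * e).
pose S1 : {sigma_finite_measure set MR -> \bar R} := mu.
pose S2 : {sigma_finite_measure set (MR * MR)%type -> \bar R} := prod_measure S1 S1.
pose S3 : {sigma_finite_measure set (MR * MR * MR)%type -> \bar R} := prod_measure S2 S1.
pose S4 : {sigma_finite_measure set (MR * MR * MR * MR)%type -> \bar R} := prod_measure S3 S1.
(* [L2] to [L5] add one coordinate at a time. The factors 1 stay in the weights to match the shape
   [w z.1 * h z.2] of the skew product lemma. *)
have L2 c1 c2 (k' : MR * MR -> \bar R) : measurable_fun setT k' ->
    (forall x, 0 <= k' x) ->
    \int[S2]_z (k' (z.1 + c1, z.2 + c2)%R * (1 * 1)%:E) =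
    \int[S2]_z (k' z * (1 * 1)%:E).
  apply: (@ge0_integral_skew _ _ S1 (fun=> 1%R) (fun=> 1%R)
    (fun z => z.1 + c1)%R (fun y => y + c2)%R) => //; try mfun;
    try by move=> x; rewrite !mulr1 ler01.
  - by move=> y k1 mk1 k10; exact: tr.
  - by move=> k1 mk1 k10; exact: tr.
have L3 t e (k' : MR * MR * MR -> \bar R) : measurable_fun setT k' ->
    (forall x, 0 <= k' x) ->
    \int[S3]_z (k' (z.1.1 + l1 t e * s.1.1.1.1,
      z.1.2 + (z.2 * (l1 t e * s.1.1.1.1) + l2 t e * s.1.1.1.2),
      z.2 + e * s.1.1.2)%R * (1 * 1 * 1)%:E) =
    \int[S3]_z (k' z * (1 * 1 * 1)%:E).
  apply: (@ge0_integral_skew _ _ S2 (fun=> (1 * 1)%R) (fun=> 1%R)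
    (fun z => (z.1.1 + l1 t e * s.1.1.1.1,
      z.1.2 + (z.2 * (l1 t e * s.1.1.1.1) + l2 t e * s.1.1.1.2))%R)
    (fun y => y + e * s.1.1.2)%R) => //; try mfun;
    try by move=> x; rewrite !mulr1 ler01.
  - by move=> y k1 mk1 k10; exact: (L2 (l1 t e * s.1.1.1.1)%R
      (y * (l1 t e * s.1.1.1.1) + l2 t e * s.1.1.1.2)%R k1 mk1 k10).
  - by move=> k1 mk1 k10; exact: tr.
have L4 e (k' : MR * MR * MR * MR -> \bar R) : measurable_fun setT k' ->
    (forall x, 0 <= k' x) ->
    \int[S4]_z (k' (z.1.1.1 + l1 z.2 e * s.1.1.1.1,
      z.1.1.2 + (z.1.2 * (l1 z.2 e * s.1.1.1.1) + l2 z.2 e * s.1.1.1.2),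
      z.1.2 + e * s.1.1.2, z.2 * s.1.2)%R * (1 * 1 * 1 * h z.2)%:E) =
    \int[S4]_z (k' z * (1 * 1 * 1 * h z.2)%:E).
  apply: (@ge0_integral_skew _ _ S3 (fun=> (1 * 1 * 1)%R) h
    (fun z => (z.1.1.1 + l1 z.2 e * s.1.1.1.1,
      z.1.1.2 + (z.1.2 * (l1 z.2 e * s.1.1.1.1) + l2 z.2 e * s.1.1.1.2),
      z.1.2 + e * s.1.1.2)%R)
    (fun y => y * s.1.2)%R) => //; try by rewrite /l1 /l2 /h; mfun;
    try by move=> x; rewrite !mulr1 ler01.
  - by move=> y k1 mk1 k10; exact: (L3 y e k1 mk1 k10).
  - by move=> k1 mk1 k10; exact: ge0_integral_dilation.
have L5 (k' : param -> \bar R) : measurable_fun setT k' ->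
    (forall x, 0 <= k' x) ->
    \int[prod_measure S4 S1]_z (k' (z.1.1.1.1 + l1 z.1.2 z.2 * s.1.1.1.1,
      z.1.1.1.2 + (z.1.1.2 * (l1 z.1.2 z.2 * s.1.1.1.1) + l2 z.1.2 z.2 * s.1.1.1.2),
      z.1.1.2 + z.2 * s.1.1.2, z.1.2 * s.1.2, z.2 * s.2)%R
      * (1 * 1 * 1 * h z.1.2 * h z.2)%:E) =
    \int[prod_measure S4 S1]_z (k' z * (1 * 1 * 1 * h z.1.2 * h z.2)%:E).
  apply: (@ge0_integral_skew _ _ S4 (fun z => (1 * 1 * 1 * h z.2)%R) h
    (fun z => (z.1.1.1.1 + l1 z.1.2 z.2 * s.1.1.1.1,
      z.1.1.1.2 + (z.1.1.2 * (l1 z.1.2 z.2 * s.1.1.1.1) + l2 z.1.2 z.2 * s.1.1.1.2),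
      z.1.1.2 + z.2 * s.1.1.2, z.1.2 * s.1.2)%R)
    (fun y => y * s.2)%R) => //; try by rewrite /l1 /l2 /h; mfun;
    try by move=> x; rewrite !mul1r.
  - by move=> k1 mk1 k10; exact: ge0_integral_dilation.
have E (f : param -> \bar R) :
  \int[leb5]_om f om = \int[prod_measure S4 S1]_om f om by [].
rewrite [LHS]E [RHS]E; have L5k := L5 k mk k0.
transitivity (\int[prod_measure S4 S1]_z (k z * (1 * 1 * 1 * h z.1.2 * h z.2)%:E)).
  rewrite -L5k; apply: eq_integral => z _; congr (k _ * _%:E).
    by rewrite /gmul -addrA.
  by rewrite !mul1r.
by apply: eq_integral => z _; rewrite !mul1r.
Qed.

End right_invariance.

(** * The maximum likelihood estimate *)

Section sufficiency.
Context {R : realType}.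
Notation MR := (measurableTypeR R).
Notation obs := (MR * MR)%type.
Notation param := (MR * MR * MR * MR * MR)%type.
Implicit Types (om s : param).

Definition mean1 n (x : n.-tuple obs) : R := (\sum_(i < n) (tnth x i).1) / n%:R.
Definition mean2 n (x : n.-tuple obs) : R := (\sum_(i < n) (tnth x i).2) / n%:R.
Definition ss11 n (x : n.-tuple obs) : R :=
  \sum_(i < n) ((tnth x i).1 - mean1 x) ^+ 2.
Definition ss12 n (x : n.-tuple obs) : R :=
  \sum_(i < n) ((tnth x i).1 - mean1 x) * ((tnth x i).2 - mean2 x).
Definition slope n (x : n.-tuple obs) : R := ss12 x / ss11 x.
Definition rss n (x : n.-tuple obs) : R :=
  \sum_(i < n) ((tnth x i).2 - mean2 x - slope x * ((tnth x i).1 - mean1 x)) ^+ 2.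

(** For [n > 0] these are exactly the samples whose likelihood attains a maximum on the parameter
    space. *)
Definition nondegenerate n (x : n.-tuple obs) := (0 < ss11 x) && (0 < rss x).

(* The maximum likelihood estimate on nondegenerate samples. *)
Definition estimate n (x : n.-tuple obs) : param :=
  (mean1 x, mean2 x, slope x, Num.sqrt (ss11 x * rss x) / n%:R,
   Num.sqrt (rss x / ss11 x)).

(* The likelihood as a function of the estimate only. *)
Definition suff_likelihood n s om : R :=
  (2 * pi * om.1.2) ^- n *
  expR (- 2^-1 * (n%:R * ((s.1.2 * s.2 + (s.1.1.2 - om.1.1.2) ^+ 2 * (s.1.2 / s.2)
      + (s.1.1.1.2 - om.1.1.1.2 - om.1.1.2 * (s.1.1.1.1 - om.1.1.1.1)) ^+ 2)
        / (om.1.2 * om.2)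
    + om.2 * (s.1.2 / s.2 + (s.1.1.1.1 - om.1.1.1.1) ^+ 2) / om.1.2))).

Section sums.
Variables (n : nat) (x : n.-tuple obs).
Hypothesis n0 : (0 < n)%N.
Let nR : n%:R != 0 :> R. Proof. by rewrite pnatr_eq0 -lt0n. Qed.

Lemma sum_dev1 : \sum_(i < n) ((tnth x i).1 - mean1 x) = 0.
Proof.
rewrite sumrB sumr_const card_ord /mean1 -[X in _ - X]mulr_natr divfK//.
by rewrite subrr.
Qed.

Lemma sum_dev2 : \sum_(i < n) ((tnth x i).2 - mean2 x) = 0.
Proof.
rewrite sumrB sumr_const card_ord /mean2 -[X in _ - X]mulr_natr divfK//.
by rewrite subrr.
Qed.

Lemma sum_sqr1 m : \sum_(i < n) ((tnth x i).1 - m) ^+ 2 =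
  ss11 x + n%:R * (mean1 x - m) ^+ 2.
Proof.
have E i : ((tnth x i).1 - m) ^+ 2 = ((tnth x i).1 - mean1 x) ^+ 2
    + (2 * (mean1 x - m)) * ((tnth x i).1 - mean1 x) + (mean1 x - m) ^+ 2.
  by move: (mean1 x) (tnth x i).1 => u v; ring.
rewrite (eq_bigr _ (fun i _ => E i)) !big_split/= -mulr_sumr sum_dev1 mulr0 addr0.
by rewrite sumr_const card_ord mulr_natl.
Qed.

(** Pythagoras around the least squares line: the cross terms vanish because deviations sum to 0 and
    by the normal equation [UV], which requires [ss11 x != 0]. *)
Lemma sum_sqr_residual b c : ss11 x != 0 ->
  \sum_(i < n) ((tnth x i).2 - c - b * ((tnth x i).1 - mean1 x)) ^+ 2 =
  rss x + (slope x - b) ^+ 2 * ss11 x + n%:R * (mean2 x - c) ^+ 2.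
Proof.
move=> s0.
pose u i := (tnth x i).1 - mean1 x; pose v i := (tnth x i).2 - mean2 x.
have E i : ((tnth x i).2 - c - b * ((tnth x i).1 - mean1 x)) ^+ 2 =
    (v i - slope x * u i) ^+ 2 + (slope x - b) ^+ 2 * u i ^+ 2 + (mean2 x - c) ^+ 2
    + (2 * (slope x - b)) * (u i * v i - slope x * u i ^+ 2)
    + (2 * (mean2 x - c)) * v i + (- 2 * (mean2 x - c) * b) * u i.
  rewrite /v /u; move: (mean1 x) (mean2 x) (slope x) (tnth x i).1 (tnth x i).2.
  by move=> m1 m2 k p q; ring.
have UV : \sum_i (u i * v i - slope x * u i ^+ 2) = 0.
  rewrite sumrB -mulr_sumr -[\sum_i u i ^+ 2]/(ss11 x) -[\sum_i u i * v i]/(ss12 x).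
  by rewrite /slope divfK// subrr.
rewrite (eq_bigr _ (fun i _ => E i)) !big_split/= -!mulr_sumr UV.
rewrite [\sum_i v i]sum_dev2 [\sum_i u i]sum_dev1 !mulr0 !addr0.
congr (_ + _ + _).
by rewrite sumr_const card_ord mulrnAr -expr2 mulr_natl.
Qed.

End sums.

Lemma estimate_param_space n (x : n.-tuple obs) : (0 < n)%N ->
  nondegenerate x -> param_space (estimate x).
Proof.
move=> n0 /andP[s0 r0]; apply/param_spaceP; split => /=.
  by rewrite divr_gt0 ?ltr0n// sqrtr_gt0 mulr_gt0.
by rewrite sqrtr_gt0 divr_gt0.
Qed.

Lemma likelihood_prodE n (x : n.-tuple obs) om :
  likelihood x om = (2 * pi * om.1.2) ^- n *
  expR (- 2^-1 * ((\sum_(i < n) ((tnth x i).2 - om.1.1.1.2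
      - om.1.1.2 * ((tnth x i).1 - om.1.1.1.1)) ^+ 2) / (om.1.2 * om.2)
    + om.2 * (\sum_(i < n) ((tnth x i).1 - om.1.1.1.1) ^+ 2) / om.1.2)).
Proof.
rewrite /likelihood; under eq_bigr do rewrite binormal_pdfE.
rewrite big_split/= prodr_const card_ord -exprVn -expR_sum; congr (_ * expR _).
by rewrite -mulr_sumr big_split/= -mulr_suml -mulr_suml -mulr_sumr.
Qed.

(** The last two coordinates of the estimate have product [rss x / n] and quotient [ss11 x / n], so
    they carry both sums of squares. *)
Lemma likelihoodE n (x : n.-tuple obs) om : (0 < n)%N -> nondegenerate x ->
  param_space om -> likelihood x om = suff_likelihood n (estimate x) om.
Proof.
move=> n0 /andP[s0 r0] /param_spaceP[t0 e0].
have nR : 0 < n%:R :> R by rewrite ltr0n.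
rewrite likelihood_prodE /suff_likelihood /=; congr (_ * expR (_ * _)).
have -> : Num.sqrt (ss11 x * rss x) / n%:R * Num.sqrt (rss x / ss11 x) = rss x / n%:R.
  rewrite mulrAC -sqrtrM ?mulr_ge0 ?ltW//.
  rewrite (_ : ss11 x * rss x * (rss x / ss11 x) = rss x ^+ 2); last first.
    by move: (ss11 x) (rss x) s0 => p q p0; field; exact: lt0r_neq0.
  by rewrite sqrtr_sqr gtr0_norm.
have -> : Num.sqrt (ss11 x * rss x) / n%:R / Num.sqrt (rss x / ss11 x) = ss11 x / n%:R.
  rewrite mulrAC -sqrtrV ?divr_ge0 ?ltW// -sqrtrM ?mulr_ge0 ?ltW//.
  rewrite (_ : ss11 x * rss x * (rss x / ss11 x)^-1 = ss11 x ^+ 2); last first.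
    by move: (ss11 x) (rss x) s0 r0 => p q p0 q0; field; rewrite !lt0r_neq0.
  by rewrite sqrtr_sqr gtr0_norm.
(* The line is recentred at [mean1 x], the form that [sum_sqr_residual] decomposes. *)
have E i : (tnth x i).2 - om.1.1.1.2 - om.1.1.2 * ((tnth x i).1 - om.1.1.1.1) =
    (tnth x i).2 - (om.1.1.1.2 + om.1.1.2 * (mean1 x - om.1.1.1.1))
    - om.1.1.2 * ((tnth x i).1 - mean1 x).
  move: (mean1 x) (tnth x i).1 (tnth x i).2 om.1.1.1.1 om.1.1.1.2 om.1.1.2.
  by move=> *; ring.
under eq_bigr do rewrite E.
rewrite sum_sqr_residual ?lt0r_neq0// sum_sqr1//.
move: (rss x) (ss11 x) (slope x) (mean1 x) (mean2 x) (n%:R : R) nR.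
move: om.1.1.1.1 om.1.1.1.2 om.1.1.2 om.1.2 om.2 t0 e0 => m1 m2 b t e t0 e0.
by move=> r s k u v N N0; field; rewrite !lt0r_neq0.
Qed.

End sufficiency.

(** * Existence, uniqueness and equivariance of the maximizer *)

Section maximum_likelihood.
Context {R : realType}.
Notation MR := (measurableTypeR R).
Notation obs := (MR * MR)%type.
Notation param := (MR * MR * MR * MR * MR)%type.
Implicit Types (om s : param).

(** The [n]-th root of the likelihood, whose maximization no longer involves [n]. *)
Definition suff_factor s om : R := (2 * pi * om.1.2)^-1 *
  expR (- 2^-1 * ((s.1.2 * s.2 + (s.1.1.2 - om.1.1.2) ^+ 2 * (s.1.2 / s.2)
      + (s.1.1.1.2 - om.1.1.1.2 - om.1.1.2 * (s.1.1.1.1 - om.1.1.1.1)) ^+ 2)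
        / (om.1.2 * om.2)
    + om.2 * (s.1.2 / s.2 + (s.1.1.1.1 - om.1.1.1.1) ^+ 2) / om.1.2)).

Lemma suff_likelihood_factor n s om : suff_likelihood n s om = suff_factor s om ^+ n.
Proof.
by rewrite /suff_likelihood /suff_factor [RHS]exprMn exprVn -expRM_natl mulrCA.
Qed.

Lemma suff_factor_ge0 s om : param_space om -> 0 <= suff_factor s om.
Proof.
move=> /param_spaceP[t0 e0]; rewrite mulr_ge0 ?expR_ge0// invr_ge0.
by rewrite !mulr_ge0 ?pi_ge0 ?ltW.
Qed.

(** With [r = T / t], the ratio of the two values is [r * expR (1 - r - D / 2)], where [D] is a sum
    of nonnegative terms. It is at most 1 by [1 + u <= expR u], and equality forces [r = 1] and
    [D = 0], that is, equality of all coordinates. *)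
Lemma suff_factor_max s om : param_space s -> param_space om ->
  suff_factor s om <= suff_factor s s /\
  (suff_factor s s <= suff_factor s om -> om = s).
Proof.
move=> /param_spaceP + /param_spaceP.
move: s om => [[[[u1 u2] k] T] H] [[[[m1 m2] b] t] e] /= [T0 H0] [t0 e0].
have p0 := pi_gt0 R.
rewrite /suff_factor /=.
set A := u2 - m2 - b * (u1 - m1).
have -> : - 2^-1 * ((T * H + (k - k) ^+ 2 * (T / H) + (u2 - u2 - k * (u1 - u1)) ^+ 2)
   / (T * H) + H * (T / H + (u1 - u1) ^+ 2) / T) = - 1.
  by field; rewrite !lt0r_neq0.
(* The first term comes from [H / e + e / H = 2 + (H - e)^2 / (e H)], which separates [T / t] from
   the exponent. *)
set D := (T / t) * ((H - e) ^+ 2 / (e * H)) + (k - b) ^+ 2 * (T / (H * t * e))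
  + A ^+ 2 / (t * e) + (u1 - m1) ^+ 2 * (e / t).
have -> : - 2^-1 * ((T * H + (k - b) ^+ 2 * (T / H) + A ^+ 2) / (t * e)
    + e * (T / H + (u1 - m1) ^+ 2) / t) = - (T / t) - 2^-1 * D.
  by rewrite /D; move: (A) => A'; field; rewrite !lt0r_neq0.
have D1 : 0 <= (T / t) * ((H - e) ^+ 2 / (e * H)).
  by rewrite mulr_ge0 ?divr_ge0 ?sqr_ge0 ?mulr_ge0// ltW.
have D2 : 0 <= (k - b) ^+ 2 * (T / (H * t * e)).
  by rewrite mulr_ge0 ?sqr_ge0 ?divr_ge0 ?mulr_ge0// ltW.
have D3 : 0 <= A ^+ 2 / (t * e) by rewrite divr_ge0 ?sqr_ge0 ?mulr_ge0// ltW.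
have D4 : 0 <= (u1 - m1) ^+ 2 * (e / t) by rewrite mulr_ge0 ?sqr_ge0 ?divr_ge0// ltW.
have D0 : 0 <= D by rewrite !addr_ge0.
set r := T / t.
have r0 : 0 < r by rewrite divr_gt0.
have -> : (2 * pi * t)^-1 * expR (- r - 2^-1 * D) =
    (2 * pi * T)^-1 * expR (- 1) * (r * expR (1 - r - 2^-1 * D)).
  rewrite [RHS]mulrACA -expRD /r; congr (_ * expR _); last by ring.
  by move: (pi) p0 => p p0; field; rewrite !lt0r_neq0.
have c0 : 0 < (2 * pi * T)^-1 * expR (- 1).
  by rewrite mulr_gt0 ?expR_gt0// invr_gt0 !mulr_gt0.
have le1 : r * expR (1 - r - 2^-1 * D) <= 1.
  rewrite -[1 - r - _]opprK expRN ler_pdivrMr ?expR_gt0// mul1r.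
  by apply: le_trans (expR_ge1Dx _); lra.
split; first by rewrite ler_piMr// ltW.
rewrite ler_pMr// => ge1.
have {}ge1 : expR (r - 1 + 2^-1 * D) <= r.
  move: ge1; rewrite -[1 - r - _]opprK expRN ler_pdivlMr ?expR_gt0// mul1r.
  by apply: le_trans; rewrite ler_expR; lra.
(* Since [r <= 1 + u] for this exponent [u], a nonzero [u] would contradict the strict inequality
   [1 + u < expR u]. *)
have rD : r - 1 + 2^-1 * D = 0.
  apply/eqP/negPn/negP => /expR_gt1Dx; rewrite ltNge => /negP; apply.
  by apply: (le_trans ge1); lra.
rewrite rD expR0 in ge1.
have r1 : r = 1 by lra.
have D0' : D = 0 by lra.
have E1 : (T / t) * ((H - e) ^+ 2 / (e * H)) = 0 by move: D0'; rewrite /D; lra.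
have E2 : (k - b) ^+ 2 * (T / (H * t * e)) = 0 by move: D0'; rewrite /D; lra.
have E3 : A ^+ 2 / (t * e) = 0 by move: D0'; rewrite /D; lra.
have E4 : (u1 - m1) ^+ 2 * (e / t) = 0 by move: D0'; rewrite /D; lra.
have tT : t = T by move: r1; rewrite /r => /divr1_eq.
have sq0 (x y : R) : x ^+ 2 * y = 0 -> 0 < y -> x = 0.
  move=> /eqP; rewrite mulf_eq0 sqrf_eq0 => /orP[/eqP//|/eqP ->].
  by rewrite ltxx.
have He : H = e.
  apply: subr0_eq; apply: (sq0 _ (T / t / (e * H))); first by rewrite mulrCA in E1.
  by rewrite !divr_gt0 ?mulr_gt0.
have bk : k = b.
  apply: subr0_eq; apply: (sq0 _ _ E2).
  by rewrite divr_gt0 ?mulr_gt0.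
have um : u1 = m1.
  by apply: subr0_eq; apply: (sq0 _ _ E4); rewrite divr_gt0.
have : A = 0 by apply: (sq0 _ _ E3); rewrite invr_gt0 mulr_gt0.
rewrite /A um subrr mulr0 subr0 => /subr0_eq u2m.
by rewrite tT He bk u2m.
Qed.

Lemma is_mle_estimate n (x : n.-tuple obs) om : (0 < n)%N -> nondegenerate x ->
  is_mle x om <-> om = estimate x.
Proof.
move=> n0 ndx; have Oe := estimate_param_space n0 ndx.
split=> [[Om mx]|->].
  apply: (suff_factor_max Oe Om).2; have := mx _ Oe.
  rewrite !likelihoodE// !suff_likelihood_factor ler_pXn2r// nnegrE.
    exact: suff_factor_ge0.
  exact: suff_factor_ge0.
split=> // om' Om'; rewrite !likelihoodE// !suff_likelihood_factor.
rewrite ler_pXn2r ?nnegrE ?suff_factor_ge0//.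
exact: (suff_factor_max Oe Om').1.
Qed.

Lemma mle_nondegenerate n (x : n.-tuple obs) : (0 < n)%N -> nondegenerate x ->
  mle x = estimate x.
Proof.
move=> n0 ndx; apply: xget_unique.
  exact/(is_mle_estimate _ n0 ndx).
by move=> om /(is_mle_estimate _ n0 ndx).
Qed.

(** If the first coordinates all coincide, [theta = t] and [eta = 1 / t] keep the exponent fixed; if
    the points lie on the least squares line, that line with [theta = eta = t] does. Only the
    normalization then depends on [t], and it blows up as [t] tends to 0. *)
Lemma degenerate_likelihood n (x : n.-tuple obs) : ~~ nondegenerate x ->
  exists c : R, 0 < c /\ forall t, 0 < t -> exists om, param_space om /\
    likelihood x om = (2 * pi * t) ^- n * c.
Proof.
have s0 : 0 <= ss11 x by apply: sumr_ge0 => i _; exact: sqr_ge0.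
have r0 : 0 <= rss x by apply: sumr_ge0 => i _; exact: sqr_ge0.
rewrite negb_and -!leNgt => /orP[le0|le0].
  exists (expR (- 2^-1 * \sum_(i < n) (tnth x i).2 ^+ 2)); split=> [|t t0].
    exact: expR_gt0.
  exists (mean1 x, 0, 0, t, t^-1); split.
    by apply/param_spaceP; rewrite invr_gt0.
  rewrite likelihood_prodE/= divff ?lt0r_neq0// divr1 -/(ss11 x).
  have -> : ss11 x = 0 by apply/eqP; rewrite eq_le le0 s0.
  rewrite mulr0 mul0r addr0; congr (_ * expR (_ * _)).
  by apply: eq_bigr => i _; rewrite mul0r !subr0.
exists (expR (- 2^-1 * ss11 x)); split=> [|t t0].
  exact: expR_gt0.
exists (mean1 x, mean2 x, slope x, t, t); split.
  exact/param_spaceP.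
rewrite likelihood_prodE/= -/(ss11 x) -/(rss x).
have -> : rss x = 0 by apply/eqP; rewrite eq_le le0 r0.
by rewrite mul0r add0r [t * ss11 x]mulrC mulfK ?lt0r_neq0.
Qed.

Lemma likelihood_gt0 n (x : n.-tuple obs) om : param_space om -> 0 < likelihood x om.
Proof. by move=> Om; apply: prodr_gt0 => i _; exact: binormal_pdf_gt0. Qed.

Lemma mle_degenerate n (x : n.-tuple obs) : (0 < n)%N -> ~~ nondegenerate x ->
  mle x = (0, 0, 0, 1, 1).
Proof.
move=> n0 /degenerate_likelihood[c [c0 unb]]; apply: xgetPN => om [Om mx].
have L0 := likelihood_gt0 x Om; set L := likelihood x om in mx L0.
(* With [2 pi t = 1 / q] the likelihood is [q^n c >= q c = c + L > L], against maximality of [L]. *)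
pose q := 1 + L / c.
have q1 : 1 <= q by rewrite lerDl divr_ge0 ?ltW.
have q0 : 0 < q by exact: lt_le_trans q1.
have t0 : 0 < (2 * pi * q)^-1 by rewrite invr_gt0 !mulr_gt0 ?pi_gt0.
have [om' [Om' E]] := unb _ t0; have := mx _ Om'; rewrite E.
have -> : 2 * pi * (2 * pi * q)^-1 = q^-1.
  by move: (pi) (pi_gt0 R) => p p0; field; rewrite !lt0r_neq0.
rewrite exprVn invrK leNgt => /negP; apply.
apply: (@lt_le_trans _ _ (q * c)).
  by rewrite mulrDl mul1r divfK ?lt0r_neq0// ltrDr.
by rewrite ler_pM2r// ler_eXnr.
Qed.

Lemma mulr_sqrtr (a b : R) : 0 < a -> a * Num.sqrt b = Num.sqrt (a ^+ 2 * b).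
Proof. by move=> a0; rewrite sqrtrM ?sqr_ge0// sqrtr_sqr gtr0_norm. Qed.

Definition gacts om n (z : n.-tuple obs) : n.-tuple obs :=
  [tuple gact om (tnth z i) | i < n].

Section equivariance.
Variables (om : param) (n : nat) (z : n.-tuple obs).
Hypotheses (Om : param_space om) (n0 : (0 < n)%N).
Let l1 := Num.sqrt (om.1.2 / om.2).
Let l2 := Num.sqrt (om.1.2 * om.2).
Let t0 : 0 < om.1.2. Proof. by have /param_spaceP[] := Om. Qed.
Let e0 : 0 < om.2. Proof. by have /param_spaceP[] := Om. Qed.
Let l10 : 0 < l1. Proof. by rewrite sqrtr_gt0 divr_gt0. Qed.
Let l20 : 0 < l2. Proof. by rewrite sqrtr_gt0 mulr_gt0. Qed.
Let nR : n%:R != 0 :> R. Proof. by rewrite pnatr_eq0 -lt0n. Qed.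

Let l21 : l2 = om.2 * l1.
Proof.
rewrite /l2 /l1 mulr_sqrtr//.
congr Num.sqrt; move: om.1.2 om.2 t0 e0 => t e t1 e1; field; exact: lt0r_neq0.
Qed.

Lemma mean1_gacts : mean1 (gacts om z) = om.1.1.1.1 + l1 * mean1 z.
Proof.
rewrite /mean1; under eq_bigr do rewrite tnth_mktuple /=.
rewrite big_split/= sumr_const card_ord -mulr_sumr mulrDl mulrA.
by rewrite -[X in X / _]mulr_natr mulfK.
Qed.

Lemma mean2_gacts : mean2 (gacts om z) =
  om.1.1.1.2 + om.1.1.2 * (l1 * mean1 z) + l2 * mean2 z.
Proof.
rewrite /mean2 /mean1; under eq_bigr do rewrite tnth_mktuple /=.
rewrite !big_split/= sumr_const card_ord -!mulr_sumr !mulrDl !mulrA.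
by rewrite -[X in X / _]mulr_natr mulfK.
Qed.

Let dev1 i : (tnth (gacts om z) i).1 - mean1 (gacts om z) =
  l1 * ((tnth z i).1 - mean1 z).
Proof.
by rewrite mean1_gacts tnth_mktuple /= -/l1 opprD addrACA subrr add0r mulrBr.
Qed.

Let dev2 i : (tnth (gacts om z) i).2 - mean2 (gacts om z) =
  om.1.1.2 * (l1 * ((tnth z i).1 - mean1 z)) + l2 * ((tnth z i).2 - mean2 z).
Proof.
rewrite mean2_gacts tnth_mktuple /= -/l1 -/l2.
by move: (mean1 z) (mean2 z) om.1.1.1.2 om.1.1.2 (tnth z i).1 (tnth z i).2 (l1) (l2);
  move=> *; ring.
Qed.

Lemma ss11_gacts : ss11 (gacts om z) = om.1.2 / om.2 * ss11 z.
Proof.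
rewrite /ss11; under eq_bigr do rewrite dev1 exprMn.
by rewrite -mulr_sumr sqr_sqrtr// divr_ge0 ?ltW.
Qed.

(** When [ss11 z] is 0 both slopes are 0 by the convention on division, and the identity would force
    [beta = 0]. *)
Lemma slope_gacts : ss11 z != 0 ->
  slope (gacts om z) = om.1.1.2 + om.2 * slope z.
Proof.
move=> s0; rewrite {1}/slope ss11_gacts.
have -> : ss12 (gacts om z) = om.1.1.2 * (om.1.2 / om.2) * ss11 z + om.1.2 * ss12 z.
  have l11 : l1 ^+ 2 = om.1.2 / om.2 by rewrite sqr_sqrtr// divr_ge0 ?ltW.
  have l12 : l1 * l2 = om.1.2.
    rewrite l21 mulrCA -expr2 l11.
    by move: om.1.2 om.2 t0 e0 => t e t1 e1; field; exact: lt0r_neq0.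
  rewrite -{2}l12 -l11 /ss12 /ss11 !mulr_sumr -big_split/=.
  apply: eq_bigr => i _; rewrite dev1 dev2.
  move: om.1.1.2 (l1) (l2) (mean1 z) (mean2 z) (tnth z i).1 (tnth z i).2.
  by move=> *; ring.
rewrite /slope; move: om.1.2 om.2 om.1.1.2 (ss11 z) (ss12 z) t0 e0 s0.
by move=> t e b p q t1 e1 p0; field; rewrite p0 !lt0r_neq0.
Qed.

Lemma rss_gacts : ss11 z != 0 -> rss (gacts om z) = om.1.2 * om.2 * rss z.
Proof.
move=> s0; rewrite /rss slope_gacts//.
have <- : l2 ^+ 2 = om.1.2 * om.2 by rewrite sqr_sqrtr// mulr_ge0 ?ltW.
rewrite mulr_sumr; apply: eq_bigr => i _; rewrite dev1 dev2 l21.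
move: om.1.1.2 (l1) om.2 (mean1 z) (mean2 z) (slope z) (tnth z i).1 (tnth z i).2.
by move=> *; ring.
Qed.

Lemma nondegenerate_gacts : nondegenerate (gacts om z) = nondegenerate z.
Proof.
rewrite /nondegenerate ss11_gacts pmulr_rgt0 ?divr_gt0//.
case: ltP => //= s0; rewrite rss_gacts ?lt0r_neq0// pmulr_rgt0// mulr_gt0//.
Qed.

Lemma estimate_gacts : nondegenerate z ->
  estimate (gacts om z) = gmul om (estimate z).
Proof.
move=> /andP[s0 r0]; rewrite /estimate /gmul /=.
rewrite mean1_gacts mean2_gacts slope_gacts ?lt0r_neq0// ss11_gacts rss_gacts ?lt0r_neq0//.
congr (_, _, _, _, _).
- rewrite [RHS]mulrA; congr (_ / _).
  rewrite mulr_sqrtr//.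
  congr Num.sqrt; move: om.1.2 om.2 t0 e0 (ss11 z) (rss z).
  by move=> t e t1 e1 p q; field; exact: lt0r_neq0.
- rewrite mulr_sqrtr//.
  congr Num.sqrt; move: om.1.2 om.2 t0 e0 (ss11 z) (rss z) s0 r0.
  by move=> t e t1 e1 p q p0 q0; field; rewrite !lt0r_neq0.
Qed.

End equivariance.

End maximum_likelihood.

(** * Independent samples *)

Section independence.
Context d d' (T : measurableType d) (T' : measurableType d') {R : realType}.
Variable P : probability T R.
Implicit Types X : nat -> T -> T'.
Local Open Scope ereal_scope.

(** Independence of initial segments, for plain functions: the form that [shift] preserves, as the
    induction on the sample size requires. *)
Definition initially_independent X := forall n (A : nat -> set T'),
  (forall i, measurable (A i)) ->
  P (\bigcap_(i in `I_n) (X i @^-1` A i)) = \prod_(i < n) P (X i @^-1` A i).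

Lemma mutually_independent_initially (X : nat -> {RV P >-> T'}) :
  mutually_independent X -> initially_independent (fun i => X i).
Proof.
move=> iX n A mA; pose J := [fset i in iota 0 n]%fset.
have mJ i : (i \in J) = (i < n)%N by rewrite !inE/= mem_iota.
rewrite (_ : `I_n = [set` J]).
  rewrite (iX J A mA) -(big_mkord xpredT (fun i => P (X i @^-1` A i))).
  apply: perm_big; apply: uniq_perm; rewrite ?fset_uniq ?iota_uniq//.
  by move=> i; rewrite mJ mem_iota subn0 add0n.
by apply/seteqP; split => i /=; rewrite mJ.
Qed.

Definition observe X n (t : T) : n.-tuple T' := [tuple X i t | i < n].

Definition shift X := fun i => X i.+1.

Lemma observeS X n t :
  observe X n.+1 t = [tuple of X 0%N t :: observe (shift X) n t].
Proof.
apply: eq_from_tnth => i; rewrite tnth_mktuple.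
case: (unliftP ord0 i) => [j ->|->]; last by rewrite tnth0.
by rewrite tnthS tnth_mktuple.
Qed.

Lemma measurable_observe X n : (forall i, measurable_fun setT (X i)) ->
  measurable_fun setT (observe X n).
Proof.
move=> mX; apply/measurable_fun_tnthP => i.
by rewrite (_ : _ \o _ = X i)//; apply/funext => t /=; rewrite tnth_mktuple.
Qed.

Lemma measurable_shift X : (forall i, measurable_fun setT (X i)) ->
  forall i, measurable_fun setT (shift X i).
Proof. by move=> mX i; exact: mX. Qed.

Definition rect n (A : nat -> set T') : set (n.-tuple T') :=
  [set x | forall i : 'I_n, A i (tnth x i)].

Lemma measurable_preim (f : T -> T') A : measurable_fun setT f ->
  measurable A -> measurable (f @^-1` A).
Proof. by move=> mf mA; rewrite -[X in measurable X]setTI; exact: mf. Qed.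

Lemma initially_independent_rect X n A B :
  (forall i, measurable_fun setT (X i)) -> initially_independent X ->
  measurable A -> (forall i, measurable (B i)) ->
  P (X 0%N @^-1` A `&` observe (shift X) n @^-1` rect B) =
  P (X 0%N @^-1` A) * P (observe (shift X) n @^-1` rect B).
Proof.
move=> mX iX mA mB.
have E (C : set T') : P (X 0%N @^-1` C `&` observe (shift X) n @^-1` rect B) =
    P (\bigcap_(i in `I_n.+1) (X i @^-1` (if i is j.+1 then B j else C))).
  congr (P _); apply/seteqP; split => t /=.
    move=> [Ct Bt] [|i]//= ilt.
    by have := Bt (Ordinal (ilt : (i < n)%N)); rewrite tnth_mktuple.
  move=> H; split; first exact: (H 0%N).
  by move=> i; rewrite tnth_mktuple; apply: (H i.+1); rewrite /= ltnS.
have F (C : set T') : measurable C ->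
    P (X 0%N @^-1` C `&` observe (shift X) n @^-1` rect B) =
    P (X 0%N @^-1` C) * \prod_(i < n) P (X i.+1 @^-1` B i).
  by move=> mC; rewrite E iX ?big_ord_recl// => -[|i].
(* The case [C = setT] identifies the product with the probability of the rectangle. *)
rewrite F//; congr (_ * _); have := F setT measurableT.
by rewrite preimage_setT setTI probability_setT mul1e.
Qed.

Lemma measurable_rect n A : (forall i, measurable (A i)) -> measurable (@rect n A).
Proof.
move=> mA; rewrite (_ : rect A = \bigcap_(i in [set: 'I_n]) ((@tnth n T')^~ i @^-1` A i)).
  apply: fin_bigcap_measurable => // i _.
  by rewrite -[X in measurable X]setTI; exact: measurable_tnth.
by apply/seteqP; split=> x /= H i; [move=> _; exact: H|exact: H].
Qed.

(** The sigma-algebra on tuples is generated by preimages under single coordinates, and each is a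
    rectangle whose other sides are full. *)
Lemma measurable_tuple_rect n (B : set (n.-tuple T')) : measurable B ->
  <<s [set C | exists2 A : nat -> set T', (forall i, measurable (A i)) & C = rect A] >> B.
Proof.
set G := (X in <<s X >>).
suff : @measurable _ (n.-tuple T') `<=` <<s G >> by exact.
apply: smallest_sub; first exact: smallest_sigma_algebra.
move=> C; rewrite -bigcup_seq => -[i _ /= [Y mY <-]].
apply: sub_sigma_algebra.
exists (fun j => if j == i :> nat then Y else setT).
  by move=> j; case: ifP.
rewrite setTI; apply/seteqP; split => x /=.
  by move=> Yx j /=; case: eqP => // /val_inj ->.
by move=> /(_ i); rewrite eqxx.
Qed.

(** For fixed [A] both sides are finite measures in [B]; they agree on rectangles, which are stable
    under intersection and generate. *)
Lemma initially_independent_cons X n A B :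
  (forall i, measurable_fun setT (X i)) -> initially_independent X ->
  measurable A -> measurable B ->
  P (X 0%N @^-1` A `&` observe (shift X) n @^-1` B) =
  P (X 0%N @^-1` A) * P (observe (shift X) n @^-1` B).
Proof.
move=> mX iX mA mB.
have mX0A : measurable (X 0%N @^-1` A) by exact: measurable_preim.
have mo := @measurable_observe (shift X) n (measurable_shift mX).
pose c : {nonneg R} := NngNum (fine_ge0 (measure_ge0 P (X 0%N @^-1` A))).
pose m1 := image_measure (mrestr P mX0A) mo.
pose m2 := mscale c (image_measure P mo).
have m1E C : m1 C = P (X 0%N @^-1` A `&` observe (shift X) n @^-1` C).
  by rewrite setIC.
have m2E C : m2 C = P (X 0%N @^-1` A) * P (observe (shift X) n @^-1` C).
  by rewrite /m2 /mscale/= fineK// fin_num_measure.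
rewrite -m1E -m2E.
apply: (@g_sigma_algebra_measure_unique _ R _ _ _ (fun=> setT)) (measurable_tuple_rect mB).
- by move=> _ [C mC ->]; exact: measurable_rect.
- move=> _; exists (fun=> setT) => //; by apply/seteqP; split.
- by rewrite bigcup_const.
- move=> _ _ [C1 mC1 ->] [C2 mC2 ->]; exists (fun i => C1 i `&` C2 i).
    by move=> i; exact: measurableI.
  apply/seteqP; split=> x /= => [[H1 H2] i|H]; split; try exact: H1; try exact: H2.
    by move=> i; have [] := H i.
  by move=> i; have [] := H i.
- move=> _ [C mC ->]; apply: (etrans (m1E _)).
  apply: (etrans _ (esym (m2E _))); exact: initially_independent_rect.
- move=> _; apply: (le_lt_trans _ (ltry 1)); rewrite (m1E setT) preimage_setT setIT.
  exact: probability_le1.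
Qed.

Section law.
Context d1 (T1 : measurableType d1).
Variables (f : T -> T1) (mf : measurable_fun setT f).

(** A name of its own, to which the probability structure needed for product measures can be
    attached. *)
Definition law : set T1 -> \bar R := image_measure P mf.

HB.instance Definition _ := Measure.copy law (image_measure P mf).

Lemma law_setT : law setT = 1.
Proof. by rewrite /law/= /pushforward preimage_setT probability_setT. Qed.

HB.instance Definition _ := Measure_isProbability.Build _ _ _ law law_setT.

Lemma ge0_integral_law (h : T1 -> \bar R) :
  measurable_fun setT h -> (forall x, 0 <= h x) ->
  \int[law]_x h x = \int[P]_t h (f t).
Proof. by move=> mh h0; rewrite ge0_integral_pushforward. Qed.

End law.

(** Independence makes the joint law of head and tail a product, split by Tonelli. The inner
    integral stays over [P], where an induction hypothesis about the shifted sequence can be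
    used. *)
Lemma ge0_integral_observe_cons X n (h : T' * n.-tuple T' -> \bar R)
    (mX : forall i, measurable_fun setT (X i)) :
  initially_independent X ->
  measurable_fun setT h -> (forall x, 0 <= h x) ->
  \int[P]_t h (X 0%N t, observe (shift X) n t) =
  \int[law (mX 0%N)]_x \int[P]_t h (x, observe (shift X) n t).
Proof.
move=> iX mh h0.
have mo := @measurable_observe (shift X) n (measurable_shift mX).
have mXo : measurable_fun setT (fun t => (X 0%N t, observe (shift X) n t)).
  exact: measurable_fun_pair.
rewrite -(ge0_integral_law mXo mh h0).
rewrite (eq_measure_integral (prod_measure (law (mX 0%N)) (law mo))).
  rewrite (tonelli1 _ _ mh h0); apply: eq_integral => x _.
  have mhx : measurable_fun setT (fun y => h (x, y)) by exact: (measurable_fun_pair2 _ mh).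
  by rewrite (ge0_integral_law mo mhx).
move=> B mB _; apply/esym; apply: product_measure_unique => //.
by move=> A1 A2 mA1 mA2; exact: initially_independent_cons.
Qed.

End independence.

(** * Integration against a measure given by a density *)

Section density.
Context d (T : measurableType d) {R : realType}.
Local Open Scope ereal_scope.
Import HBNNSimple.

(** The hypothesis is the case of indicators; it extends to simple functions by linearity and to [k]
    by monotone convergence. *)
Lemma ge0_integral_density (m nu : {measure set T -> \bar R}) (f : T -> R)
    (k : T -> \bar R) :
  measurable_fun setT f -> (forall x, 0 <= f x)%R ->
  (forall A, measurable A -> m A = \int[nu]_(x in A) (f x)%:E) ->
  measurable_fun setT k -> (forall x, 0 <= k x) ->
  \int[m]_x k x = \int[nu]_x (k x * (f x)%:E).
Proof.
move=> mf f0 mE mk k0.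
have mfE : measurable_fun setT (EFin \o f) by exact/measurable_EFinP.
pose k_ := nnsfun_approx measurableT mk.
have cvgk x : (k_ n x)%:E @[n --> \oo] --> k x.
  by apply: cvg_nnsfun_approx.
transitivity (limn (fun n => \int[m]_x (k_ n x)%:E)).
  rewrite -monotone_convergence//.
  - by apply: eq_integral => x _; apply/esym/cvg_lim.
  - by move=> n; exact/measurable_EFinP.
  - by move=> n x _; rewrite lee_fin.
  - by move=> x _ a b ab; rewrite lee_fin; exact/lefP/nd_nnsfun_approx.
transitivity (limn (fun n => \int[nu]_x ((k_ n x)%:E * (f x)%:E))); last first.
  rewrite -monotone_convergence//.
  - apply: eq_integral => x _; apply/cvg_lim => //.
    exact: cvgeZr.
  - move=> n; apply: emeasurable_funM => //; exact/measurable_EFinP.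
  - by move=> n x _; rewrite mule_ge0 ?lee_fin.
  - move=> x _ a b ab; rewrite lee_wpmul2r ?lee_fin//.
    exact/lefP/nd_nnsfun_approx.
congr (limn _); apply/funext => n.
transitivity (\sum_(r \in range (k_ n)) \int[nu]_x (r%:E * ((\1_(k_ n @^-1` [set r]) x)%:E * (f x)%:E))).
  rewrite integralT_nnsfun sintegralE; apply: eq_fsbigr => r.
  rewrite inE => -[y _ <-].
  rewrite ge0_integralT_Zl//.
  - congr (_ * _); rewrite mE// integral_mkcond; apply: eq_integral => x _.
    rewrite patchE indicE; case: ifPn => _; first by rewrite mul1e.
    by rewrite mul0e.
  - by apply: emeasurable_funM => //; exact/measurable_EFinP.
  - by move=> x; rewrite mule_ge0 ?lee_fin.
rewrite -ge0_integral_fsum//.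
- apply: eq_integral => x _; rewrite [in RHS]fimfunE -fsumEFin// ge0_mule_fsuml//.
    by apply: eq_fsbigr => r _; rewrite muleA.
  by move=> r; rewrite nnfun_muleindic_ge0.
- move=> r; apply: emeasurable_funM => //; apply: emeasurable_funM => //.
  exact/measurable_EFinP.
- move=> r x _; rewrite muleA mule_ge0 ?lee_fin//.
  exact: (nnfun_muleindic_ge0 (k_ n) r x).
Qed.

End density.

(** * Change of the sampling parameter *)

Section change_of_parameter.
Context {R : realType} d (T : measurableType d) (P : probability T R).
Notation MR := (measurableTypeR R).
Notation mu := (@lebesgue_measure R).
Notation obs := (MR * MR)%type.
Notation param := (MR * MR * MR * MR * MR)%type.
Local Open Scope ereal_scope.

Definition ginv (om : param) (x : obs) : obs :=
  ((x.1 - om.1.1.1.1) / Num.sqrt (om.1.2 / om.2),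
   (x.2 - om.1.1.1.2 - om.1.1.2 * (x.1 - om.1.1.1.1)) / Num.sqrt (om.1.2 * om.2))%R.

Lemma measurable_ginv om : measurable_fun setT (ginv om).
Proof. by rewrite /ginv; mfun. Qed.

Let sqrt_neq0 (om : param) : param_space om ->
  (Num.sqrt (om.1.2 / om.2) != 0)%R /\ (Num.sqrt (om.1.2 * om.2) != 0)%R.
Proof.
by move=> /param_spaceP[t0 e0]; rewrite !lt0r_neq0 ?sqrtr_gt0 ?divr_gt0 ?mulr_gt0.
Qed.

Lemma gactK om : param_space om -> cancel (gact om) (ginv om).
Proof.
move=> /sqrt_neq0[l1 l2] [u v]; rewrite /gact /ginv /= !(addrC om.1.1.1.1) addrK.
congr (_, _); first by rewrite mulrAC divff// mul1r.
rewrite (_ : _ - _ - _ = v * Num.sqrt (om.1.2 * om.2))%R ?mulfK//.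
by move: om.1.1.1.2 om.1.1.2 (Num.sqrt _) (Num.sqrt _) => *; ring.
Qed.

Lemma ginvK om : param_space om -> cancel (ginv om) (gact om).
Proof.
move=> /sqrt_neq0[l1 l2] [u v]; rewrite /gact /ginv /=.
congr (_, _); first by rewrite mulrC divfK// addrC subrK.
rewrite [(Num.sqrt (om.1.2 / om.2) * _)%R]mulrC divfK//.
rewrite [(Num.sqrt (om.1.2 * om.2) * _)%R]mulrC divfK//.
by move: om.1.1.1.2 om.1.1.2 om.1.1.1.1 => *; ring.
Qed.

Definition density_ratio (om0 om : param) (x : obs) : R :=
  (binormal_pdf om x / binormal_pdf om0 x)%R.

Lemma density_ratio_ge0 om0 om x : param_space om0 -> param_space om ->
  (0 <= density_ratio om0 om x)%R.
Proof. by move=> O0 O; rewrite divr_ge0// ltW// binormal_pdf_gt0. Qed.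

Lemma measurable_density_ratio om0 om : measurable_fun setT (density_ratio om0 om).
Proof.
apply: measurable_funM; first exact: measurable_binormal_pdf.
by apply: measurable_fun_inv; exact: measurable_binormal_pdf.
Qed.

Definition has_density (om0 : param) (X : T -> obs) := forall A, measurable A ->
  P (X @^-1` A) = \int[leb2]_(x in A) (binormal_pdf om0 x)%:E.

Section one_variable.
Variables (om0 : param) (X : T -> obs) (mX : measurable_fun setT X).
Hypotheses (O0 : param_space om0) (hX : has_density om0 X).

Lemma ge0_integral_law_density (k : obs -> \bar R) :
  measurable_fun setT k -> (forall x, 0 <= k x) ->
  \int[law P mX]_x k x = \int[leb2]_x (k x * (binormal_pdf om0 x)%:E).
Proof.
move=> mk k0; apply: ge0_integral_density => //.
- exact: measurable_binormal_pdf.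
- by move=> x; exact/ltW/binormal_pdf_gt0.
Qed.

(** Standardizing by [om0] and then acting by [om] carries the law at [om0] to the law at [om]. Both
    sides pass through the standard normal integral. *)
Lemma ge0_integral_law_gact om (k : obs -> \bar R) : param_space om ->
  measurable_fun setT k -> (forall x, 0 <= k x) ->
  \int[law P mX]_x k (gact om (ginv om0 x)) =
  \int[law P mX]_x (k x * (density_ratio om0 om x)%:E).
Proof.
move=> O mk k0.
have mk1 : measurable_fun setT (fun x => k (gact om (ginv om0 x))).
  apply: (measurableT_comp mk); apply: (measurableT_comp (measurable_gact om)).
  exact: measurable_ginv.
have mk2 : measurable_fun setT (fun x => k x * (density_ratio om0 om x)%:E).
  apply: emeasurable_funM => //; apply/measurable_EFinP.
  exact: measurable_density_ratio.
have k20 x : 0 <= k x * (density_ratio om0 om x)%:E.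
  by rewrite mule_ge0// lee_fin density_ratio_ge0.
rewrite (ge0_integral_law_density mk1 (fun _ => k0 _)).
rewrite (ge0_integral_law_density mk2 k20).
rewrite (ge0_integral_gact O0 mk1 (fun _ => k0 _)).
under eq_integral do rewrite gactK//.
rewrite -(ge0_integral_gact O mk k0); apply: eq_integral => x _.
rewrite -muleA -EFinM /density_ratio divfK// lt0r_neq0//.
exact: binormal_pdf_gt0.
Qed.

Lemma law_null L : measurable L -> leb2 L = 0 -> P (X @^-1` L) = 0.
Proof.
move=> mL L0; rewrite hX//; apply: null_set_integral => //.
by apply/measurable_funTS/measurable_EFinP; exact: measurable_binormal_pdf.
Qed.

End one_variable.

Definition iid_sequence (om0 : param) (X : nat -> T -> obs) :=
  [/\ forall i, measurable_fun setT (X i), initially_independent P X &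
      forall i, has_density om0 (X i)].

Lemma iid_shift om0 X : iid_sequence om0 X -> iid_sequence om0 (shift X).
Proof.
move=> [mX iX hX]; split; [exact: measurable_shift| |by move=> i; exact: hX].
move=> n A mA.
pose B i := if i is j.+1 then A j else setT.
have mB i : measurable (B i) by case: i => [|i]; [exact: measurableT|exact: mA].
have := iX n.+1 B mB; rewrite big_ord_recl /= preimage_setT probability_setT mul1e.
move=> <-; congr (P _); apply/seteqP; split => t /=.
  by move=> H [|i] ilt //; exact: H.
by move=> H i ilt; exact: (H i.+1).
Qed.

Lemma measurable_tuple_cons n :
  measurable_fun setT (fun z : obs * n.-tuple obs => [tuple of z.1 :: z.2]).
Proof. exact: (measurable_cons measurable_fst measurable_snd). Qed.

Definition tuple_act om0 om n (x : n.-tuple obs) : n.-tuple obs :=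
  [tuple gact om (ginv om0 (tnth x i)) | i < n].

Lemma measurable_tuple_act om0 om n : measurable_fun setT (@tuple_act om0 om n).
Proof.
apply/measurable_fun_tnthP => i.
rewrite (_ : _ \o _ = fun x => gact om (ginv om0 (tnth x i))); last first.
  by apply/funext => x /=; rewrite tnth_mktuple.
apply: (measurableT_comp (measurable_gact om)).
by apply: (measurableT_comp (measurable_ginv om0)); exact: measurable_tnth.
Qed.

Lemma tuple_act_cons om0 om n (p : obs) (x : n.-tuple obs) :
  tuple_act om0 om [tuple of p :: x] =
  [tuple of gact om (ginv om0 p) :: tuple_act om0 om x].
Proof.
apply: eq_from_tnth => i; rewrite tnth_mktuple.
case: (unliftP ord0 i) => [j ->|->]; last by rewrite !tnth0.
by rewrite !tnthS tnth_mktuple.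
Qed.

Definition likelihood_ratio om0 om n (x : n.-tuple obs) : R :=
  \prod_(i < n) density_ratio om0 om (tnth x i).

Lemma likelihood_ratioE om0 om n (x : n.-tuple obs) :
  likelihood_ratio om0 om x = (likelihood x om / likelihood x om0)%R.
Proof. by rewrite /likelihood_ratio /likelihood big_split/= prodfV. Qed.

Lemma measurable_likelihood_ratio om0 om n :
  measurable_fun setT (@likelihood_ratio om0 om n).
Proof.
apply: measurable_prod => i _.
by apply: (measurableT_comp (measurable_density_ratio om0 om)); exact: measurable_tnth.
Qed.

(** Induction on the sample size: for a fixed head the tail is changed by the induction hypothesis,
    then for a fixed tail the head is changed by the case of one observation. *)
Lemma change_of_parameter om0 om n X (h : n.-tuple obs -> \bar R) :
  param_space om0 -> param_space om -> iid_sequence om0 X ->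
  measurable_fun setT h -> (forall x, 0 <= h x) ->
  \int[P]_t h (tuple_act om0 om (observe X n t)) =
  \int[P]_t (h (observe X n t) * (likelihood_ratio om0 om (observe X n t))%:E).
Proof.
move=> O0 O; elim: n X h => [|n IH] X h iidX mh h0.
  apply: eq_integral => t _; rewrite /likelihood_ratio big_ord0 mule1.
  by congr h; apply: eq_from_tnth => -[].
have [mX iX hX] := iidX.
have lr0 m (x : m.-tuple obs) : (0 <= likelihood_ratio om0 om x)%R.
  by apply: prodr_ge0 => i _; exact: density_ratio_ge0.
pose g := gact om \o ginv om0.
have mg : measurable_fun setT g.
  by apply: (measurableT_comp (measurable_gact om)); exact: measurable_ginv.
have mhc : measurable_fun setT (fun z : obs * n.-tuple obs => h [tuple of z.1 :: z.2]).
  by apply: (measurableT_comp mh); exact: measurable_tuple_cons.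
have ma := @measurable_tuple_act om0 om n.
pose H1 (z : obs * n.-tuple obs) := h [tuple of g z.1 :: tuple_act om0 om z.2].
have mH1 : measurable_fun setT H1.
  apply: (measurableT_comp mhc (g := fun z : obs * n.-tuple obs =>
    (g z.1, tuple_act om0 om z.2))); apply: measurable_fun_pair.
    exact: (measurableT_comp mg).
  exact: (measurableT_comp ma).
have mlr : measurable_fun setT (fun z : obs * n.-tuple obs =>
    (likelihood_ratio om0 om z.2)%:E).
  apply/measurable_EFinP.
  by apply: (measurableT_comp (@measurable_likelihood_ratio om0 om n)).
have mdr : measurable_fun setT (fun z : obs * n.-tuple obs =>
    (density_ratio om0 om z.1)%:E).
  apply/measurable_EFinP.
  by apply: (measurableT_comp (@measurable_density_ratio om0 om)).
pose K (z : obs * n.-tuple obs) :=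
  h [tuple of z.1 :: z.2] * (likelihood_ratio om0 om z.2)%:E.
have mK : measurable_fun setT K by exact: emeasurable_funM.
have K0 z : 0 <= K z by rewrite mule_ge0// lee_fin.
pose H2 z := K z * (density_ratio om0 om z.1)%:E.
have mH2 : measurable_fun setT H2 by exact: emeasurable_funM.
have H20 z : 0 <= H2 z by rewrite mule_ge0// lee_fin density_ratio_ge0.
have mo := @measurable_observe _ _ _ _ (shift X) n (measurable_shift mX).
have mKo : measurable_fun setT (fun z : obs * T => K (g z.1, observe (shift X) n z.2)).
  apply: (measurableT_comp mK); apply: measurable_fun_pair.
    exact: (measurableT_comp mg).
  exact: (measurableT_comp mo).
have mH2o : measurable_fun setT (fun z : obs * T => H2 (z.1, observe (shift X) n z.2)).
  apply: (measurableT_comp mH2); apply: measurable_fun_pair => //.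
  exact: (measurableT_comp mo).
transitivity (\int[P]_t H1 (X 0%N t, observe (shift X) n t)).
  by apply: eq_integral => t _; rewrite observeS tuple_act_cons.
rewrite (ge0_integral_observe_cons mX iX mH1 (fun _ => h0 _)).
transitivity (\int[law P (mX 0%N)]_x \int[P]_t K (g x, observe (shift X) n t)).
  apply: eq_integral => x _.
  apply: (IH (shift X) (fun y => h [tuple of g x :: y])) => //.
    exact: iid_shift.
  exact: (measurable_fun_pair2 _ mhc).
(* The order of integration is exchanged so that the head becomes the inner variable. *)
rewrite -(tonelli1 (law P (mX 0%N)) P mKo (fun _ => K0 _)).
rewrite (tonelli2 (law P (mX 0%N)) P mKo (fun _ => K0 _)).
transitivity (\int[P]_t \int[law P (mX 0%N)]_x H2 (x, observe (shift X) n t)).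
  apply: eq_integral => t _ /=.
  apply: (@ge0_integral_law_gact om0 (X 0%N) (mX 0%N) O0 (hX 0%N) om
    (fun x => K (x, observe (shift X) n t))) => //.
  exact: (measurable_fun_pair1 _ mK).
rewrite -(tonelli2 (law P (mX 0%N)) P mH2o (fun _ => H20 _)).
rewrite (tonelli1 (law P (mX 0%N)) P mH2o (fun _ => H20 _)).
rewrite -(ge0_integral_observe_cons mX iX mH2 H20).
apply: eq_integral => t _; rewrite observeS /H2 /K -muleA -EFinM; congr (_ * _%:E).
rewrite /likelihood_ratio [in RHS]big_ord_recl tnth0 mulrC; congr (_ * _)%R.
by apply: eq_bigr => i _; rewrite tnthS.
Qed.

End change_of_parameter.

(** * Almost sure nondegeneracy *)

Section nondegenerate_sample.
Context {R : realType} d (T : measurableType d) (P : probability T R).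
Notation MR := (measurableTypeR R).
Notation mu := (@lebesgue_measure R).
Notation obs := (MR * MR)%type.
Notation param := (MR * MR * MR * MR * MR)%type.
Local Open Scope ereal_scope.

Lemma leb2_vertical_line (c : R) : leb2 [set x : obs | x.1 = c] = 0.
Proof.
rewrite (_ : [set x : obs | x.1 = c] = [set c] `*` setT); last first.
  by apply/seteqP; split => -[a b] //= -[].
have m1 : measurable ([set c] : set MR) by exact: measurable_set1.
rewrite [LHS](@product_measure1E _ _ _ _ R mu mu _ _ m1 measurableT).
rewrite -[RHS](mul0e (mu setT)); congr (_ * _); exact: lebesgue_measure_set1.
Qed.

(** Every vertical section is a single point, and the product measure is by definition the integral
    of the measures of sections. *)
Lemma leb2_graph (f : R -> R) : leb2 [set x : obs | x.2 = f x.1] = 0.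
Proof.
change (\int[mu]_x (mu (xsection [set x : obs | x.2 = f x.1] x)) = 0).
apply: integral0_eq => x _; rewrite (_ : xsection _ _ = [set f x]).
  exact: lebesgue_measure_set1.
by apply/seteqP; split => y; rewrite /xsection /= ?inE//= => ->; rewrite inE.
Qed.

(** Given a tail outside [N], the head falls into a Lebesgue null section with probability 0,
    because it has a density; integrating over the tail gives the claim. *)
Lemma null_sections om0 X n (W : set (obs * n.-tuple obs)) (N : set (n.-tuple obs)) :
  param_space om0 -> iid_sequence P om0 X -> measurable W -> measurable N ->
  P (observe (shift X) n @^-1` N) = 0 ->
  (forall y, ~ N y -> leb2 [set x | W (x, y)] = 0) ->
  P [set t | W (X 0%N t, observe (shift X) n t)] = 0.
Proof.
move=> O0 [mX iX hX] mW mN PN0 LW.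
have mo := @measurable_observe _ _ _ _ (shift X) n (measurable_shift mX).
have mWX : measurable [set t | W (X 0%N t, observe (shift X) n t)].
  rewrite -[X in measurable X]setTI.
  have mXo : measurable_fun setT (fun t => (X 0%N t, observe (shift X) n t)).
    exact: measurable_fun_pair.
  exact: (mXo measurableT W mW).
pose h (z : obs * n.-tuple obs) : \bar R := (\1_W z)%:E.
have mh : measurable_fun setT h by apply/measurable_EFinP; exact: measurable_indic.
have h0 z : 0 <= h z by rewrite lee_fin.
have mho : measurable_fun setT (fun z : obs * T => h (z.1, observe (shift X) n z.2)).
  apply: (measurableT_comp mh); apply: measurable_fun_pair => //.
  exact: (measurableT_comp mo).
have -> : P [set t | W (X 0%N t, observe (shift X) n t)] =
    \int[P]_t h (X 0%N t, observe (shift X) n t).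
  rewrite -[X in P X]setIT -(integral_indic P measurableT mWX).
  by apply: eq_integral => t _.
rewrite (ge0_integral_observe_cons mX iX mh h0).
rewrite -(tonelli1 (law P (mX 0%N)) P mho (fun _ => h0 _)).
rewrite (tonelli2 (law P (mX 0%N)) P mho (fun _ => h0 _)).
have mI := measurable_integral_fst (law P (mX 0%N)) mho (fun _ => h0 _).
have mN' : measurable (observe (shift X) n @^-1` N).
  by rewrite -[X in measurable X]setTI; exact: mo.
rewrite (ge0_negligible_integral mN' measurableT mI _ PN0); last first.
  by move=> t _; exact: integral_ge0.
apply: integral0_eq => t [_ /= Nt].
have mWt : measurable [set x | W (x, observe (shift X) n t)].
  rewrite -[X in measurable X]setTI.
  have mp : measurable_fun setT (fun x : obs => (x, observe (shift X) n t)).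
    exact: pair2_measurable.
  exact: (mp measurableT W mW).
rewrite (_ : (fun x => _) = (fun x => (\1_[set x | W (x, observe (shift X) n t)] x)%:E)).
  rewrite integral_indic// setIT.
  exact: (law_null (hX 0%N) mWt (LW _ Nt)).
by [].
Qed.

(** Twice the signed area of the triangle [p q r]; it vanishes exactly when the points are
    collinear. *)
Definition cross (p q r : obs) : R :=
  ((q.1 - p.1) * (r.2 - p.2) - (q.2 - p.2) * (r.1 - p.1))%R.

(** If [ss11 x] is 0 the points share a vertical line; if [rss x] is 0 they lie on the least squares
    line. *)
Lemma degenerate_collinear n (x : n.-tuple obs) (i j k : 'I_n) :
  ~~ nondegenerate x -> cross (tnth x i) (tnth x j) (tnth x k) = 0%R.
Proof.
have s0 : (0 <= ss11 x)%R by apply: sumr_ge0 => l _; exact: sqr_ge0.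
have r0 : (0 <= rss x)%R by apply: sumr_ge0 => l _; exact: sqr_ge0.
rewrite negb_and -!leNgt => /orP[le0|le0].
  have /eqP : ss11 x = 0%R by apply/eqP; rewrite eq_le le0 s0.
  rewrite psumr_eq0; last by move=> l _; exact: sqr_ge0.
  move=> /allP H.
  have {}H l : (tnth x l).1 = mean1 x.
    by have := H l (mem_index_enum l); rewrite sqrf_eq0 => /eqP/subr0_eq.
  by rewrite /cross !H !subrr mul0r mulr0 subrr.
have /eqP : rss x = 0%R by apply/eqP; rewrite eq_le le0 r0.
rewrite psumr_eq0; last by move=> l _; exact: sqr_ge0.
move=> /allP H.
have {}H l : (tnth x l).2 = (mean2 x + slope x * ((tnth x l).1 - mean1 x))%R.
  have := H l (mem_index_enum l); rewrite sqrf_eq0 => /eqP/subr0_eq <-.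
  by rewrite addrC subrK.
by rewrite /cross !H; move: (mean1 x) (mean2 x) (slope x) (tnth x i).1
  (tnth x j).1 (tnth x k).1 => *; ring.
Qed.

(** Almost surely the second and third points have distinct abscissae. The line through them is then
    a graph, and the first point almost surely misses it. *)
Lemma collinear_null om0 X : param_space om0 -> iid_sequence P om0 X ->
  P [set t | cross (X 0%N t) (X 1%N t) (X 2%N t) = 0%R] = 0.
Proof.
move=> O0 iidX.
pose i0 : 'I_2 := ord0; pose i1 : 'I_2 := ord_max.
pose N : set (2.-tuple obs) := [set y | (tnth y i0).1 = (tnth y i1).1 :> R].
have mN : measurable N.
  rewrite (_ : N = [set y | (tnth y i0).1 == (tnth y i1).1 :> R]); last first.
    by apply/seteqP; split => y /eqP.
  by apply: measurable_set_bool; apply: measurable_fun_eqr; mfun.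
pose W : set (obs * 2.-tuple obs) :=
  [set z | cross z.1 (tnth z.2 i0) (tnth z.2 i1) = 0%R].
have mW : measurable W.
  rewrite (_ : W = [set z | cross z.1 (tnth z.2 i0) (tnth z.2 i1) == 0%R]); last first.
    by apply/seteqP; split => y /eqP.
  by apply: measurable_set_bool; apply: measurable_fun_eqr; rewrite /cross; mfun.
pose N1 : set (obs * 1.-tuple obs) := [set z | z.1.1 = (tnth z.2 ord0).1 :> R].
have mN1 : measurable N1.
  rewrite (_ : N1 = [set z | z.1.1 == (tnth z.2 ord0).1 :> R]); last first.
    by apply/seteqP; split => y /eqP.
  by apply: measurable_set_bool; apply: measurable_fun_eqr; mfun.
have PN : P (observe (shift X) 2 @^-1` N) = 0.
  rewrite -(@null_sections om0 (shift X) 1 N1 set0 O0)//.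
  - congr (P _); apply/seteqP; split => t /=; rewrite /N /N1 /= !tnth_mktuple//.
  - exact: iid_shift.
  - by rewrite preimage_set0 measure0.
  - by move=> y _; rewrite /N1/=; exact: leb2_vertical_line.
rewrite -(@null_sections om0 X 2 W N O0 iidX mW mN PN).
  by congr (P _); apply/seteqP; split => t /=; rewrite /W /= !tnth_mktuple.
move=> y /= Ny; rewrite /W /=.
set q := tnth y i0; set r := tnth y i1.
have qr : (r.1 - q.1 != 0)%R by rewrite subr_eq0; apply/eqP => E; apply: Ny.
rewrite (_ : [set x | _] = [set x : obs | x.2 =
  ((q.2 * (r.1 - x.1) - (q.1 - x.1) * r.2) / (r.1 - q.1))%R]).
  exact: (leb2_graph (fun u => (q.2 * (r.1 - u) - (q.1 - u) * r.2) / (r.1 - q.1))%R).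
apply/seteqP; split => -[a b] /= E.
  apply/eqP; rewrite eq_sym -(inj_eq (mulIf qr)) divfK// -subr_eq0 -oppr_eq0.
  by apply/eqP; rewrite -E /cross /=; move: q.1 q.2 r.1 r.2 => *; ring.
rewrite /cross /= E; move: q.1 q.2 r.1 r.2 qr => q1 q2 r1 r2 qr.
by field; exact: qr.
Qed.

(** Already the first three observations are almost surely not collinear; two points always would
    be. *)
Lemma nondegenerate_ae om0 X n : param_space om0 -> iid_sequence P om0 X ->
  (2 < n)%N -> P [set t | ~~ nondegenerate (observe X n t)] = 0.
Proof.
move=> O0 iidX n2; have [mX _ _] := iidX.
have mo := @measurable_observe _ _ _ _ X n mX.
apply/eqP; rewrite eq_le measure_ge0 andbT -(collinear_null O0 iidX).
apply: le_measure.
- rewrite inE; apply: measurable_set_bool; apply: measurable_neg.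
  by rewrite /nondegenerate /rss /slope /ss12 /ss11 /mean1 /mean2; mfun.
- rewrite inE (_ : [set t | _] = [set t | cross (X 0%N t) (X 1%N t) (X 2%N t) == 0%R]).
    have m0 := mX 0%N; have m1 := mX 1%N; have m2 := mX 2%N.
    by apply: measurable_set_bool; apply: measurable_fun_eqr; rewrite /cross; mfun.
  by apply/seteqP; split => y /eqP.
move=> t /= deg.
have := degenerate_collinear (Ordinal (ltn_trans (isT : 0 < 2)%N n2))
  (Ordinal (ltn_trans (isT : 1 < 2)%N n2)) (Ordinal n2) deg.
by rewrite !tnth_mktuple.
Qed.

End nondegenerate_sample.

(** * The posterior distribution *)

Section haar_posterior.
Context {R : realType}.
Notation MR := (measurableTypeR R).
Notation mu := (@lebesgue_measure R).
Notation obs := (MR * MR)%type.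
Notation param := (MR * MR * MR * MR * MR)%type.

Implicit Types (om s : param).

(** Convertible to [leb5], with the sigma-finite structure that Tonelli requires. *)
Definition lebesgue5 : {sigma_finite_measure set param -> \bar R} :=
  prod_measure (prod_measure (prod_measure (prod_measure mu mu) mu) mu) mu.

Definition in_param_space (s : param) := (0 < s.1.2) && (0 < s.2).

Lemma in_param_spaceP s : reflect (param_space s) (in_param_space s).
Proof.
by apply: (iffP andP) => [H|/param_spaceP//]; exact/param_spaceP.
Qed.

Lemma haarE om : param_space om -> haar om = @prior R om.
Proof.
move: om => [[[[a b] c] t] e] [/= t0 e0].
by rewrite /haar /prior/= t0 e0 !mul1r -invfM.
Qed.

Lemma haar_out om : ~ param_space om -> haar om = 0.
Proof.
move=> /in_param_spaceP; rewrite /in_param_space /haar negb_and.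
by case/orP => /negbTE ->; rewrite !(mul0r, mulr0).
Qed.

(** Expresses nondegeneracy through the estimate alone. If [ss11 x] or [rss x] is 0, the third
    square root argument aside, already [theta] of the estimate is 0. *)
Lemma in_param_space_estimate n (x : n.-tuple obs) : (0 < n)%N ->
  in_param_space (estimate x) = nondegenerate x.
Proof.
move=> n0; apply/idP/idP => [|/(estimate_param_space n0)/in_param_spaceP//].
have s0 : 0 <= ss11 x by apply: sumr_ge0 => i _; exact: sqr_ge0.
have r0 : 0 <= rss x by apply: sumr_ge0 => i _; exact: sqr_ge0.
rewrite /in_param_space /= pmulr_lgt0 ?invr_gt0 ?ltr0n// sqrtr_gt0 => /andP[sr _].
rewrite /nondegenerate !lt_def s0 r0 !andbT -negb_or.
by apply/negP => /orP[] /eqP E; move: sr; rewrite E ?mul0r ?mulr0 ltxx.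
Qed.

Lemma measurable_suff_likelihood n :
  measurable_fun setT (fun z : param * param => suff_likelihood n z.1 z.2).
Proof. by rewrite /suff_likelihood; mfun. Qed.

Lemma suff_likelihood_gt0 n s om : param_space om -> 0 < suff_likelihood n s om.
Proof.
move=> /param_spaceP[t0 e0]; rewrite mulr_gt0 ?expR_gt0// invr_gt0 exprn_gt0//.
by rewrite !mulr_gt0// pi_gt0.
Qed.

Lemma measurable_estimate n : measurable_fun setT (@estimate R n).
Proof.
by rewrite /estimate /rss /slope /ss12 /ss11 /mean1 /mean2; mfun.
Qed.

(* A strictly positive function with finite Haar integral. *)
Definition test_function (om : param) : R :=
  om.1.2 * om.2 * (normal_pdf 0 1 om.1.1.1.1 * normal_pdf 0 1 om.1.1.1.2 *
    normal_pdf 0 1 om.1.1.2 * normal_pdf 0 1 om.1.2 * normal_pdf 0 1 om.2).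

Lemma std_normal_gt0 x : 0 < normal_pdf 0 1 x :> R.
Proof.
rewrite normal_pdfE ?oner_neq0// mulr_gt0 ?expR_gt0//.
by rewrite normal_peak_gt0// oner_neq0.
Qed.

Lemma test_function_gt0 om : param_space om -> 0 < test_function om.
Proof.
by move=> /param_spaceP[t0 e0]; rewrite !mulr_gt0// std_normal_gt0.
Qed.

Lemma measurable_fun_std_normal d (T : measurableType d) (f : T -> R) :
  measurable_fun setT f -> measurable_fun setT (fun x => normal_pdf 0 1 (f x) : R).
Proof. by move=> mf; exact: (measurableT_comp (measurable_normal_pdf 0 1)). Qed.

Lemma measurable_test_function : measurable_fun setT test_function.
Proof.
rewrite /test_function; do ! apply: measurable_funM; try (by mfun);
  by apply: measurable_fun_std_normal; mfun.
Qed.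

Local Open Scope ereal_scope.

Lemma leb5E (f : param -> \bar R) : \int[leb5]_om f om = \int[lebesgue5]_om f om.
Proof. by []. Qed.

Lemma ge0_integral_prod_measure d (T : measurableType d)
    (m : {sigma_finite_measure set T -> \bar R}) (f : T -> R) (g : MR -> R) :
  measurable_fun setT f -> (forall x, 0 <= f x)%R ->
  measurable_fun setT g -> (forall y, 0 <= g y)%R ->
  \int[prod_measure m mu]_z (f z.1 * g z.2)%:E =
  (\int[m]_x (f x)%:E) * (\int[mu]_y (g y)%:E).
Proof.
move=> mf f0 mg g0.
have mfg : measurable_fun setT (fun z : T * MR => (f z.1 * g z.2)%:E).
  apply/measurable_EFinP/measurable_funM.
    exact: (measurableT_comp mf).
  exact: (measurableT_comp mg).
rewrite (tonelli2 _ _ mfg); last by move=> z; rewrite lee_fin mulr_ge0.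
have mfE : measurable_fun setT (EFin \o f) by exact/measurable_EFinP.
have mgE : measurable_fun setT (EFin \o g) by exact/measurable_EFinP.
rewrite -ge0_integralZl//; last 2 first.
- by move=> y _; rewrite lee_fin.
- by apply: integral_ge0 => x _; rewrite lee_fin.
apply: eq_integral => y _ /=.
under eq_integral do rewrite EFinM.
by rewrite ge0_integralT_Zr.
Qed.

(** The factor [theta * eta] cancels the Haar density, leaving five normal densities of total
    integral 1, restricted to the parameter space. *)
Lemma test_function_integral : \int[leb5]_om (test_function om * haar om)%:E <= 1.
Proof.
pose g := @normal_pdf R 0 1.
have mg : measurable_fun setT (g : MR -> R) by exact: measurable_normal_pdf.
have g0 x : (0 <= g x)%R by exact: normal_pdf_ge0.
have Ig : \int[mu]_x (g x)%:E = 1 by exact: integral_normal_pdf.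
have I2 : \int[prod_measure mu mu]_z (g z.1 * g z.2)%:E = 1.
  by rewrite (ge0_integral_prod_measure mu mg g0 mg g0) Ig mule1.
have I3 : \int[prod_measure (prod_measure mu mu) mu]_z
    (g z.1.1 * g z.1.2 * g z.2)%:E = 1.
  rewrite (@ge0_integral_prod_measure _ _ (prod_measure mu mu)
    (fun z => g z.1 * g z.2)%R g _ _ mg g0) ?I2 ?Ig ?mule1//.
  - by apply: measurable_funM; apply: (measurableT_comp mg).
  - by move=> x; rewrite mulr_ge0.
have I4 : \int[prod_measure (prod_measure (prod_measure mu mu) mu) mu]_z
    (g z.1.1.1 * g z.1.1.2 * g z.1.2 * g z.2)%:E = 1.
  rewrite (@ge0_integral_prod_measure _ _ (prod_measure (prod_measure mu mu) mu)
    (fun z => g z.1.1 * g z.1.2 * g z.2)%R g _ _ mg g0) ?I3 ?Ig ?mule1//.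
  - do ! apply: measurable_funM; apply: (measurableT_comp mg) => //.
      by apply: measurable_fun_fst; mfun.
    by apply: measurable_fun_snd; mfun.
  - by move=> x; rewrite !mulr_ge0.
have I5 : \int[lebesgue5]_z
    (g z.1.1.1.1 * g z.1.1.1.2 * g z.1.1.2 * g z.1.2 * g z.2)%:E = 1.
  rewrite (@ge0_integral_prod_measure _ _
    (prod_measure (prod_measure (prod_measure mu mu) mu) mu)
    (fun z => g z.1.1.1 * g z.1.1.2 * g z.1.2 * g z.2)%R g _ _ mg g0) ?I4 ?Ig ?mule1//.
  - do ! apply: measurable_funM; apply: (measurableT_comp mg) => //.
    + by do 2 apply: measurable_fun_fst; mfun.
    + by apply: measurable_fun_snd; apply: measurable_fun_fst; mfun.
    + by apply: measurable_fun_snd; mfun.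
  - by move=> x; rewrite !mulr_ge0.
rewrite leb5E -I5; apply: ge0_le_integral => //.
- move=> om _; rewrite lee_fin.
  case: (pselect (param_space om)) => [Om | /haar_out ->]; last by rewrite mulr0.
  by rewrite mulr_ge0 ?haar_ge0// ltW// test_function_gt0.
- apply/measurable_EFinP; apply: measurable_funM; first exact: measurable_test_function.
  exact: measurable_haar.
- apply/measurable_EFinP.
  by do ! apply: measurable_funM; apply: measurable_fun_std_normal; mfun.
- move=> om _; rewrite lee_fin.
  case: (pselect (param_space om)) => [Om | /haar_out ->]; last by rewrite mulr0 !mulr_ge0.
  rewrite haarE// /test_function /prior mulrAC.
  have /param_spaceP[t0 e0] := Om.
  move: om {Om} t0 e0 => [[[[a b] c] t] e] /= t0 e0.
  by rewrite mulfV ?mul1r// mulf_neq0// lt0r_neq0.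
Qed.

(** The measure of this product of lines and half-lines is infinite. Serves to prove the normalizing
    constant positive. *)
Lemma lebesgue5_param_space : lebesgue5 (fun s => in_param_space s) != 0.
Proof.
have muT : mu [set: MR] = +oo.
  by rewrite -set_itvNyy lebesgue_measure_itv.
pose pos : set MR := `]0%R, +oo[%classic.
have mpos : measurable pos by exact: measurable_itv.
have mup : mu pos = +oo by rewrite lebesgue_measure_itv/= ltry.
have -> : (fun s : param => in_param_space s : Prop) =
    (setT `*` setT `*` setT `*` pos `*` pos : set param).
  apply/seteqP; split => -[[[[a b] c] t] e]; rewrite /in_param_space /pos /= !in_itv/= !andbT.
    by move=> /andP[].
  by move=> [[_ ->] ->].
have E (dd : measure_display) (TT : measurableType dd)
    (m : {sigma_finite_measure set TT -> \bar R}) (A : set TT) (B : set MR) :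
    measurable A -> measurable B -> m A = +oo -> mu B = +oo ->
    prod_measure m mu (A `*` B) = +oo.
  move=> mA mB mAy mBy.
  rewrite [LHS](@product_measure1E _ _ _ _ R m mu _ _ mA mB).
  by rewrite [X in X * _]mAy [X in _ * X]mBy.
have M2 : measurable (setT `*` setT : set (MR * MR)) by exact: measurableX.
have M3 : measurable (setT `*` setT `*` setT : set (MR * MR * MR)) by exact: measurableX.
have M4 : measurable (setT `*` setT `*` setT `*` pos : set (MR * MR * MR * MR)).
  exact: measurableX.
rewrite (_ : lebesgue5 _ = +oo)//.
by do 4 apply: (E) => //.
Qed.

End haar_posterior.

Section posterior_probability.
Context {R : realType} d (T : measurableType d) (P : probability T R).
Notation MR := (measurableTypeR R).
Notation obs := (MR * MR)%type.
Notation param := (MR * MR * MR * MR * MR)%type.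
Local Open Scope ereal_scope.

Lemma measurable_gmul : measurable_fun setT (fun z : param * param => gmul z.1 z.2).
Proof. by rewrite /gmul; mfun. Qed.

(** The unnormalized posterior as a function of the sufficient statistic. The event is a set of
    pairs (estimate, parameter), since [y <= w] involves both and Tonelli needs joint
    measurability. *)
Definition posterior_mass n (A : set (param * param)) (s : param) : \bar R :=
  \int[leb5]_om (suff_likelihood n s om * \1_A (s, om) * haar om)%:E.

Lemma measurable_posterior_integrand n (A : set (param * param)) : measurable A ->
  measurable_fun setT (fun z : param * param =>
    (suff_likelihood n z.1 z.2 * \1_A z * haar z.2)%:E).
Proof.
move=> mA; apply/measurable_EFinP; apply: measurable_funM.
  apply: measurable_funM; first exact: measurable_suff_likelihood.
  exact: measurable_indic.
exact: (measurableT_comp measurable_haar).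
Qed.

Lemma posterior_integrand_ge0 n (A : set (param * param)) (s om : param) :
  0 <= (suff_likelihood n s om * \1_A (s, om) * haar om)%:E.
Proof.
rewrite lee_fin; case: (pselect (param_space om)) => [Om | /haar_out ->].
  apply: mulr_ge0; last exact: haar_ge0.
  by apply: mulr_ge0; [exact/ltW/suff_likelihood_gt0|rewrite indicE].
by rewrite mulr0.
Qed.

Lemma measurable_posterior_mass n A : measurable A ->
  measurable_fun setT (posterior_mass n A).
Proof.
move=> mA; apply: (@measurable_integral_snd _ _ _ _ R lebesgue5 _
  (measurable_posterior_integrand n mA)).
by move=> [s om]; exact: posterior_integrand_ge0.
Qed.

Lemma posterior_mass_ge0 n A s : 0 <= posterior_mass n A s.
Proof. by apply: integral_ge0 => om _; exact: posterior_integrand_ge0. Qed.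

(** A nonnegative integrand of integral 0 vanishes almost everywhere, but this one is positive on
    the parameter space, which is not null. *)
Lemma posterior_massT_gt0 n s : 0 < posterior_mass n setT s.
Proof.
rewrite lt_def posterior_mass_ge0 andbT; apply/eqP => M0.
have mf : measurable_fun setT (fun om : param =>
    (suff_likelihood n s om * \1_(@setT (param * param)) (s, om) * haar om)%:E).
  exact: (measurable_fun_pair2 s (measurable_posterior_integrand n measurableT)).
have /(ae_eq_integral_abs lebesgue5 measurableT mf).1 : \int[lebesgue5]_om
    `|(suff_likelihood n s om * \1_(@setT (param * param)) (s, om) * haar om)%:E| = 0.
  rewrite (eq_integral (fun om =>
    (suff_likelihood n s om * \1_(@setT (param * param)) (s, om) * haar om)%:E)).
    by rewrite -leb5E; exact M0.
  by move=> om _; apply: gee0_abs; exact: posterior_integrand_ge0.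
move=> [Z [mZ Z0 ZP]]; move: (@lebesgue5_param_space R) => /eqP; apply.
apply: (subset_measure0 _ mZ _ Z0).
  by apply: measurable_set_bool; rewrite /in_param_space; mfun.
move=> om /in_param_spaceP Om; apply: ZP => /= /(_ I) [].
rewrite indicT mulr1 haarE// => /eqP; apply/negP; rewrite mulf_neq0//.
  by rewrite lt0r_neq0// suff_likelihood_gt0.
have /param_spaceP[t0 e0] := Om.
by rewrite -haarE// /haar t0 e0 !mul1r mulf_neq0// invr_eq0 lt0r_neq0.
Qed.

Variables (om0 : param) (X : nat -> T -> obs) (n : nat).
Hypotheses (O0 : param_space om0) (iidX : iid_sequence P om0 X) (n2 : (2 < n)%N).

Let n0 : (0 < n)%N. Proof. exact: ltn_trans n2. Qed.
Let mX : forall i, measurable_fun setT (X i). Proof. by have [] := iidX. Qed.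

Definition estimator (t : T) : param := estimate (observe X n t).

(* The estimate for the sample standardized by the true parameter. *)
Definition pivot (t : T) : param :=
  estimate [tuple ginv om0 (tnth (observe X n t) i) | i < n].

Lemma measurable_estimator : measurable_fun setT estimator.
Proof.
apply: (measurableT_comp (@measurable_estimate R n)).
exact: measurable_observe.
Qed.

Lemma measurable_pivot : measurable_fun setT pivot.
Proof.
apply: (measurableT_comp (@measurable_estimate R n)).
apply/measurable_fun_tnthP => i.
rewrite (_ : _ \o _ = fun t => ginv om0 (X i t)); last first.
  by apply/funext => t /=; rewrite !tnth_mktuple.
exact: (measurableT_comp (measurable_ginv om0)).
Qed.

Lemma in_param_space_estimator t :
  in_param_space (estimator t) = nondegenerate (observe X n t).
Proof. exact: in_param_space_estimate. Qed.

Lemma observe_gacts t :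
  observe X n t = gacts om0 [tuple ginv om0 (tnth (observe X n t) i) | i < n].
Proof. by apply: eq_from_tnth => i; rewrite !tnth_mktuple ginvK. Qed.

Lemma in_param_space_pivot t :
  in_param_space (pivot t) = nondegenerate (observe X n t).
Proof.
by rewrite in_param_space_estimate// [in RHS]observe_gacts nondegenerate_gacts.
Qed.

Lemma estimator_pivot t : nondegenerate (observe X n t) ->
  estimator t = gmul om0 (pivot t).
Proof.
rewrite /estimator {1 2}observe_gacts nondegenerate_gacts// => nd.
by rewrite estimate_gacts.
Qed.

(** By equivariance and sufficiency, [change_of_parameter] can be read on the estimate. The
    indicators discard degenerate samples, since both properties were established for nondegenerate
    ones. *)
Lemma change_of_parameter_estimator om (h : param -> \bar R) :
  param_space om -> measurable_fun setT h -> (forall s, 0 <= h s) ->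
  \int[P]_t (h (gmul om (pivot t)) * (in_param_space (pivot t))%:R%:E) =
  \int[P]_t (h (estimator t) * ((in_param_space (estimator t))%:R *
    (suff_likelihood n (estimator t) om / suff_likelihood n (estimator t) om0))%:E).
Proof.
move=> Om mh h0.
pose h' (x : n.-tuple obs) := h (estimate x) * (in_param_space (estimate x))%:R%:E.
have me := @measurable_estimate R n.
have mh' : measurable_fun setT h'.
  apply: emeasurable_funM; first exact: (measurableT_comp mh).
  apply/measurable_EFinP; apply: measurable_fun_natr.
  by rewrite /in_param_space; mfun.
have h'0 x : 0 <= h' x by rewrite mule_ge0// lee_fin.
have := change_of_parameter O0 Om iidX mh' h'0.
rewrite (eq_integral (fun t =>
    h (gmul om (pivot t)) * (in_param_space (pivot t))%:R%:E)); last first.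
  move=> t _; rewrite /h'.
  have -> : tuple_act om0 om (observe X n t) =
      gacts om [tuple ginv om0 (tnth (observe X n t) i) | i < n].
    by apply: eq_from_tnth => i; rewrite !tnth_mktuple.
  rewrite /pivot; set z := [tuple _ | i < n].
  rewrite !in_param_space_estimate// nondegenerate_gacts//.
  by case: (boolP (nondegenerate z)) => [nd|_]; rewrite ?mule0// estimate_gacts.
move=> ->; apply: eq_integral => t _; rewrite /h' -muleA -EFinM; congr (_ * _%:E).
rewrite -/(estimator t); case: (boolP (in_param_space _)) => [|_]; last by rewrite !mul0r.
rewrite in_param_space_estimator => nd.
by rewrite likelihood_ratioE !likelihoodE.
Qed.

Section pivotal_set.
Variables (A : set (param * param)) (V : set param).
Hypotheses (mA : measurable A) (mV : measurable V).
Hypothesis AV : forall om s, param_space om -> A (gmul om s, om) <-> V s.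

(** Together with the likelihood at [om] inside the posterior mass, the division forms the
    likelihood ratio that turns an expectation under [om0] into one under [om]. *)
Definition weight (f : param -> R) s : R :=
  (f s * (in_param_space s)%:R / suff_likelihood n s om0)%R.

Lemma weight_ge0 f s : (forall s, 0 <= f s)%R -> (0 <= weight f s)%R.
Proof.
move=> f0; apply: mulr_ge0; first by apply: mulr_ge0.
by rewrite invr_ge0; exact/ltW/suff_likelihood_gt0.
Qed.

Lemma measurable_weight f : measurable_fun setT f -> measurable_fun setT (weight f).
Proof.
move=> mf; apply: measurable_funM.
  by apply: measurable_funM => //; apply: measurable_fun_natr;
    rewrite /in_param_space; mfun.
by apply: measurable_fun_inv; rewrite /suff_likelihood; mfun.
Qed.

Lemma integral_posterior_mass (f : param -> R) :
  measurable_fun setT f -> (forall s, 0 <= f s)%R ->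
  \int[P]_t (posterior_mass n A (estimator t) * (weight f (estimator t))%:E) =
  \int[P]_t (\1_V (pivot t) * (in_param_space (pivot t))%:R)%:E *
  \int[leb5]_om (f om * haar om)%:E.
Proof.
move=> mf f0; have mS := measurable_estimator; have mt := measurable_pivot.
have mw := measurable_weight mf.
have mpi := measurable_posterior_integrand n mA.
pose F (z : T * param) : \bar R :=
  (suff_likelihood n (estimator z.1) z.2 * \1_A (estimator z.1, z.2) * haar z.2)%:E
  * (weight f (estimator z.1))%:E.
have mSz : measurable_fun setT (fun z : T * param => (estimator z.1, z.2)).
  apply: measurable_fun_pair; first exact: (measurableT_comp mS).
  exact: measurable_snd.
have mF : measurable_fun setT F.
  apply: emeasurable_funM; first exact: (measurableT_comp mpi mSz).
  apply/measurable_EFinP; apply: (measurableT_comp mw).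
  exact: (measurableT_comp mS).
have F0 z : 0 <= F z.
  by rewrite mule_ge0 ?posterior_integrand_ge0// lee_fin weight_ge0.
transitivity (\int[P]_t \int[lebesgue5]_om F (t, om)).
  apply: eq_integral => t _; rewrite /posterior_mass leb5E -ge0_integralT_Zr//.
  - exact: weight_ge0.
  - exact: (measurable_fun_pair2 (estimator t) mpi).
  - by move=> om; exact: posterior_integrand_ge0.
rewrite -(tonelli1 P lebesgue5 mF F0) (tonelli2 P lebesgue5 mF F0).
pose G (z : T * param) : \bar R := (f (gmul z.2 (pivot z.1)) * haar z.2)%:E
  * (\1_V (pivot z.1) * (in_param_space (pivot z.1))%:R)%:E.
have mgm : measurable_fun setT (fun z : T * param => gmul z.2 (pivot z.1)).
  have mz1 : measurable_fun setT (fun z : T * param => pivot z.1).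
    exact: (measurableT_comp mt).
  have mp : measurable_fun setT (fun z : T * param => (z.2, pivot z.1)).
    by apply: measurable_fun_pair => //; exact: measurable_snd.
  exact: (measurableT_comp measurable_gmul mp).
have mVp : measurable_fun setT (fun t : T => (\1_V (pivot t) * (in_param_space (pivot t))%:R : R)%R).
  apply: measurable_funM.
    apply: (measurableT_comp _ mt); exact: measurable_indic.
  apply: measurable_fun_natr; apply: (measurableT_comp _ mt).
  by rewrite /in_param_space; mfun.
have mfh : measurable_fun setT (fun z : T * param => (f (gmul z.2 (pivot z.1)) * haar z.2)%:E).
  apply/measurable_EFinP; apply: measurable_funM; first exact: (measurableT_comp mf).
  exact: (measurableT_comp measurable_haar).
have mG : measurable_fun setT G.
  apply: emeasurable_funM => //.
  apply/measurable_EFinP; apply: (measurableT_comp mVp); exact: measurable_fst.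
have Vp0 t : (0 <= \1_V (pivot t) * (in_param_space (pivot t))%:R :> R)%R.
  by rewrite mulr_ge0.
have fh0 t om : 0 <= (f (gmul om (pivot t)) * haar om)%:E.
  by rewrite lee_fin mulr_ge0// haar_ge0.
have G0 z : 0 <= G z by rewrite mule_ge0 ?lee_fin ?Vp0// mulr_ge0// haar_ge0.
(* For fixed [om], the change of parameter replaces the estimate by [gmul om] of the pivot, and
   invariance of [A] reduces its indicator to that of [V]. Off the parameter space [haar] is 0. *)
transitivity (\int[lebesgue5]_om \int[P]_t G (t, om)).
  apply: eq_integral => om _; case: (pselect (param_space om)) => [Om | Om]; last first.
    by rewrite !integral0_eq// => t _; rewrite /G /F/= haar_out// !mulr0 mul0e.
  pose h s : \bar R := (f s * \1_A (s, om))%:E * (haar om)%:E.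
  have mh : measurable_fun setT h.
    apply: emeasurable_funM => //; apply/measurable_EFinP; apply: measurable_funM => //.
    have mp : measurable_fun setT (fun s : param => (s, om)) by exact: pair2_measurable.
    by apply: (measurableT_comp _ mp); exact: measurable_indic.
  have h0 s : 0 <= h s.
    apply: mule_ge0; rewrite lee_fin; last exact: haar_ge0.
    by apply: mulr_ge0; rewrite ?indicE.
  transitivity (\int[P]_t (h (estimator t) * ((in_param_space (estimator t))%:R *
    (suff_likelihood n (estimator t) om / suff_likelihood n (estimator t) om0))%:E)).
    apply: eq_integral => t _; rewrite /F /h /weight/= -!EFinM; congr EFin.
    by move: (suff_likelihood n _ om) (suff_likelihood n _ om0) => *; ring.
  rewrite -(change_of_parameter_estimator Om mh h0).
  apply: eq_integral => t _; rewrite /G /h/= -!EFinM; congr EFin.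
  have -> : \1_A (gmul om (pivot t), om) = \1_V (pivot t) :> R.
    rewrite !indicE; congr (nat_of_bool _)%:R.
    by apply/idP/idP; rewrite !inE => /(AV _ Om).
  by move: (f _) (\1_V _) (haar _) (_%:R) => *; ring.
rewrite -(tonelli2 P lebesgue5 mG G0) (tonelli1 P lebesgue5 mG G0).
have mVpE : measurable_fun setT (fun t : T =>
    (\1_V (pivot t) * (in_param_space (pivot t))%:R : R)%:E) by exact/measurable_EFinP.
have K0 : 0 <= \int[leb5]_om (f om * haar om)%:E.
  by apply: integral_ge0 => om _; rewrite lee_fin mulr_ge0// haar_ge0.
rewrite -ge0_integralZr; first last.
- exact: K0.
- by move=> t _; rewrite lee_fin.
- exact: mVpE.
- exact: measurableT.
apply: eq_integral => t _; rewrite /G/=.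
rewrite ge0_integralT_Zr//; last exact: (measurable_fun_pair2 t mfh).
case: (boolP (in_param_space (pivot t))) => [Op|_]; last by rewrite mulr0 mule0 mul0e.
rewrite muleC; congr (_ * _).
have mfE : measurable_fun setT (EFin \o f) by exact/measurable_EFinP.
(* For a fixed pivot, right invariance removes it from the argument of [f]; the two integrals then
   separate. *)
have := ge0_integral_gmul (elimT (in_param_spaceP _) Op) mfE (fun s => f0 s).
rewrite -leb5E /= => H; transitivity (\int[leb5]_om ((f (gmul om (pivot t)))%:E * (haar om)%:E)).
  by apply: eq_integral => om _; rewrite EFinM.
by rewrite H; apply: eq_integral => om _; rewrite EFinM.
Qed.

End pivotal_set.

End posterior_probability.

(** * Almost sure proportionality of posterior masses *)

Section posterior_constant.
Context {R : realType} d (T : measurableType d) (P : probability T R).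
Notation MR := (measurableTypeR R).
Notation obs := (MR * MR)%type.
Notation param := (MR * MR * MR * MR * MR)%type.
Local Open Scope ereal_scope.

Variables (om0 : param) (X : nat -> T -> obs) (n : nat).
Hypotheses (O0 : param_space om0) (iidX : iid_sequence P om0 X) (n2 : (2 < n)%N).

Let n0 : (0 < n)%N. Proof. exact: ltn_trans n2. Qed.
Let mX : forall i, measurable_fun setT (X i). Proof. by have [] := iidX. Qed.

Notation S := (@estimator R d T X n).
Notation tau := (@pivot R d T om0 X n).
Let mS : measurable_fun setT S. Proof. exact: measurable_estimator iidX. Qed.
Let mtau : measurable_fun setT tau. Proof. exact: measurable_pivot iidX. Qed.

(** The indicator ensures nonnegativity: [test_function] is negative where [theta] and [eta] have
    opposite signs. *)
Let test (s : param) : R := ((in_param_space s)%:R * test_function s)%R.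

Let test_ge0 s : (0 <= test s)%R.
Proof.
rewrite /test; case: in_param_spaceP => [Os|_]; last by rewrite mul0r.
by rewrite mul1r ltW// test_function_gt0.
Qed.

Let measurable_test : measurable_fun setT test.
Proof.
apply: measurable_funM; last exact: measurable_test_function.
by apply: measurable_fun_natr; rewrite /in_param_space; mfun.
Qed.

Let ptest_ge0 (B : set param) s : (0 <= test s * \1_B s)%R.
Proof. by rewrite mulr_ge0// indicE. Qed.

Let measurable_ptest (B : set param) : measurable B ->
  measurable_fun setT (fun s => test s * \1_B s)%R.
Proof. by move=> mB; apply: measurable_funM => //; exact: measurable_indic. Qed.

Definition pivot_prob (V : set param) : R :=
  fine (P [set t | V (tau t) /\ nondegenerate (observe X n t)]).

Lemma pivot_probE V : measurable V ->
  \int[P]_t (\1_V (tau t) * (in_param_space (tau t))%:R)%:E = (pivot_prob V)%:E.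
Proof.
move=> mV.
have mVt : measurable (tau @^-1` V) by rewrite -[X in measurable X]setTI; exact: mtau.
have mnd : measurable [set t | nondegenerate (observe X n t)].
  apply: measurable_set_bool.
  rewrite (_ : (fun t => _) = (fun t => in_param_space (S t))); last first.
    by apply/funext => t; rewrite (in_param_space_estimator X n2).
  apply: (measurableT_comp _ mS).
  by rewrite /in_param_space; mfun.
have mVn : measurable [set t | V (tau t) /\ nondegenerate (observe X n t)].
  exact: measurableI.
rewrite /pivot_prob fineK ?fin_num_measure// -[X in P X]setIT -integral_indic//.
apply: eq_integral => t _; congr EFin.
rewrite (in_param_space_pivot X O0 n2) !indicE -natrM mulnb; congr (nat_of_bool _)%:R.
by apply/andP/idP; rewrite !inE//=.
Qed.

Lemma pivot_probT : pivot_prob setT = 1%R.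
Proof.
have mnd : measurable [set t | ~~ nondegenerate (observe X n t)].
  apply: measurable_set_bool; apply: measurable_neg.
  rewrite (_ : (fun t => _) = (fun t => in_param_space (S t))); last first.
    by apply/funext => t; rewrite (in_param_space_estimator X n2).
  apply: (measurableT_comp _ mS).
  by rewrite /in_param_space; mfun.
rewrite /pivot_prob (_ : [set t | _] = ~` [set t | ~~ nondegenerate (observe X n t)]).
  by rewrite probability_setC// (nondegenerate_ae O0 iidX n2) sube0.
by apply/seteqP; split=> t /=; [move=> [_ ->]|move=> /negP; rewrite negbK].
Qed.

Let mass (A : set (param * param)) (s : param) : \bar R :=
  posterior_mass n A s * (weight om0 n test s)%:E.

Let mass_ge0 A s : 0 <= mass A s.
Proof.
by rewrite mule_ge0 ?posterior_mass_ge0// lee_fin (weight_ge0 n O0).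
Qed.

Let measurable_mass A : measurable A -> measurable_fun setT (mass A).
Proof.
move=> mA; apply: emeasurable_funM; first exact: measurable_posterior_mass.
by apply/measurable_EFinP; exact: measurable_weight.
Qed.

(** Cutting the test function to [B] localizes the identity to any measurable set of estimates, as
    the almost everywhere comparison needs. *)
Let integral_mass A V (B : set param) : measurable A -> measurable V ->
  (forall om s, param_space om -> A (gmul om s, om) <-> V s) -> measurable B ->
  \int[law P mS]_(s in B) mass A s =
  (pivot_prob V)%:E * \int[leb5]_om (test om * \1_B om * haar om)%:E.
Proof.
move=> mA mV AV mB.
have mtB := measurable_ptest mB.
pose k s := posterior_mass n A s * (weight om0 n (fun s => test s * \1_B s)%R s)%:E.
have mk : measurable_fun setT k.
  apply: emeasurable_funM; first exact: measurable_posterior_mass.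
  by apply/measurable_EFinP; exact: measurable_weight.
have k0 s : 0 <= k s.
  by rewrite mule_ge0 ?posterior_mass_ge0// lee_fin (weight_ge0 n O0).
transitivity (\int[law P mS]_s k s).
  rewrite integral_mkcond; apply: eq_integral => s _.
  rewrite patchE /k /mass /weight indicE; case: ifPn => sB; first by rewrite mulr1.
  by rewrite mulr0 !mul0r mule0.
rewrite (ge0_integral_law P mS mk k0).
have := integral_posterior_mass O0 iidX n2 mA mV AV mtB (ptest_ge0 B).
by rewrite pivot_probE.
Qed.

(** [mass A] and [pivot_prob V] times [mass setT] have the same integral over every measurable set
    and the latter is integrable, so they agree almost everywhere. At a nondegenerate estimate the
    weight is positive and can be cancelled. *)
Lemma posterior_mass_ae A V : measurable A -> measurable V ->
  (forall om s, param_space om -> A (gmul om s, om) <-> V s) ->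
  exists Z : set T, [/\ measurable Z, P Z = 0 & forall t, ~ Z t ->
    [/\ nondegenerate (observe X n t),
        posterior_mass n A (S t) = (pivot_prob V)%:E * posterior_mass n setT (S t) &
        posterior_mass n setT (S t) < +oo]].
Proof.
move=> mA mV AV.
have IT B (mB : measurable B) : \int[law P mS]_(s in B) mass setT s =
    \int[leb5]_om (test om * \1_B om * haar om)%:E.
  by rewrite (integral_mass measurableT measurableT)// pivot_probT mul1e.
have mmT := measurable_mass measurableT.
have mmA := measurable_mass mA.
(* Finiteness comes from the Haar integral of the test function; it makes the normalizing constant
   almost surely finite without computing it. *)
have massT_lty : \int[law P mS]_s mass setT s < +oo.
  rewrite IT//; apply: le_lt_trans (ltry 1).
  apply: le_trans (@test_function_integral R).
  rewrite le_eqVlt; apply/orP; left; apply/eqP; apply: eq_integral => om _.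
  congr EFin; rewrite indicT mulr1 /test.
  case: in_param_spaceP => [_ | /haar_out ->]; first by rewrite mul1r.
  by rewrite !mulr0.
have iT : (law P mS).-integrable setT (mass setT).
  apply/integrableP; split => //.
  by rewrite (eq_integral (mass setT))// => s _; rewrite gee0_abs.
have ipT : (law P mS).-integrable setT (fun s => (pivot_prob V)%:E * mass setT s).
  exact: integrableZl.
have p0 : (0 <= pivot_prob V)%R by exact: fine_ge0.
have [Z1 [mZ1 Z10 Z1P]] : ae_eq (law P mS) setT
    (fun s => (pivot_prob V)%:E * mass setT s) (mass A).
  apply: integral_ae_eq => // B _ mB.
  rewrite (integral_mass mA mV AV mB) -(IT B mB) ge0_integralZl//.
  exact: measurable_funTS.
have [Z2 [mZ2 Z20 Z2P]] := integrable_ae measurableT iT.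
pose ND : set T := [set t | ~~ nondegenerate (observe X n t)].
have mND : measurable ND.
  apply: measurable_set_bool; apply: measurable_neg.
  rewrite (_ : (fun t => _) = (fun t => in_param_space (S t))); last first.
    by apply/funext => t; rewrite (in_param_space_estimator X n2).
  apply: (measurableT_comp _ mS).
  by rewrite /in_param_space; mfun.
have mSZ1 : measurable (S @^-1` Z1) by rewrite -[X in measurable X]setTI; exact: mS.
have mSZ2 : measurable (S @^-1` Z2) by rewrite -[X in measurable X]setTI; exact: mS.
exists (S @^-1` Z1 `|` S @^-1` Z2 `|` ND); split.
- by apply: measurableU => //; exact: measurableU.
- apply: null_set_setU => //; first exact: measurableU.
    exact: null_set_setU.
  exact: (nondegenerate_ae O0 iidX n2).
move=> t /not_orP[/not_orP[nZ1 nZ2] /negP]; rewrite negbK => nd.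
have Ot : param_space (S t).
  by apply/in_param_spaceP; rewrite (in_param_space_estimator X n2).
have w0 : (0 < weight om0 n test (S t))%R.
  rewrite /weight /test divr_gt0 ?suff_likelihood_gt0//.
  by rewrite (introT (in_param_spaceP _) Ot) mul1r mulr1 test_function_gt0.
have E1 : (pivot_prob V)%:E * mass setT (S t) = mass A (S t).
  by apply: contrapT => H; apply: nZ1; apply: Z1P => /= /(_ Logic.I).
have F2 : mass setT (S t) \is a fin_num.
  by apply: contrapT => H; apply: nZ2; apply: Z2P => /= /(_ Logic.I).
split => //.
  move: E1; rewrite /mass; set u := weight _ _ _ _ in w0 *.
  move=> /(congr1 (fun y => y * (u^-1)%:E)).
  by rewrite -!muleA -EFinM divff ?mule1 ?gt_eqF.
move: F2; rewrite /mass; case: (posterior_mass n setT (S t)) (posterior_massT_gt0 n (S t)) => //=.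
  by move=> *; exact: ltry.
by rewrite gt0_mulye ?lte_fin.
Qed.

End posterior_constant.

(** * Fisher information *)

Section gaussian_moments.
Context {R : realType}.
Notation MR := (measurableTypeR R).
Notation mu := (@lebesgue_measure R).
Local Notation g := (@normal_pdf R 0 1).

Lemma std_normalE x : g x = normal_peak 1 * expR (- 2^-1 * x ^+ 2).
Proof.
rewrite normal_pdfE ?oner_neq0// /normal_fun subr0 expr1n.
by congr (_ * expR _); rewrite mulrC mulNr mulrN mulrC.
Qed.

Let g0 x : 0 <= g x. Proof. exact: normal_pdf_ge0. Qed.

Lemma is_derive_std_normal (x : R) : is_derive x 1 (g : R -> R) (- x * g x).
Proof.
rewrite (_ : (g : R -> R) = fun y => normal_peak 1 * expR (- 2^-1 * y ^+ 2)); last first.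
  by apply/funext => y; exact: std_normalE.
apply: is_derive_eq; rewrite /GRing.scale/=.
by field.
Qed.

(** From [expR u >= u^4 / 4!] at [u = x^2 / 2] follows [expR (- x^2 / 2) <= 4! 2^4 / x^8], and
    [x^k <= x^4 <= x^7]. *)
Lemma pow_expR_bound (x : R) k : (k <= 4)%N -> 1 <= x ->
  x ^+ k * expR (- 2^-1 * x ^+ 2) <= (4`!%:R * 2 ^+ 4) / x.
Proof.
move=> k4 x1; have x0 : 0 < x by exact: lt_le_trans x1.
rewrite mulNr expRN -ler_pdivlMr ?invr_gt0 ?expR_gt0// invrK.
apply: (@le_trans _ _ (x ^+ 4)); first exact: ler_weXn2l.
apply: (@le_trans _ _ (4`!%:R * 2 ^+ 4 / x * ((2^-1 * x ^+ 2) ^+ 4 / 4`!%:R))).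
  rewrite (_ : _ / x * _ = x ^+ 7); first exact: ler_weXn2l.
  have : 4`!%:R != 0 :> R by rewrite pnatr_eq0.
  by move: (4`!%:R) => c c0; field; rewrite c0 lt0r_neq0.
rewrite ler_pM2l ?divr_gt0 ?mulr_gt0 ?exprn_gt0 ?ltr0n//.
apply: le_trans (@expR_ge1Dxn R _ 3 _); last by rewrite mulr_ge0// sqr_ge0.
by rewrite lerDr.
Qed.

(** Dominated by a multiple of the normal density of variance 2. Half of the exponent absorbs the
    power: [expR u >= 1 + u^2 / 2] at [u = x^2 / 4] gives [x^4 <= 32 expR u], so
    [1 + x^4 <= 33 expR u]. Degree 4 suffices for products of two quadratic scores. *)
Lemma integrable_pow_std_normal k : (k <= 4)%N ->
  mu.-integrable setT (fun x : MR => (x ^+ k * g x)%:E).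
Proof.
move=> k4.
have s2 : Num.sqrt 2 != 0 :> R by rewrite gt_eqF ?sqrtr_gt0.
have pk1 : 0 < normal_peak 1 :> R by rewrite normal_peak_gt0 ?oner_neq0.
have pk2 : 0 < normal_peak (Num.sqrt 2) :> R by rewrite normal_peak_gt0.
have [C [C0 CE]] : exists C : R, 0 <= C /\
    C = 33%:R * (normal_peak 1 / normal_peak (Num.sqrt 2)).
  by eexists; split; [|reflexivity]; rewrite mulr_ge0 ?ler0n// divr_ge0// ltW.
have iC := integrableZl measurableT C (integrable_normal_pdf 0 (Num.sqrt 2)).
apply: (le_integrable measurableT _ _ iC).
  apply/measurable_EFinP; apply: measurable_funM; first exact: measurable_funX.
  exact: measurable_normal_pdf.
move=> x _; rewrite -EFinM /= lee_fin !normrM normrX.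
rewrite [X in _ * X]ger0_norm// [X in _ <= _ * X]ger0_norm ?normal_pdf_ge0//.
rewrite (ger0_norm C0).
have -> : normal_pdf 0 (Num.sqrt 2) x =
    normal_peak (Num.sqrt 2) * expR (- 2^-1 * (2^-1 * x ^+ 2)) :> R.
  rewrite normal_pdfE// /normal_fun subr0 sqr_sqrtr//.
  by congr (_ * expR _); rewrite -mulr_natr; field.
rewrite std_normalE CE -[X in _ <= X]mulrA.
have -> : normal_peak 1 / normal_peak (Num.sqrt 2) *
    (normal_peak (Num.sqrt 2) * expR (- 2^-1 * (2^-1 * x ^+ 2))) =
    normal_peak 1 * expR (- 2^-1 * (2^-1 * x ^+ 2)) :> R.
  by rewrite mulrA divfK// gt_eqF.
rewrite mulrCA [X in _ <= X]mulrCA ler_pM2l//.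
have -> : - 2^-1 * x ^+ 2 = - (2^-1 * (2^-1 * x ^+ 2)) + - 2^-1 * (2^-1 * x ^+ 2) by field.
rewrite expRD; have b0 := expR_gt0 (- 2^-1 * (2^-1 * x ^+ 2)).
move: (expR (- 2^-1 * (2^-1 * x ^+ 2))) b0 => b b0; rewrite [X in X <= _]mulrA ler_pM2r//.
rewrite expRN ler_pdivrMr ?expR_gt0//.
set e := expR _.
have h0 : 0 <= 2^-1 * (2^-1 * x ^+ 2).
  by apply: mulr_ge0 => //; apply: mulr_ge0 => //; exact: sqr_ge0.
have e1 : 1 <= e by rewrite -expR0 ler_expR.
have ex : x ^+ 4 <= 32 * e.
  have := @expR_ge1Dxn R (2^-1 * (2^-1 * x ^+ 2)) 1 h0.
  rewrite -/e (_ : 2`! = 2)%N//.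
  have -> : (2^-1 * (2^-1 * x ^+ 2)) ^+ 2 / 2 = x ^+ 4 / 32 by field.
  by move=> H; lra.
have xk : `|x| ^+ k <= 1 + x ^+ 4.
  have x4 : `|x| ^+ 4 = x ^+ 4 by rewrite -normrX ger0_norm// exprn_even_ge0.
  have [le1|ge1] := leP `|x| 1.
    apply: (@le_trans _ _ 1); first exact: exprn_ile1.
    by rewrite lerDl exprn_even_ge0.
  apply: (@le_trans _ _ (`|x| ^+ 4)); first by apply: ler_weXn2l => //; exact: ltW.
  by rewrite x4 lerDr.
apply: (le_trans xk); lra.
Qed.

End gaussian_moments.

Section moments.
Context {R : realType}.
Notation MR := (measurableTypeR R).
Notation mu := (@lebesgue_measure R).
Local Notation g := (@normal_pdf R 0 1).
Local Open Scope ereal_scope.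

(** The fundamental theorem of calculus on growing symmetric intervals, with dominated convergence
    bounded by [f] itself. *)
Lemma integral_derivative_line (F f : R -> R) :
  (forall x : R, is_derive x 1%R F (f x)) -> continuous f ->
  mu.-integrable setT (EFin \o f) ->
  (F n.+1%:R @[n --> \oo] --> 0%R) -> (F (- n.+1%:R)%R @[n --> \oo] --> 0%R) ->
  \int[mu]_x (f x)%:E = 0.
Proof.
move=> dF cf fi Fp Fn.
(* The index [n.+1] keeps the interval of positive length, as the fundamental theorem requires. *)
pose I n : set R := `[(- n.+1%:R)%R, n.+1%:R]%classic.
have mI n : measurable (I n : set MR) by exact: measurable_itv.
pose f_ n : MR -> \bar R := (EFin \o f) \_ (I n).
have mf : measurable_fun setT (EFin \o f : MR -> \bar R) by exact: measurable_int fi.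
have mf_ n : measurable_fun setT (f_ n).
  by apply/(measurable_restrictT _ (mI n)); exact: measurable_funTS.
have f_f x : f_ n x @[n --> \oo] --> (f x)%:E.
  apply: cvg_near_cst; exists (Num.bound `|x|) => // n /= bn.
  rewrite /f_ patchE mem_set// /I /= in_itv/= -ler_norml.
  apply: (le_trans (ltW (archi_boundP (normr_ge0 x)))).
  by rewrite ler_nat (leq_trans bn).
have f_g x n : `|f_ n x| <= `|(f x)%:E|.
  rewrite /f_ patchE; case: ifPn => _; first exact: lexx.
  by rewrite abse0 abse_ge0.
have A1 : {ae mu, forall x, setT x -> f_ ^~ x @ \oo --> (EFin \o f) x}.
  by apply: aeW => x _; exact: f_f.
have A2 : {ae mu, forall x n, setT x -> `|f_ n x| <= (abse \o (EFin \o f)) x}.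
  by apply: aeW => x n _; exact: f_g.
have [_ _ lim1] := dominated_convergence measurableT mf_ mf A1 (integrable_abse fi) A2.
have FE n : \int[mu]_x f_ n x = (F n.+1%:R - F (- n.+1%:R))%:E.
  rewrite /f_ -integral_mkcond EFinB; apply: continuous_FTC2.
  - by rewrite -subr_gt0 opprK addr_gt0.
  - exact: continuous_subspaceT.
  - have cF : continuous F.
      by move=> x; apply/differentiable_continuous/derivable1_diffP; have [] := dF x.
    split.
    + by move=> x _; have [] := dF x.
    + by apply: cvg_at_right_filter; exact: cF.
    + by apply: cvg_at_left_filter; exact: cF.
  - by move=> x _; rewrite derive1E; exact: (@derive_val _ _ _ _ _ _ _ (dF x)).
have lim2 : (\int[mu]_x f_ n x) @[n --> \oo] --> (0 : \bar R).
  under eq_fun do rewrite FE.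
  apply: cvg_EFin; first exact: nearW.
  by rewrite -[X in _ --> X](subr0 0%R); apply: cvgB.
exact: (cvg_unique _ lim1 lim2).
Qed.

Lemma is_derive_pow (k : nat) (x : R) :
  is_derive x 1%R (fun y : R => y ^+ k)%R (k%:R * x ^+ k.-1)%R.
Proof.
have := @is_deriveX R R (fun y : R => y) k x 1%R 1%R (is_derive_id x 1%R).
by rewrite exprfctE /GRing.scale/= mulr1.
Qed.

Lemma continuous_pow_std k : continuous (fun x : R => x ^+ k * g x)%R.
Proof.
move=> x; apply: cvgM; first exact: exprn_continuous.
by apply: continuous_normal_pdf; rewrite oner_neq0.
Qed.

(** The sign [(-1) ^+ s] treats both ends of the line at once. *)
Lemma cvg_pow_std k (s : bool) : (k <= 4)%N ->
  (((-1) ^+ s * n.+1%:R) ^+ k * g ((-1) ^+ s * n.+1%:R))%R @[n --> \oo] --> (0%R : R).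
Proof.
move=> k4; apply/cvgr0Pnorm_le => /= e e0.
pose c : R := (4`!%:R * 2 ^+ 4 * normal_peak 1)%R.
have c0 : (0 < c)%R.
  by rewrite /c !mulr_gt0 ?exprn_gt0 ?ltr0n// normal_peak_gt0 ?oner_neq0.
exists (Num.bound (c / e)) => // n /= bn.
rewrite normrM normrX normrM normr_sign mul1r ger0_norm//.
rewrite [X in (_ * X)%R]ger0_norm ?normal_pdf_ge0// std_normalE exprMn sqrr_sign mul1r.
rewrite mulrCA; apply: (@le_trans _ _ (c / n.+1%:R)%R).
  rewrite /c [X in (X / _)%R]mulrC -mulrA ler_pM2l ?normal_peak_gt0 ?oner_neq0//.
  by apply: pow_expR_bound => //; rewrite ler1n.
rewrite ler_pdivrMr ?ltr0n// mulrC -ler_pdivrMr//.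
apply: le_trans (ltW (archi_boundP _)) _; first by rewrite divr_ge0 ?ltW.
by rewrite ler_nat (leq_trans bn).
Qed.

Definition moment k : R := nth 0%R [:: 1; 0; 1; 0; 3]%R k.

(** Integration by parts: the integrand of the difference is the derivative of [- x^k g x], which
    vanishes at both ends. For [k = 0] the truncated exponent [k.-1] is harmless, its factor being
    0. *)
Lemma moment_rec k : (k <= 3)%N ->
  \int[mu]_x (x ^+ k.+1 * g x)%:E = k%:R%:E * \int[mu]_x (x ^+ k.-1 * g x)%:E.
Proof.
move=> k3.
have i1 := @integrable_pow_std_normal R k.+1 k3.
have k1 : (k.-1 <= 4)%N by apply: (leq_trans (leq_pred _)); exact: leq_trans k3 _.
have i2 := @integrable_pow_std_normal R k.-1 k1.
have i3 := integrableZl measurableT k%:R i2.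
pose F := (fun x : R => - (x ^+ k * g x))%R.
pose f := (fun x : R => x ^+ k.+1 * g x - k%:R * (x ^+ k.-1 * g x))%R.
have fE : EFin \o f = (fun x => (x ^+ k.+1 * g x)%:E - k%:R%:E * (x ^+ k.-1 * g x)%:E).
  by apply/funext => x.
have dF (x : R) : is_derive x 1%R F (f x).
  have d1 := is_derive_pow k x; have d2 := is_derive_std_normal x.
  have d3 := is_deriveN (is_deriveM d1 d2).
  apply: is_derive_eq; rewrite /f /GRing.scale/= exprS.
  by move: (g x) (k%:R) (x ^+ k.-1)%R (x ^+ k)%R => *; ring.
have fi : mu.-integrable setT (EFin \o f) by rewrite fE; exact: integrableB.
have cf : continuous f.
  move=> x; apply: cvgB; first exact: continuous_pow_std.
  by apply: cvgM; [exact: cvg_cst|exact: continuous_pow_std].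
have k4 : (k <= 4)%N by exact: leq_trans k3 _.
have Fp : F n.+1%:R @[n --> \oo] --> 0%R.
  rewrite -[X in _ --> X]oppr0; apply: cvgN.
  have := @cvg_pow_std k false k4.
  by under eq_fun do rewrite expr0 mul1r.
have Fn : F (- n.+1%:R)%R @[n --> \oo] --> 0%R.
  rewrite -[X in _ --> X]oppr0; apply: cvgN.
  have := @cvg_pow_std k true k4.
  by under eq_fun do rewrite expr1 mulN1r.
have := integral_derivative_line dF cf fi Fp Fn.
rewrite -[X in X = _ -> _]/(\int[mu]_x (EFin \o f) x) fE integralB//.
rewrite integralZl// => /eqP; rewrite sube_eq ?add0e; last 2 first.
- by rewrite integrable_fin_num.
- by rewrite fin_num_adde_defr// fin_numM ?integrable_fin_num.
by move=> /eqP.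
Qed.

Lemma std_normal_moment k : (k <= 4)%N ->
  \int[mu]_x (x ^+ k * g x)%:E = (moment k)%:E.
Proof.
have m0 : \int[mu]_x (x ^+ 0 * g x)%:E = 1.
  under eq_integral do rewrite expr0 mul1r.
  exact: integral_normal_pdf.
have m1 : \int[mu]_x (x ^+ 1 * g x)%:E = 0 by rewrite moment_rec// mul0e.
have m2 : \int[mu]_x (x ^+ 2 * g x)%:E = 1 by rewrite moment_rec// m0 mule1.
have m3 : \int[mu]_x (x ^+ 3 * g x)%:E = 0 by rewrite moment_rec// m1 mule0.
have m4 : \int[mu]_x (x ^+ 4 * g x)%:E = 3%:R%:E by rewrite moment_rec// m2 mule1.
by case: k => [|[|[|[|[|]]]]].
Qed.

Lemma std_pdfE (z : R * R) : std_pdf z = (g z.1 * g z.2)%R.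
Proof.
rewrite !std_normalE mulrACA -expRD -mulrDr /std_pdf; congr (_ * _)%R.
rewrite /normal_peak -invfM -expr2 sqr_sqrtr; last first.
  by rewrite expr1n mul1r mulrn_wge0// pi_ge0.
by rewrite expr1n mul1r mulr_natl.
Qed.

Definition bimonomial (p : nat * nat) (z : R * R) : R := (z.1 ^+ p.1 * z.2 ^+ p.2)%R.

Lemma bimonomial_moment (p : nat * nat) : (p.1 <= 4)%N -> (p.2 <= 4)%N ->
  leb2.-integrable setT (fun z => (bimonomial p z * std_pdf z)%:E) /\
  \int[leb2]_z (bimonomial p z * std_pdf z)%:E = (moment p.1 * moment p.2)%:E.
Proof.
case: p => a b /= a4 b4.
pose f (z : MR * MR) : \bar R := (z.1 ^+ a * g z.1)%:E * (z.2 ^+ b * g z.2)%:E.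
have fE : (fun z => (bimonomial (a, b) z * std_pdf z)%:E) = f.
  by apply/funext => z; rewrite /f -EFinM std_pdfE mulrACA.
have ia := @integrable_pow_std_normal R a a4.
have ib := @integrable_pow_std_normal R b b4.
have mf : measurable_fun setT f.
  apply: emeasurable_funM.
    exact: (measurableT_comp (measurable_int _ ia) measurable_fst).
  exact: (measurableT_comp (measurable_int _ ib) measurable_snd).
have fi : leb2.-integrable setT f.
  apply/(integrable12ltyP mu mu mf).
  have [ma la] := integrableP _ _ _ ia; have [mb lb] := integrableP _ _ _ ib.
  have mab : measurable_fun setT (fun x : MR => `|(x ^+ a * g x)%:E|).
    exact: measurableT_comp.
  have mbb : measurable_fun setT (fun x : MR => `|(x ^+ b * g x)%:E|).
    exact: measurableT_comp.
  rewrite (eq_integral (fun x : MR => `|(x ^+ a * g x)%:E| *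
      \int[mu]_y `|(y ^+ b * g y)%:E|)); last first.
    move=> x _; rewrite /= -(ge0_integralT_Zl mu (normr_ge0 _) mbb)//.
    by apply: eq_integral => y _; rewrite /f /= normrM EFinM.
  rewrite ge0_integralZr//; last exact: integral_ge0.
  by rewrite lte_mul_pinfty ?integral_ge0// ge0_fin_numE// integral_ge0.
split; first by rewrite fE.
rewrite -[LHS]/(\int[leb2]_z ((fun z => (bimonomial (a, b) z * std_pdf z)%:E) z)) fE.
rewrite -[LHS](@integral12_prod_meas1 _ _ _ _ R mu mu f fi) /fubini_F /f /=.
under eq_integral do rewrite integralZl// std_normal_moment//.
by rewrite integralZr// std_normal_moment.
Qed.

Lemma bipoly_moment (l : seq (R * (nat * nat))) :
  all (fun p => (p.2.1 <= 4)%N && (p.2.2 <= 4)%N) l ->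
  \int[leb2]_z ((\sum_(p <- l) p.1 * bimonomial p.2 z) * std_pdf z)%:E =
  (\sum_(p <- l) p.1 * (moment p.2.1 * moment p.2.2))%:E.
Proof.
move=> all4.
have E z : (((\sum_(p <- l) p.1 * bimonomial p.2 z) * std_pdf z)%:E =
    \sum_(p <- l) p.1%:E * (bimonomial p.2 z * std_pdf z)%:E)%E.
  rewrite mulr_suml -sumEFin; apply: eq_bigr => p _.
  by rewrite -EFinM -mulrA.
under eq_integral do rewrite E.
elim: l all4 {E} => [_|p l IH /= /andP[/andP[p1 p2] all4]].
  by under eq_integral do rewrite big_nil; rewrite big_nil integral0.
have [ip Ip] := bimonomial_moment p1 p2.
have il : leb2.-integrable setT (fun z =>
    \sum_(q <- l) q.1%:E * (bimonomial q.2 z * std_pdf z)%:E).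
  elim: l all4 {IH} => [_|q l IH /= /andP[/andP[q1 q2] all4]].
    by under eq_fun do rewrite big_nil; exact: integrable0.
  under eq_fun do rewrite big_cons.
  apply: integrableD => //; last exact: IH.
  by apply: integrableZl => //; have [] := bimonomial_moment q1 q2.
under eq_integral do rewrite big_cons.
rewrite integralD//; last exact: integrableZl.
by rewrite IH// integralZl// Ip big_cons EFinD EFinM.
Qed.

End moments.

(** * Scores and the information matrix *)

Section fisher_information.
Context {R : realType}.
Notation MR := (measurableTypeR R).
Notation obs := (MR * MR)%type.

Lemma is_derive_inv (f : R -> R) (x df : R) : f x != 0 -> is_derive x 1 f df ->
  is_derive x 1 (fun v => (f v)^-1) (- df / f x ^+ 2).
Proof.
move=> fx0 dfx; have dV := is_deriveV fx0 dfx.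
by apply: is_derive_eq; rewrite /GRing.scale/=; field.
Qed.

(** In each parameter the density is a positive factor times an exponential, so one logarithmic
    derivative serves all five scores. *)
Lemma derive1_ln_mul_expR (a q : R -> R) (x da dq : R) : 0 < a x ->
  is_derive x 1 a da -> is_derive x 1 q dq ->
  derive1 (fun v => ln (a v * expR (q v))) x = da / a x + dq.
Proof.
move=> ax0 Da Dq.
have De : is_derive x 1 (fun v => expR (q v)) (expR (q x) * dq).
  exact: (is_derive1_comp (is_derive_expR (q x)) Dq).
have Dh : is_derive x 1 (fun v => a v * expR (q v)) _ := is_deriveM Da De.
have h0 : 0 < a x * expR (q x) by rewrite mulr_gt0 ?expR_gt0.
have Dl := is_derive1_comp (f := @ln R) (g := fun v => a v * expR (q v))
  (is_derive1_ln h0) Dh.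
rewrite derive1E (@derive_val _ _ _ _ _ _ _ Dl) /GRing.scale/=.
have := expR_gt0 (q x); move: (expR _) => E E0.
by field; rewrite !lt0r_neq0.
Qed.

Section score.
Variables (m1 m2 b t e : R).
Hypotheses (t0 : 0 < t) (e0 : 0 < e).
Let om := (m1, m2, b, t, e).

Let c0 (u : R) : 0 < u -> 0 < (2 * pi * u)^-1.
Proof. by move=> u0; rewrite invr_gt0 !mulr_gt0// pi_gt0. Qed.

Lemma score_mu1 (x : R * R) : score om i_mu1 x =
  - b * (x.2 - m2 - b * (x.1 - m1)) / (t * e) + e * (x.1 - m1) / t.
Proof.
rewrite /score (_ : par om i_mu1 = m1)//.
pose q v := - 2^-1 * ((x.2 - m2 - b * (x.1 - v)) ^+ 2 / (t * e)
    + e * (x.1 - v) ^+ 2 / t).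
rewrite (_ : (fun v => _) = (fun v => ln ((2 * pi * t)^-1 * expR (q v))))//.
have Dq : is_derive m1 1 q
    (- b * (x.2 - m2 - b * (x.1 - m1)) / (t * e) + e * (x.1 - m1) / t).
  by rewrite /q; apply: is_derive_eq; rewrite /GRing.scale/=;
    field; rewrite !lt0r_neq0.
rewrite (@derive1_ln_mul_expR (fun=> (2 * pi * t)^-1) q m1 0 _ (c0 t0) _ Dq).
by rewrite mul0r add0r.
Qed.

Lemma score_mu2 (x : R * R) : score om i_mu2 x =
  (x.2 - m2 - b * (x.1 - m1)) / (t * e).
Proof.
rewrite /score (_ : par om i_mu2 = m2)//.
pose q v := - 2^-1 * ((x.2 - v - b * (x.1 - m1)) ^+ 2 / (t * e)
    + e * (x.1 - m1) ^+ 2 / t).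
rewrite (_ : (fun v => _) = (fun v => ln ((2 * pi * t)^-1 * expR (q v))))//.
have Dq : is_derive m2 1 q ((x.2 - m2 - b * (x.1 - m1)) / (t * e)).
  by rewrite /q; apply: is_derive_eq; rewrite /GRing.scale/=;
    field; rewrite !lt0r_neq0.
rewrite (@derive1_ln_mul_expR (fun=> (2 * pi * t)^-1) q m2 0 _ (c0 t0) _ Dq).
by rewrite mul0r add0r.
Qed.

Lemma score_beta (x : R * R) : score om i_beta x =
  (x.2 - m2 - b * (x.1 - m1)) * (x.1 - m1) / (t * e).
Proof.
rewrite /score (_ : par om i_beta = b)//.
pose q v := - 2^-1 * ((x.2 - m2 - v * (x.1 - m1)) ^+ 2 / (t * e)
    + e * (x.1 - m1) ^+ 2 / t).
rewrite (_ : (fun v => _) = (fun v => ln ((2 * pi * t)^-1 * expR (q v))))//.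
have Dq : is_derive b 1 q ((x.2 - m2 - b * (x.1 - m1)) * (x.1 - m1) / (t * e)).
  by rewrite /q; apply: is_derive_eq; rewrite /GRing.scale/=;
    field; rewrite !lt0r_neq0.
rewrite (@derive1_ln_mul_expR (fun=> (2 * pi * t)^-1) q b 0 _ (c0 t0) _ Dq).
by rewrite mul0r add0r.
Qed.

Lemma score_theta (x : R * R) : score om i_theta x =
  - t^-1 + 2^-1 * ((x.2 - m2 - b * (x.1 - m1)) ^+ 2 / (t ^+ 2 * e)
    + e * (x.1 - m1) ^+ 2 / t ^+ 2).
Proof.
rewrite /score (_ : par om i_theta = t)//.
pose q v := - 2^-1 * ((x.2 - m2 - b * (x.1 - m1)) ^+ 2 / (v * e)
    + e * (x.1 - m1) ^+ 2 / v).
rewrite (_ : (fun v => _) = (fun v => ln ((2 * pi * v)^-1 * expR (q v))))//.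
have p0 := pi_gt0 R.
have Di : is_derive t 1 (fun v : R => v^-1) (- 1 / t ^+ 2).
  by apply: (is_derive_inv (f := fun v => v)); rewrite lt0r_neq0.
have Die : is_derive t 1 (fun v : R => (v * e)^-1) (- e / (t * e) ^+ 2).
  apply: (is_derive_inv (f := fun v => v * e)); first by rewrite mulf_neq0 ?lt0r_neq0.
  by apply: is_derive_eq; rewrite /GRing.scale/=; ring.
have Da : is_derive t 1 (fun v : R => (2 * pi * v)^-1) (- (2 * pi) / (2 * pi * t) ^+ 2).
  apply: (is_derive_inv (f := fun v => 2 * pi * v)).
    by rewrite !mulf_neq0 ?lt0r_neq0.
  by apply: is_derive_eq; rewrite /GRing.scale/= mulr1.
have Dq : is_derive t 1 q (2^-1 * ((x.2 - m2 - b * (x.1 - m1)) ^+ 2 / (t ^+ 2 * e)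
    + e * (x.1 - m1) ^+ 2 / t ^+ 2)).
  by rewrite /q; apply: is_derive_eq; rewrite /GRing.scale/=;
    field; rewrite !lt0r_neq0.
rewrite (@derive1_ln_mul_expR (fun v => (2 * pi * v)^-1) q t _ _ (c0 t0) Da Dq).
congr (_ + _); move: (pi) p0 => p p0.
by field; rewrite !lt0r_neq0.
Qed.

Lemma score_eta (x : R * R) : score om i_eta x =
  2^-1 * ((x.2 - m2 - b * (x.1 - m1)) ^+ 2 / (t * e ^+ 2) - (x.1 - m1) ^+ 2 / t).
Proof.
rewrite /score (_ : par om i_eta = e)//.
pose q v := - 2^-1 * ((x.2 - m2 - b * (x.1 - m1)) ^+ 2 / (t * v)
    + v * (x.1 - m1) ^+ 2 / t).
rewrite (_ : (fun v => _) = (fun v => ln ((2 * pi * t)^-1 * expR (q v))))//.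
have Die : is_derive e 1 (fun v : R => (t * v)^-1) (- t / (t * e) ^+ 2).
  apply: (is_derive_inv (f := fun v => t * v)); first by rewrite mulf_neq0 ?lt0r_neq0.
  by apply: is_derive_eq; rewrite /GRing.scale/= mulr1.
have Dq : is_derive e 1 q
    (2^-1 * ((x.2 - m2 - b * (x.1 - m1)) ^+ 2 / (t * e ^+ 2) - (x.1 - m1) ^+ 2 / t)).
  by rewrite /q; apply: is_derive_eq; rewrite /GRing.scale/=;
    field; rewrite !lt0r_neq0.
rewrite (@derive1_ln_mul_expR (fun=> (2 * pi * t)^-1) q e 0 _ (c0 t0) _ Dq).
by rewrite mul0r add0r.
Qed.

(* The scores at [gact om z], as polynomials in the standard normal pair [z]:
   lists of terms (coefficient, exponents). *)
Definition score_poly (i : 'I_5) : seq (R * (nat * nat)) :=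
  nth [::] [:: [:: ((Num.sqrt (t / e))^-1, (1, 0)); (- b / Num.sqrt (t * e), (0, 1))];
    [:: ((Num.sqrt (t * e))^-1, (0, 1))];
    [:: (e^-1, (1, 1))];
    [:: (- t^-1, (0, 0)); (2^-1 / t, (2, 0)); (2^-1 / t, (0, 2))];
    [:: (2^-1 / e, (0, 2)); (- 2^-1 / e, (2, 0))]]%N i.

Lemma measurable_score i : measurable_fun [set: obs] (score om i).
Proof.
case: i => -[|[|[|[|[|//]]]]] i5; set i := Ordinal _.
- rewrite (_ : i = i_mu1); last exact: val_inj.
  by rewrite (funext score_mu1); mfun.
- rewrite (_ : i = i_mu2); last exact: val_inj.
  by rewrite (funext score_mu2); mfun.
- rewrite (_ : i = i_beta); last exact: val_inj.
  by rewrite (funext score_beta); mfun.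
- rewrite (_ : i = i_theta); last exact: val_inj.
  by rewrite (funext score_theta); mfun.
- rewrite (_ : i = i_eta); last exact: val_inj.
  by rewrite (funext score_eta); mfun.
Qed.

Lemma score_gact i (z : R * R) : score om i (gact om z) =
  \sum_(p <- score_poly i) p.1 * bimonomial p.2 z.
Proof.
have l1 : 0 < Num.sqrt (t / e) by rewrite sqrtr_gt0 divr_gt0.
have l2 : 0 < Num.sqrt (t * e) by rewrite sqrtr_gt0 mulr_gt0.
have l12 : Num.sqrt (t / e) ^+ 2 = t / e by rewrite sqr_sqrtr// divr_ge0 ?ltW.
have l22 : Num.sqrt (t * e) ^+ 2 = t * e by rewrite sqr_sqrtr// mulr_ge0 ?ltW.
have lt : Num.sqrt (t / e) * Num.sqrt (t * e) = t.
  rewrite -sqrtrM ?divr_ge0 ?ltW// (_ : t / e * (t * e) = t ^+ 2).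
    by rewrite sqrtr_sqr gtr0_norm.
  by field; exact: lt0r_neq0.
have d1 : (gact om z).1 - m1 = Num.sqrt (t / e) * z.1.
  by rewrite /gact /= addrC addKr.
have d2 : (gact om z).2 - m2 - b * ((gact om z).1 - m1) = Num.sqrt (t * e) * z.2.
  by rewrite d1 /gact /=; move: (Num.sqrt _) (Num.sqrt _) => *; ring.
(* [theta] and [eta] become the product and the quotient of the two roots, so that the goals are
   rational identities for [field]. *)
have ep : e = Num.sqrt (t * e) / Num.sqrt (t / e).
  apply: (mulIf (lt0r_neq0 l1)); rewrite divfK ?lt0r_neq0//.
  by apply: (mulIf (lt0r_neq0 l1)); rewrite -mulrA -expr2 l12 [RHS]mulrC lt;
    field; exact: lt0r_neq0.
have E i' : score om i' (gact om z) =
    \sum_(p <- score_poly i') p.1 * bimonomial p.2 z -> i' = i ->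
    score om i (gact om z) = \sum_(p <- score_poly i) p.1 * bimonomial p.2 z.
  by move=> ? <-.
case: i E => -[|[|[|[|[|//]]]]] i5 E;
  [apply: (E i_mu1)|apply: (E i_mu2)|apply: (E i_beta)|apply: (E i_theta)
  |apply: (E i_eta)]; try exact: val_inj;
  rewrite ?(score_mu1, score_mu2, score_beta, score_theta, score_eta) d2 ?d1;
  rewrite /score_poly /= !big_cons big_nil /bimonomial/=;
  move: (Num.sqrt (t / e)) (Num.sqrt (t * e)) l1 l2 lt ep => p q p0 q0 <- ->;
  by field; rewrite !lt0r_neq0.
Qed.

Definition mul_terms (l l' : seq (R * (nat * nat))) :=
  [seq (p.1 * q.1, (p.2.1 + q.2.1, p.2.2 + q.2.2)%N) | p <- l, q <- l'].

(** At [gact om z] a product of two scores is a polynomial in [z] with exponents at most 4, so each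
    entry is a combination of normal moments. *)
Lemma fisher_info_moment i j : fisher_info om i j =
  \sum_(p <- mul_terms (score_poly i) (score_poly j))
    p.1 * (moment p.2.1 * moment p.2.2).
Proof.
have Oom : param_space om by apply/param_spaceP.
rewrite mxE /Rintegral (integral_gact (k := fun x => score om i x * score om j x) Oom);
  last by apply: measurable_funM; exact: measurable_score.
rewrite -[RHS]/(fine (_%:E)) -bipoly_moment.
  congr fine; apply: eq_integral => z _; congr (_ * _)%:E.
  rewrite !score_gact /mul_terms big_allpairs_dep mulr_suml; apply: eq_bigr => p _.
  rewrite mulr_sumr; apply: eq_bigr => q _.
  by rewrite /bimonomial /= !exprD; ring.
by case: i => -[|[|[|[|[|//]]]]] i5; case: j => -[|[|[|[|[|//]]]]] j5.
Qed.

(** A witness for the inverse, verified by multiplication in [fisher_matrixK]. Only the two means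
    are coupled; the other three parameters are orthogonal to everything else. *)
Definition fisher_inverse : 'M[R]_5 := \matrix_(i, j)
  nth 0 (nth [::] [:: [:: t / e; b * t / e; 0; 0; 0];
    [:: b * t / e; t * e + b ^+ 2 * t / e; 0; 0; 0];
    [:: 0; 0; e ^+ 2; 0; 0]; [:: 0; 0; 0; t ^+ 2; 0]; [:: 0; 0; 0; 0; e ^+ 2]] i) j.

Definition fisher_matrix : 'M[R]_5 := \matrix_(i, j)
  nth 0 (nth [::] [:: [:: e / t + b ^+ 2 / (t * e); - b / (t * e); 0; 0; 0];
    [:: - b / (t * e); (t * e)^-1; 0; 0; 0];
    [:: 0; 0; e ^- 2; 0; 0]; [:: 0; 0; 0; t ^- 2; 0]; [:: 0; 0; 0; 0; e ^- 2]] i) j.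

Lemma fisher_infoE : fisher_info om = fisher_matrix.
Proof.
have l1 : 0 < Num.sqrt (t / e) by rewrite sqrtr_gt0 divr_gt0.
have l2 : 0 < Num.sqrt (t * e) by rewrite sqrtr_gt0 mulr_gt0.
have l12 : Num.sqrt (t / e) ^+ 2 = t / e by rewrite sqr_sqrtr// divr_ge0 ?ltW.
have l22 : Num.sqrt (t * e) ^+ 2 = t * e by rewrite sqr_sqrtr// mulr_ge0 ?ltW.
have [t1 e1] : t != 0 /\ e != 0 by rewrite !lt0r_neq0.
have et : e / t = (Num.sqrt (t / e))^-1 ^+ 2 by rewrite exprVn l12 invf_div.
apply/matrixP => i j; rewrite fisher_info_moment mxE et -l22 /score_poly.
move: (Num.sqrt (t / e)) (Num.sqrt (t * e)) l1 l2 => p q p0 q0.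
have [p1 q1] : p != 0 /\ q != 0 by rewrite !lt0r_neq0.
by case: i => -[|[|[|[|[|//]]]]] i5; case: j => -[|[|[|[|[|//]]]]] j5;
  rewrite /mul_terms /= ?big_cons big_nil /moment /=; field; rewrite ?p1 ?q1 ?t1 ?e1.
Qed.

Lemma fisher_matrixK : fisher_matrix *m fisher_inverse = 1%:M.
Proof.
have [t1 e1] : t != 0 /\ e != 0 by rewrite !lt0r_neq0.
apply/matrixP => i j; rewrite !mxE !big_ord_recl big_ord0 !mxE.
by case: i => -[|[|[|[|[|//]]]]] i5; case: j => -[|[|[|[|[|//]]]]] j5;
  rewrite /= ?mulr1n ?mulr0n; field; rewrite ?t1 ?e1.
Qed.

Lemma invmx_fisher_info : invmx (fisher_info om) = fisher_inverse.
Proof.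
have FG := fisher_matrixK; have [uF _] := mulmx1_unit FG.
by rewrite fisher_infoE -[LHS]mulmx1 -FG mulmxA mulVmx// mul1mx.
Qed.

End score.

Lemma inv_infoE (om : R * R * R * R * R) : param_space om ->
  [/\ inv_info om i_beta = par om i_eta ^+ 2,
      inv_info om i_theta = par om i_theta ^+ 2 &
      inv_info om i_eta = par om i_eta ^+ 2].
Proof.
move: om => [[[[m1 m2] b] t] e] /param_spaceP[t0 e0].
by rewrite /inv_info invmx_fisher_info// !mxE.
Qed.

End fisher_information.

(** * Matching *)

Section nonmeasurable_integral.
Context {R : realType} d (T : measurableType d) (P : probability T R).
Local Open Scope ereal_scope.

(** The integral of a nonnegative function is a supremum over simple functions below it, hence
    monotone for arbitrary functions. *)
Lemma ge0_le_integralT (f g : T -> \bar R) : (forall x, 0 <= f x) ->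
  (forall x, f x <= g x) -> \int[P]_x f x <= \int[P]_x g x.
Proof.
move=> f0 fg; have g0 x : 0 <= g x by exact: le_trans (f0 x) (fg x).
rewrite !ge0_integralE//; apply: ge_ereal_sup => _ [h hf <-].
apply: ereal_sup_ubound; exists h => // x; apply: le_trans (hf x) _.
by rewrite !patchE in_setT.
Qed.

(* The integrand need not be measurable: it is squeezed between two measurable
   functions equal to [p] off [Z]. *)
Lemma integral_eq_cst_off_null (f : T -> R) (p : R) (Z : set T) : (0 <= p)%R ->
  (forall x, (0 <= f x)%R) -> measurable Z -> P Z = 0 ->
  (forall x, ~ Z x -> f x = p) -> \int[P]_x (f x)%:E = p%:E.
Proof.
move=> p0 f0 mZ PZ fp.
have mC : measurable (~` Z) by exact: measurableC.
have m1 (A : set T) (c : \bar R) : measurable A ->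
    measurable_fun setT ((cst c : T -> \bar R) \_ A).
  move=> mA; apply/(measurable_restrict _ mA measurableT).
  exact: measurable_cst.
have PC : P (~` Z) = 1 by rewrite probability_setC// PZ sube0.
have Ip : \int[P]_x ((cst p%:E : T -> \bar R) \_ (~` Z)) x = p%:E.
  apply: etrans (esym (integral_mkcond (~` Z) (cst p%:E))) _.
  apply: etrans (integral_cst P mC p%:E) _.
  exact: etrans (congr1 (fun y => p%:E * y) PC) (mule1 _).
have Iz : \int[P]_x ((cst +oo : T -> \bar R) \_ Z) x = 0.
  apply: etrans (esym (integral_mkcond Z (cst +oo))) _.
  apply: etrans (integral_cst P mZ +oo) _.
  exact: etrans (congr1 (fun y => +oo * y) PZ) (mule0 _).
have lo0 x : 0 <= ((cst p%:E : T -> \bar R) \_ (~` Z)) x.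
  by rewrite patchE; case: ifP => _ //=; rewrite lee_fin.
have up0 x : 0 <= ((cst +oo : T -> \bar R) \_ Z) x.
  by rewrite patchE; case: ifP => _ //=.
apply/eqP; rewrite eq_le; apply/andP; split.
  (* The upper bound is [p] off [Z] plus [+oo] on [Z]; the second part has integral 0 because [Z] is
     null. *)
  rewrite -[leRHS]adde0 -{1}Ip -Iz -ge0_integralD//;
    [|exact: m1|exact: m1].
  apply: ge0_le_integralT => x; first by rewrite lee_fin.
  have [Zx|nZx] := pselect (Z x).
    by rewrite [X in _ + X]patchE mem_set//= addey ?leey//
      -ltNye (lt_le_trans _ (lo0 x))// ltNy0.
  by rewrite [X in X + _]patchE mem_set//= [X in _ + X]patchE memNset//= adde0 fp.
rewrite -{1}Ip; apply: ge0_le_integralT => // x; rewrite patchE.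
by case: ifPn => [/set_mem/= nZx|_]; [rewrite fp|exact: f0].
Qed.

End nonmeasurable_integral.

Section matching.
Context {R : realType}.
Notation MR := (measurableTypeR R).
Notation obs := (MR * MR)%type.
Notation param := (MR * MR * MR * MR * MR)%type.

Definition coord (psi : 'I_5) (om : param) : R :=
  if psi == i_beta then om.1.1.2 else if psi == i_theta then om.1.2 else om.2.

Definition scale (psi : 'I_5) (om : param) : R :=
  if psi == i_theta then om.1.2 else om.2.

(** [standardized] with the information in closed form and the estimate as a free argument, hence
    jointly measurable in the pair. *)
Definition root_pivot (n : nat) (psi : 'I_5) (om s : param) : R :=
  Num.sqrt n%:R * (coord psi om - coord psi s) / scale psi om.

Lemma standardizedE n psi (om : param) (x : n.-tuple obs) :
  psi \in [:: i_beta; i_theta; i_eta] -> param_space om ->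
  standardized psi om x = root_pivot n psi om (mle x).
Proof.
move=> hpsi Oom; have [/param_spaceP[t0 e0] [Ib It Ie]] := (Oom, inv_infoE Oom).
have parE (o : R * R * R * R * R) : par o psi = coord psi o.
  by move: hpsi; case: o => -[[[m1 m2] b] t] e;
    rewrite !inE => /or3P[] /eqP ->.
rewrite /standardized /root_pivot !parE; congr (_ / _).
rewrite (_ : inv_info om psi = scale psi om ^+ 2); last first.
  by move: hpsi Ib It Ie; clear; case: om => -[[[m1 m2] b] t] e;
    rewrite !inE => /or3P[] /eqP -> *.
by rewrite sqrtr_sqr ger0_norm// /scale; case: ifP => _; exact: ltW.
Qed.

(** The group multiplies the error of each interest parameter by exactly [scale psi om], which the
    quotient cancels. The point [(0, 0, 0, 1, 1)] is the group identity. *)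
Lemma root_pivot_gmul n psi (om s : param) :
  psi \in [:: i_beta; i_theta; i_eta] -> param_space om ->
  root_pivot n psi om (gmul om s) = root_pivot n psi (0, 0, 0, 1, 1) s.
Proof.
move=> hpsi /param_spaceP[]; rewrite /root_pivot.
case: om s => -[[[m1 m2] b] t] e [[[[n1 n2] c] u] v] /= t0 e0.
have [t1 e1] : t != 0 /\ e != 0 by rewrite !lt0r_neq0.
move: (Num.sqrt n%:R) => r.
by move: hpsi; rewrite !inE => /or3P[] /eqP ->; rewrite /coord /scale /gmul /=;
  field; rewrite ?t1 ?e1.
Qed.

Lemma measurable_root_pivot n psi (w : R) :
  measurable [set z : param * param | root_pivot n psi z.2 z.1 <= w].
Proof.
apply: measurable_set_bool; apply: measurable_fun_ler; last exact: measurable_cst.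
by rewrite /root_pivot /coord /scale; case: (psi == i_beta); case: (psi == i_theta); mfun.
Qed.

Lemma measurable_root_pivot1 n psi (w : R) (e : param) :
  measurable [set s : param | root_pivot n psi e s <= w].
Proof.
apply: measurable_set_bool; apply: measurable_fun_ler; last exact: measurable_cst.
by rewrite /root_pivot /coord /scale; case: (psi == i_beta); case: (psi == i_theta); mfun.
Qed.

Lemma posterior_ge0 n (x : n.-tuple obs) (A : set (R * R * R * R * R)) :
  0 <= posterior x A.
Proof.
have lp0 (om : R * R * R * R * R) : param_space om -> (0 <= (likelihood x om * prior om)%:E)%E.
  move=> Oom; rewrite lee_fin mulr_ge0//.
    by apply: prodr_ge0 => i _; rewrite ltW// binormal_pdf_gt0.
  by rewrite -haarE// haar_ge0.
rewrite /posterior divr_ge0// fine_ge0//; apply: integral_ge0 => om; first by case=> /lp0.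
exact: lp0.
Qed.

Lemma posterior_massE n (x : n.-tuple obs) (A : set (param * param))
    (S : set param) : (0 < n)%N -> nondegenerate x ->
  (forall om, param_space om -> S om <-> A (estimate x, om)) ->
  (\int[leb5]_(om in (param_space : set param) `&` S)
     (likelihood x om * prior om)%:E = posterior_mass n A (estimate x))%E.
Proof.
move=> n0 ndx SA; rewrite integral_mkcond; apply: eq_integral => om _.
have [Oom|nO] := pselect (param_space om); last first.
  by rewrite patchE memNset ?haar_out ?mulr0// => -[].
rewrite patchE haarE//; have [Som|nS] := pselect (S om).
  rewrite mem_set// likelihoodE// indicE mem_set ?mulr1//.
  exact/SA.
rewrite memNset; last by case.
by rewrite indicE memNset ?mulr0 ?mul0r// => /(SA _ Oom).
Qed.

Section fixed_sample_size.
Context d (T : measurableType d) (P : probability T R).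
Variables (om0 : param) (X : nat -> T -> obs) (n : nat) (psi : 'I_5) (w : R).
Hypotheses (O0 : param_space om0) (iidX : iid_sequence P om0 X) (n2 : (2 < n)%N).
Hypothesis hpsi : psi \in [:: i_beta; i_theta; i_eta].

Let n0 : (0 < n)%N. Proof. exact: ltn_trans n2. Qed.
Let mX : forall i, measurable_fun setT (X i). Proof. by have [] := iidX. Qed.
Let V := [set s : param | root_pivot n psi (0, 0, 0, 1, 1) s <= w].
Let A := [set z : param * param | root_pivot n psi z.2 z.1 <= w].
Let mV : measurable V. Proof. exact: measurable_root_pivot1. Qed.
Let AV om s : param_space om -> A (gmul om s, om) <-> V s.
Proof. by move=> Oom; rewrite /A /V /= root_pivot_gmul. Qed.

Let pivot_prob_ge0 : 0 <= pivot_prob P om0 X n V.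
Proof. by rewrite /pivot_prob fine_ge0. Qed.

Lemma expected_posterior :
  (\int[P]_t (posterior (observe X n t)
     [set om | standardized psi om (observe X n t) <= w])%:E
   = (pivot_prob P om0 X n V)%:E)%E.
Proof.
have [Z [mZ PZ HZ]] := posterior_mass_ae O0 iidX n2 (@measurable_root_pivot n psi w) mV AV.
apply: (@integral_eq_cst_off_null _ _ _ _ _ _ Z) => //.
  by move=> t; exact: posterior_ge0.
move=> t /HZ[ndt EA fin]; rewrite /posterior.
rewrite (@posterior_massE _ _ A)//; last first.
  by move=> om Oom /=; rewrite standardizedE// mle_nondegenerate.
(* The normalizing constant is the posterior mass of the full event. *)
rewrite -[X in fine _ / fine (integral _ X _)]setIT (@posterior_massE _ _ setT)//.
have M0 : (0 < posterior_mass n setT (estimate (observe X n t)))%E.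
  by apply: posterior_massT_gt0 => //; exact: estimate_param_space.
move: EA fin M0; rewrite /A /estimator => ->.
case: (posterior_mass n setT _) => [m| |]//= _; rewrite lte_fin => m0.
by rewrite mulfK// lt0r_neq0.
Qed.

Lemma sampling_probability :
  fine (P [set t | standardized psi om0 (observe X n t) <= w])
  = pivot_prob P om0 X n V.
Proof.
pose N := [set t | nondegenerate (observe X n t)].
have mN : measurable N.
  rewrite /N (_ : [set t | _] = [set t | in_param_space (pivot om0 X n t)]).
    apply: measurable_set_bool.
    apply: (measurableT_comp (f := @in_param_space R)); last exact: measurable_pivot iidX.
    by rewrite /in_param_space; mfun.
  by apply/seteqP; split => t /=; rewrite in_param_space_pivot.
have mtV : measurable (pivot om0 X n @^-1` V).
  by apply: measurable_preim mV; exact: measurable_pivot iidX.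
(* On degenerate samples the estimator is the default value, so the event no longer depends on the
   data: [W] is either empty or the whole null set of such samples. *)
pose W := [set t | ~~ nondegenerate (observe X n t) /\
  root_pivot n psi om0 (0, 0, 0, 1, 1) <= w].
have PN : P (~` N) = 0%E.
  rewrite (_ : ~` N = [set t | ~~ nondegenerate (observe X n t)]).
    exact: nondegenerate_ae O0 iidX n2.
  by apply/seteqP; split => t /= /negP.
have [mW PW] : measurable W /\ P W = 0%E.
  have [c|c] := boolP (root_pivot n psi om0 (0, 0, 0, 1, 1) <= w).
    rewrite (_ : W = ~` N); first by split=> //; exact: measurableC.
    by apply/seteqP; split => t /=; [case=> /negP|move=> /negP].
  rewrite (_ : W = set0) ?measure0; first by split.
  by apply/seteqP; split => t //= -[_]; rewrite (negbTE c).
rewrite /pivot_prob; congr fine.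
rewrite (_ : [set t | standardized _ _ _ <= w] = (pivot om0 X n @^-1` V `&` N) `|` W).
  by rewrite measureU0//; exact: measurableI.
apply/seteqP; split => t /=; rewrite standardizedE//.
  have [nd|nd] := boolP (nondegenerate (observe X n t)).
    rewrite mle_nondegenerate// => Ht; left; split=> //.
    apply/(AV _ O0); rewrite /A /= -(estimator_pivot O0 n2)//.
  by rewrite mle_degenerate// => ?; right.
case=> [[Vt nd]|[nd c]]; last by rewrite mle_degenerate.
by rewrite mle_nondegenerate//; move/(AV _ O0): Vt; rewrite /A /= -(estimator_pivot O0 n2).
Qed.

End fixed_sample_size.

End matching.

Theorem mainTheorem2 (R : realType) :
  (forall om : R * R * R * R * R, param_space om ->
    [/\ inv_info om i_beta = par om i_eta ^+ 2,
        inv_info om i_theta = par om i_theta ^+ 2 &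
        inv_info om i_eta = par om i_eta ^+ 2]) /\
  (forall (psi : 'I_5), psi \in [:: i_beta; i_theta; i_eta] ->
   forall (w : R) (om : R * R * R * R * R), param_space om ->
   forall (d : measure_display) (T : measurableType d) (P : probability T R)
     (X : nat -> {RV P >-> (measurableTypeR R * measurableTypeR R)%type}),
     iid_with_density leb2 (binormal_pdf om) X ->
     (fun n : nat => fine 'E_P[fun t =>
        posterior (sample X n t)
          [set om' | standardized psi om' (sample X n t) <= w]] : R^o)
     = (fun n : nat => fine (P [set t | standardized psi om (sample X n t) <= w]) : R^o)
       +o_\oo (fun n : nat => n%:R^-1 : R^o)).
Proof.
split; first exact: inv_infoE.
move=> psi hpsi w om Oom d T P X [indX densX].
have iidX : iid_sequence P om (fun i => X i : T -> _).
  split; [move=> i; exact: measurable_funP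
         |exact: mutually_independent_initially|].
  by move=> i A mA; exact: densX.
(* For [n > 2] the two sides coincide, so their difference is 0 and lies below every multiple of
   [1 / n]. *)
apply/eqaddoP => eps eps0; near=> n.
have n2 : (2 < n)%N by near: n; exact: nbhs_infty_gt.
rewrite !fctE unlock (expected_posterior w Oom iidX n2 hpsi)/=.
by rewrite (sampling_probability w Oom iidX n2 hpsi) subrr normr0 mulr_ge0// ltW.
Unshelve. all: by end_near.
Qed.
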